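(* Let $H$ be a Krull monoid and $\varphi\colon H\to\mathcal F(P)$ a cofinal divisor homomorphism into a free monoid such that the class group $G=\mathcal C(\varphi)$ is an infinite cyclic group, which we identify with $\mathbb Z$. Denote by $G_P\subset G$ the set of classes containing prime divisors and consider the following conditions: (a) $G_P$ is finite or $\min\{|G_P^+|,|G_P^-|\}=1$. (b1) The Structure Theorem for Sets of Lengths holds for $H$ with set $\Delta(G_P)$. (b2) The successive distance $\delta(H)$ is finite. (b3) The monotone catenary degree $\mathsf c_{\mathrm{mon}}(H)$ is finite. (b4) There is an $M\in\mathbb N$ such that, for all $a\in H$ and for each two adjacent lengths $k,l\in\mathsf L(a)\cap[\min\mathsf L(a)+M,\ \max\mathsf L(a)-M]$, we have $\mathsf d(\mathsf Z_k(a),\mathsf Z_l(a))\le M$. (c) $G_P^+$ or $G_P^-$ is finite. Then: 1. Condition (a) implies each of the conditions (b1) to (b4). 2. Each of the conditions (b1) to (b4) implies (c). 3. (b2) $\Rightarrow$ (b3) $\Rightarrow$ (b4).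
   Context: $\mathbb N$ is the set of positive integers, $\mathbb N_0=\mathbb N\cup\{0\}$, and $[a,b]=\{x\in\mathbb Z: a\le x\le b\}$. A monoid is a commutative cancellative semigroup with unit element. For a monoid $H$: $H^\times$ is its group of units, $H_{\mathrm{red}}=\{aH^\times: a\in H\}$, $\mathsf q(H)$ its quotient group, $\mathcal A(H)$ its set of atoms (irreducible elements). $\mathcal F(P)$ is the free abelian monoid with basis $P$, and $|a|=\sum_p\mathsf v_p(a)$ is the length of $a=\prod_p p^{\mathsf v_p(a)}\in\mathcal F(P)$. Krull monoids. A monoid homomorphism $\varphi\colon H\to D$ is a divisor homomorphism if $\varphi(a)\mid\varphi(b)$ implies $a\mid b$; it is cofinal if for every $a\in D$ there is $u\in H$ with $a\mid\varphi(u)$. $H$ is a Krull monoid if there is a divisor homomorphism from $H$ into a free abelian monoid. The class group is $\mathcal C(\varphi)=\mathsf q(D)/\mathsf q(\varphi(H))$, written additively, with $[a]=a\,\mathsf q(\varphi(H))$. For $D=\mathcal F(P)$, $G_P=\{[p]: p\in P\}$. When $\mathcal C(\varphi)=\mathbb Z$, $G_P^+=G_P\cap\mathbb N$ and $G_P^-=G_P\cap(-\mathbb N)$. Factorizations. $\mathsf Z(H)=\mathcal F(\mathcal A(H_{\mathrm{red}}))$, $\pi\colon\mathsf Z(H)\to H_{\mathrm{red}}$ is the homomorphism with $\pi(u)=u$ for atoms $u$; for $a\in H$, $\mathsf Z(a)=\pi^{-1}(aH^\times)$ (also written $\mathsf Z(aH^\times)$), $\mathsf Z_k(a)=\{z\in\mathsf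 Z(a):|z|=k\}$, $\mathsf L(a)=\{|z|: z\in\mathsf Z(a)\}$. $H$ is atomic if all $\mathsf Z(a)\ne\emptyset$. For $z,z'\in\mathsf Z(H)$, $\mathsf d(z,z')=\max\{|z\gcd(z,z')^{-1}|,|z'\gcd(z,z')^{-1}|\}$; for $X,Y\subset\mathsf Z(H)$, $\mathsf d(X,Y)=\min\{\mathsf d(x,y): x\in X,y\in Y\}$, and $\mathsf d(z,Y)=\mathsf d(\{z\},Y)$. Distinct $k,l\in L\subset\mathbb Z$ are adjacent if $L\cap[\min\{k,l\},\max\{k,l\}]=\{k,l\}$; $\Delta(L)$ is the set of all $|k-l|$ with $k,l\in L$ adjacent, and $\Delta(H)=\bigcup_{b\in H}\Delta(\mathsf L(b))$. $\mathcal B(G_P)=\{S\in\mathcal F(G_P):\sigma(S)=0\}$ is the monoid of zero-sum sequences over $G_P$, where $\sigma(S)=\sum_{g}\mathsf v_g(S)g$, and $\Delta(G_P):=\Delta(\mathcal B(G_P))$. Successive distance: for $z\in\mathsf Z(H)$, $\delta(z)$ is the smallest $N\in\mathbb N_0$ such that whenever $k\in\mathbb N$ and $k,|z|$ are adjacent lengths of $\mathsf L(\pi(z))$, then $\mathsf d(z,\mathsf Z_k(\pi(z)))\le N$; $\delta(H)=\sup\{\delta(z): z\in\mathsf Z(H)\}\in\mathbb N_0\cup\{\infty\}$. Monotone catenary degree: $\mathsf c_{\mathrm{mon}}(a)$ is the smallest $N\in\mathbb N_0\cup\{\infty\}$ such that for any $z,z'\in\mathsf Z(a)$ there are $z=z_0,\dots,z_k=z'$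 in $\mathsf Z(a)$ with $\mathsf d(z_{i-1},z_i)\le N$ for all $i\in[1,k]$ and with $|z_0|\le\dots\le|z_k|$ or $|z_0|\ge\dots\ge|z_k|$; $\mathsf c_{\mathrm{mon}}(H)=\sup_{a\in H}\mathsf c_{\mathrm{mon}}(a)$. Structure Theorem: let $d\in\mathbb N$, $M\in\mathbb N_0$, $\{0,d\}\subset\mathcal D\subset[0,d]$. A set $L\subset\mathbb Z$ is an almost arithmetical multiprogression (AAMP) with difference $d$, period $\mathcal D$ and bound $M$ if $L=y+(L'\cup L^*\cup L'')\subset y+\mathcal D+d\mathbb Z$ with $y\in\mathbb Z$, $L^*$ finite and nonempty, $\min L^*=0$, $L^*=(\mathcal D+d\mathbb Z)\cap[0,\max L^*]$, $L'\subset[-M,-1]$, $L''\subset\max L^*+[1,M]$. The Structure Theorem for Sets of Lengths holds for $H$ with set $\Delta^*$ (a finite nonempty subset of $\mathbb N$) if $H$ is atomic and there is $M\in\mathbb N_0$ such that for every $a\in H$ the set $\mathsf L(a)$ is an AAMP with some difference $d\in\Delta^*$ and bound $M$. Convention for (b1): if $\Delta(G_P)=\emptyset$ (in which case all sets of lengths of $H$ are singletons), (b1) is regarded as satisfied. *)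

(* Defs.v *)
From HB Require Import structures.
From mathcomp Require Import all_boot all_order all_algebra.
From mathcomp Require Import finmap multiset.
From mathcomp Require Import generic_quotient ring_quotient.
From mathcomp Require Import boolp classical_sets functions cardinality.

Set Implicit Arguments.
Unset Strict Implicit.
Unset Printing Implicit Defensive.

Import Order.TTheory GRing.Theory Num.Theory.

Local Open Scope mset_scope.
Local Open Scope classical_set_scope.
Local Open Scope quotient_scope.
Local Open Scope card_scope.
Local Open Scope ring_scope.

(* Commutative cancellative monoids are written additively throughout: the
   product a b is a + b, the unit element is 0 and "a divides b" is
   "b = a + c for some c". *)
HB.mixin Record Nmodule_isCancellative M of GRing.Nmodule M := {
  cancel_addI : forall a : M, injective (+%R a)
}.

#[short(type="cmonoidType")]
HB.structure Definition CMonoid :=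
  {M of Nmodule_isCancellative M & GRing.Nmodule M}.

Section Monoids.
Variable M : cmonoidType.
Implicit Types a b : M.

Definition divides a b : Prop := exists c, b = a + c.

Definition is_unit a : Prop := exists b, a + b = 0.

Definition is_atom a : Prop :=
  ~ is_unit a /\ forall b c, a = b + c -> is_unit b \/ is_unit c.

End Monoids.

(* The free abelian monoid F(P) with basis P is {mset P}: v_p(a) is a p, the
   prime p is [mset p], the length |a| is size a, gcd(a, b) is a `&` b. *)
Section FreeMonoid.
Variable P : choiceType.

HB.instance Definition _ :=
  Choice.copy {mset P} {fsfun P -> nat with 0%N}.
HB.instance Definition _ :=
  GRing.isNmodule.Build {mset P}
    (@msetDA P) (@msetDC P) (@mset0D P).

Fact mset_addI (A : {mset P}) : injective (+%R A).
Proof.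
by move=> B C /msetP BC; apply/msetP => x; move: (BC x); rewrite !msetE2 => /addnI.
Qed.

HB.instance Definition _ := Nmodule_isCancellative.Build {mset P} mset_addI.

End FreeMonoid.

Section Reduced.
Variable M : cmonoidType.
Implicit Types a b c : M.

Definition associated : rel M :=
  fun a b => `[< exists2 e, is_unit e & b = a + e >].

Fact associated_equiv : equiv_class_of associated.
Proof.
split=> [a|a b|b a c].
- by apply/asboolP; exists 0; [exists 0; rewrite addr0 | rewrite addr0].
- have sym x y : associated x y -> associated y x.
    move=> /asboolP[e [f ef] ->]; apply/asboolP; exists f.
      by exists e; rewrite addrC.
    by rewrite -addrA ef addr0.
  by apply/idP/idP; apply: sym.
- move=> /asboolP[e [e' ee'] ->] /asboolP[f [f' ff'] ->]; apply/asboolP.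
  exists (e + f); last by rewrite addrA.
  by exists (e' + f'); rewrite addrACA ee' ff' addr0.
Qed.

Canonical associated_equiv_rel := EquivRelPack associated_equiv.
Canonical associated_encModRel := defaultEncModRel associated.

Definition reduced := {eq_quot associated}.
HB.instance Definition _ := EqQuotient.on reduced.
HB.instance Definition _ := Choice.on reduced.

Definition assoc_class (a : M) : reduced := \pi_reduced a.

Fact assoc_classP a b : assoc_class a = assoc_class b <-> exists2 e, is_unit e & b = a + e.
Proof. by rewrite /assoc_class; split=> [/eqP|ab]; [rewrite eqmodE => /asboolP|
  apply/eqP; rewrite eqmodE; apply/asboolP]. Qed.

Fact assoc_class_repr (x : reduced) : assoc_class (repr x) = x.
Proof. exact: reprK. Qed.

Definition red_add (x y : reduced) : reduced := assoc_class (repr x + repr y).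

Fact assoc_class_add a b : red_add (assoc_class a) (assoc_class b) = assoc_class (a + b).
Proof.
have /esym/assoc_classP[e [e' ee'] aE] := assoc_class_repr (assoc_class a).
have /esym/assoc_classP[f [f' ff'] bE] := assoc_class_repr (assoc_class b).
rewrite /red_add aE bE; apply/esym/assoc_classP; exists (e + f); last by rewrite addrACA.
by exists (e' + f'); rewrite addrACA ee' ff' addr0.
Qed.

Fact red_addA : associative red_add.
Proof.
move=> x y z; rewrite -(assoc_class_repr x) -(assoc_class_repr y) -(assoc_class_repr z).
by rewrite !assoc_class_add addrA.
Qed.

Fact red_addC : commutative red_add.
Proof.
by move=> x y; rewrite -(assoc_class_repr x) -(assoc_class_repr y) !assoc_class_add addrC.
Qed.

Fact red_add0 : left_id (assoc_class 0) red_add.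
Proof. by move=> x; rewrite -(assoc_class_repr x) assoc_class_add add0r. Qed.

HB.instance Definition _ :=
  GRing.isNmodule.Build reduced red_addA red_addC red_add0.

Fact red_addI (x : reduced) : injective (+%R x).
Proof.
move=> y z; rewrite -(assoc_class_repr x) -(assoc_class_repr y) -(assoc_class_repr z).
rewrite [LHS]assoc_class_add [RHS]assoc_class_add => /assoc_classP[e ue].
by rewrite -addrA => /cancel_addI yz; apply/assoc_classP; exists e.
Qed.

HB.instance Definition _ := Nmodule_isCancellative.Build reduced red_addI.

End Reduced.

Section QuotientGroup.
Variable M : cmonoidType.
Implicit Types (a b : M) (p q : M * M).

(* The pair (a, b) stands for the fraction a / b. *)
Definition frac_eq : rel (M * M) := fun p q => p.1 + q.2 == q.1 + p.2.

Fact frac_equiv : equiv_class_of frac_eq.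
Proof.
split=> [p|p q|q p r]; first exact: eqxx; first exact: eq_sym.
move=> /eqP pq /eqP qr; apply/eqP/(@cancel_addI _ q.2).
by rewrite addrA (addrC q.2) pq addrAC qr -addrA addrCA.
Qed.

Canonical frac_equiv_rel := EquivRelPack frac_equiv.
Canonical frac_encModRel := defaultEncModRel frac_eq.

Definition qgroup := {eq_quot frac_eq}.
HB.instance Definition _ := EqQuotient.on qgroup.
HB.instance Definition _ := Choice.on qgroup.

Definition frac p : qgroup := \pi_qgroup p.

Fact fracP p q : frac p = frac q <-> p.1 + q.2 = q.1 + p.2.
Proof. by rewrite /frac; split=> [/eqP|pq]; [rewrite eqmodE => /eqP|
  apply/eqP; rewrite eqmodE; apply/eqP]. Qed.

Fact frac_repr (x : qgroup) : frac (repr x) = x.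
Proof. exact: reprK. Qed.

Definition q_add (x y : qgroup) : qgroup :=
  frac ((repr x).1 + (repr y).1, (repr x).2 + (repr y).2).
Definition q_opp (x : qgroup) : qgroup := frac ((repr x).2, (repr x).1).

Fact frac_add p q : q_add (frac p) (frac q) = frac (p.1 + q.1, p.2 + q.2).
Proof.
apply/fracP => /=.
have /fracP pE := frac_repr (frac p); have /fracP qE := frac_repr (frac q).
by rewrite addrACA pE qE addrACA.
Qed.

Fact frac_opp p : q_opp (frac p) = frac (p.2, p.1).
Proof.
apply/fracP => /=; have /fracP pE := frac_repr (frac p).
by rewrite addrC -pE addrC.
Qed.

Fact q_addA : associative q_add.
Proof.
move=> x y z; rewrite -(frac_repr x) -(frac_repr y) -(frac_repr z).
by rewrite !frac_add /= !addrA.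
Qed.

Fact q_addC : commutative q_add.
Proof.
move=> x y; rewrite -(frac_repr x) -(frac_repr y) !frac_add.
by rewrite (addrC (repr x).1) (addrC (repr x).2).
Qed.

Fact q_add0 : left_id (frac (0, 0)) q_add.
Proof. by move=> x; rewrite -(frac_repr x) frac_add /= !add0r -surjective_pairing. Qed.

Fact q_addN : left_inverse (frac (0, 0)) q_opp q_add.
Proof.
move=> x; rewrite -(frac_repr x) frac_opp frac_add; apply/fracP => /=.
by rewrite addr0 add0r addrC.
Qed.

HB.instance Definition _ :=
  GRing.isZmodule.Build qgroup q_addA q_addC q_add0 q_addN.

Definition to_q (a : M) : qgroup := frac (a, 0).

Fact to_qD a b : to_q (a + b) = to_q a + to_q b.
Proof. by rewrite [RHS]frac_add /= addr0. Qed.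

End QuotientGroup.

Section Homomorphisms.
Variables (H D : cmonoidType) (phi : {additive H -> D}).

Definition divisor_hom : Prop :=
  forall a b : H, divides (phi a) (phi b) -> divides a b.

Definition cofinal_hom : Prop := forall a : D, exists u : H, divides a (phi u).

Definition q_image : qgroup D -> bool :=
  fun x => `[< exists a b : H, x = to_q (phi a) - to_q (phi b) >].

Fact q_image_closed : zmod_closed q_image.
Proof.
split=> [|x y]; first by apply/asboolP; exists 0, 0; rewrite subrr.
move=> /asboolP[a [b ->]] /asboolP[c [d ->]]; apply/asboolP.
by exists (a + d), (b + c); rewrite !(raddfD phi) !to_qD opprB opprD addrACA.
Qed.

HB.instance Definition _ :=
  GRing.isZmodClosed.Build (qgroup D) q_image q_image_closed.

Definition class_group := Quotient.quot (GRing.ZmodClosed.clone _ q_image _).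
HB.instance Definition _ := GRing.Zmodule.on class_group.

Definition divisor_class (a : D) : class_group := \pi_class_group (to_q a).

End Homomorphisms.

Definition krull (H : cmonoidType) : Prop :=
  exists (P : choiceType) (phi : {additive H -> {mset P}}), divisor_hom phi.

(* Values in N_0 together with infinity, the latter being None. *)
Notation enat := (option nat).

Definition enat_le (x : enat) (N : nat) : Prop :=
  if x is Some n then (n <= N)%N else False.

(* min A, with min of the empty set being infinity. *)
Definition least (A : set nat) : enat :=
  match pselect (exists n, `[< A n >]) with
  | left h => Some (ex_minn h)
  | right _ => None
  end.

Definition esupremum (A : set enat) : enat :=
  least [set N | forall x, A x -> enat_le x N].

Definition adjacent (L : set int) (k l : int) : Prop :=
  k <> l /\
  L `&` [set x | Num.min k l <= x <= Num.max k l] = [set k; l].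

Definition Delta_set (L : set int) : set nat :=
  [set n | exists k l : int, adjacent L k l /\ n = `|k - l|%N].

Section Factorizations.
Variable H : cmonoidType.

Definition atoms := {u : reduced H | `[< is_atom u >]}.
HB.instance Definition _ := Choice.on atoms.

Local Notation factorizations := {mset atoms}.
Implicit Types (z : factorizations) (x : reduced H) (a : H).

Definition factor_prod z : reduced H := \sum_(u <- finsupp z) val u *+ z u.

(* Z(x), Z_k(x), L(x) for x in H_red; for a in H, take x = assoc_class a *)
Definition Zfact x : set factorizations := [set z | factor_prod z = x].

Definition Zfact_len (k : int) x : set factorizations :=
  [set z | Zfact x z /\ (size z)%:Z = k].

Definition lengths x : set int := [set (size z)%:Z | z in Zfact x].

Definition atomic : Prop := forall a, Zfact (assoc_class a) !=set0.

Definition Delta : set nat := \bigcup_(a in [set: H]) Delta_set (lengths (assoc_class a)).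

Definition dist z z' : nat :=
  maxn (size (z `\` (z `&` z'))%mset) (size (z' `\` (z `&` z'))%mset).

Definition set_dist (X Y : set factorizations) : enat :=
  least [set n | exists z z', [/\ X z, Y z' & n = dist z z']].

Definition succ_dist z : enat :=
  least [set N | forall k : nat, (0 < k)%N ->
    adjacent (lengths (factor_prod z)) k%:Z (size z)%:Z ->
    enat_le (set_dist [set z] (Zfact_len k%:Z (factor_prod z))) N].

Definition succ_dist_monoid : enat := esupremum (range succ_dist).

(* The chain is z_0 = z followed by the entries z_1, ..., z_k of s. *)
Definition monotone_chain (x : reduced H) (N : nat) z z' : Prop :=
  exists s : seq factorizations,
    [/\ (forall y : factorizations, y \in s -> Zfact x y), last z s = z',
        path (fun y y' => (dist y y' <= N)%N) z s &
        path (fun y y' : factorizations => (size y <= size y')%N) z s \/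
        path (fun y y' : factorizations => (size y >= size y')%N) z s].

Definition cmon a : enat :=
  least [set N | forall z z', Zfact (assoc_class a) z -> Zfact (assoc_class a) z' ->
    monotone_chain (assoc_class a) N z z'].

Definition cmon_monoid : enat := esupremum (range cmon).

End Factorizations.

Definition periodic (d : nat) (D : set int) : set int :=
  [set n | exists2 r : int, D r & exists q : int, n = r + d%:Z * q].

Definition AAMP_period (d M : nat) (D L : set int) : Prop :=
  [/\ (0 < d)%N, D 0, D d%:Z, D `<=` [set n | 0 <= n <= d%:Z] &
  exists (y : int) (L1 Ls L2 : set int) (m : int),
    [/\ L = [set y + n | n in L1 `|` Ls `|` L2],
        L `<=` [set y + n | n in periodic d D],
        [/\ finite_set Ls, Ls !=set0, (Ls `&` lbound Ls) 0 &
            (Ls `&` ubound Ls) m],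
        Ls = periodic d D `&` [set n | 0 <= n <= m] &
        L1 `<=` [set n | - M%:Z <= n <= -1] /\
        L2 `<=` [set m + n | n in [set n : int | 1 <= n <= M%:Z]]]].

Definition AAMP (d M : nat) (L : set int) : Prop :=
  exists D : set int, AAMP_period d M D L.

Definition structure_theorem (H : cmonoidType) (Ds : set nat) : Prop :=
  [/\ finite_set Ds, Ds !=set0, Ds `<=` [set d | (0 < d)%N], atomic H &
  exists M : nat, forall a : H, exists2 d, Ds d & AAMP d M (lengths (assoc_class a))].

Section ZeroSum.
Variables (G : zmodType) (G0 : set G).

Definition sigma (S : {mset G0}) : G := \sum_(g <- finsupp S) val g *+ S g.

Definition zero_sum : {pred {mset G0}} := fun S => sigma S == 0.

Fact sigmaE (K : {fset G0}) (S : {mset G0}) :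
  fsubset (finsupp S) K -> sigma S = \sum_(g <- K) val g *+ S g.
Proof.
move=> SK; apply: big_fset_incl => // g _ gS.
by rewrite (fsfun_dflt gS) mulr0n.
Qed.

Fact sigmaD (S T : {mset G0}) : sigma (S + T) = sigma S + sigma T.
Proof.
pose K := (finsupp S `|` finsupp T `|` finsupp (S + T : {mset G0})%R)%fset.
rewrite (@sigmaE K (S + T)%R); last exact: fsubsetUr.
rewrite (@sigmaE K S); last by rewrite /K -fsetUA fsubsetUl.
rewrite (@sigmaE K T); last by rewrite /K (fsetUC (finsupp S)) -fsetUA fsubsetUl.
by rewrite -big_split /=; apply: eq_bigr => g _; rewrite msetE2 mulrnDr.
Qed.

Fact zero_sum_closed : addr_closed zero_sum.
Proof.
split=> [|S T]; rewrite !unfold_in /zero_sum.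
  by apply/eqP; apply: big1 => g _; rewrite mset0E mulr0n.
by rewrite sigmaD => /eqP-> /eqP->; rewrite addr0.
Qed.

Record zero_sum_monoid := ZeroSum {zs_val :> {mset G0}; _ : zero_sum zs_val}.
HB.instance Definition _ := [isSub for zs_val].
HB.instance Definition _ := [Choice of zero_sum_monoid by <:].
HB.instance Definition _ :=
  GRing.SubChoice_isSubNmodule.Build _ _ zero_sum_monoid zero_sum_closed.

Fact zero_sum_addI (S : zero_sum_monoid) : injective (+%R S).
Proof.
move=> T U /(congr1 val); rewrite !raddfD => /cancel_addI; exact: val_inj.
Qed.

HB.instance Definition _ :=
  Nmodule_isCancellative.Build zero_sum_monoid zero_sum_addI.

End ZeroSum.

Section Conditions.
Variables (H : cmonoidType) (GP : set int).

Definition pos_part : set int := GP `&` [set n | 0 < n].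
Definition neg_part : set int := GP `&` [set n | n < 0].

(* The second disjunct is min(|GP^+|, |GP^-|) = 1: one of the two cardinals is
   1 and the other one is at least 1. *)
Definition cond_a : Prop :=
  finite_set GP \/
  ((pos_part #= `I_1) /\ (`I_1 #<= neg_part)) \/
  ((neg_part #= `I_1) /\ (`I_1 #<= pos_part)).

Definition cond_b1 : Prop :=
  Delta (zero_sum_monoid GP) = set0 \/
  structure_theorem H (Delta (zero_sum_monoid GP)).

Definition cond_b2 : Prop := succ_dist_monoid H <> None.

Definition cond_b3 : Prop := cmon_monoid H <> None.

(* lo and hi are min L(a) and max L(a); these exist as L(a) is finite and
   nonempty in a Krull monoid. *)
Definition cond_b4 : Prop :=
  exists2 M : nat, (0 < M)%N &
  forall (a : H) (lo hi k l : int),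
    (lengths (assoc_class a) `&` lbound (lengths (assoc_class a))) lo ->
    (lengths (assoc_class a) `&` ubound (lengths (assoc_class a))) hi ->
    adjacent (lengths (assoc_class a)) k l ->
    lo + M%:Z <= k <= hi - M%:Z -> lo + M%:Z <= l <= hi - M%:Z ->
    enat_le (set_dist (Zfact_len k (assoc_class a)) (Zfact_len l (assoc_class a))) M.

Definition cond_c : Prop := finite_set pos_part \/ finite_set neg_part.

End Conditions.

(* Main.v *)
(* A divisor homomorphism phi identifies H_red with the monoid of multisets of
   primes of weight 0, where the weight w p is the class of p in Z.

   (a) => (b1), (b2): there is a transfer homomorphism onto a monoid of multisets
   over finitely many classes: over G_P if it is finite, and over Z/n if G_P^- is
   {-n} (keep the primes of class >= 0 modulo n and drop the others; dually for
   G_P^+). That monoid has finitely many atoms, and by Dickson's lemma relations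
   between factorizations with a prescribed bounded length difference contain
   bounded ones. This bounds the successive distance and Delta, and yields the
   Structure Theorem: when all coordinates in a set C1 of classes are large, many
   copies of a pair of factorizations of one element realizing the minimal
   distance d over C1 can be forced into any factorization, at bounded cost, and
   then fill all lengths of a given residue modulo d.

   (b1), (b4) => (c): if G_P^+ and G_P^- are infinite, take small classes g, -h
   and large ones G >> H. Every factorization of the square of
   G^h (-h)^G (-H)^g g^H times a fixed element has either few atoms or very many,
   according to whether some atom contains both G and -H.

   (b2) => (b3): (b2) implies (b4), hence (c), say G_P^- is finite. Then atoms
   have boundedly many primes of class >= 0. Given factorizations z, z' of the same
   length, an averaging argument finds an atom U of z' with few primes of each
   negative class relative to the number of atoms, so that boundedly many atoms of
   z together contain U up to exchanging primes of equal class. Refactoring them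
   makes the two share an atom; cancel it, correct the length using (b2) and
   induct. *)

Require Import Defs.
From mathcomp Require Import all_boot all_order all_algebra.
From mathcomp Require Import finmap multiset.
From mathcomp Require Import boolp classical_sets functions cardinality.
From mathcomp Require Import zify.

Local Open Scope mset_scope.
Local Open Scope classical_set_scope.
Local Open Scope ring_scope.

Set Implicit Arguments.
Unset Strict Implicit.
Unset Printing Implicit Defensive.

Import Order.TTheory GRing.Theory Num.Theory.

(** * Multisets and factorizations in saturated submonoids *)

Section Multisets.
Variable K : choiceType.
Implicit Types (A B C : {mset K}) (s : seq {mset K}).

Lemma msetDE A B x : (A + B)%R x = (A x + B x)%N.
Proof. by rewrite msetE2. Qed.

Lemma mset_ext A B : (forall x, A x = B x) -> A = B.
Proof. by move=> h; apply/msetP. Qed.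

Lemma mset0RE x : (0 : {mset K}) x = 0%N.
Proof. exact: mset0E. Qed.

Lemma perm_msetD A B : perm_eq (A + B : {mset K}) ((A : seq K) ++ B).
Proof.
apply/allP => x _ /=; rewrite count_cat !count_mem_mset.
by rewrite msetDE.
Qed.

Lemma size_msetD A B : size (A + B : {mset K}) = (size A + size B)%N.
Proof. by rewrite (perm_size (perm_msetD A B)) size_cat. Qed.

Lemma size_mset_eq0R A : size A = 0%N -> A = 0.
Proof. by move/eqP; rewrite size_mset_eq0 => /eqP. Qed.

Lemma size_mset0R : size (0 : {mset K}) = 0%N.
Proof. exact: size_mset0. Qed.

Lemma size_mset1 (x : K) : size [mset x] = 1%N.
Proof. by rewrite enum_msetn. Qed.

Lemma mset_addI0 A B : A + B = 0 -> A = 0 /\ B = 0.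
Proof.
move=> /(congr1 (fun C : {mset K} => size C)); rewrite size_msetD size_mset0R.
by move/eqP; rewrite addn_eq0 => /andP[/eqP a /eqP b]; split; apply: size_mset_eq0R.
Qed.

Lemma mset_le A B : (forall x, (A x <= B x)%N) -> exists C, B = A + C.
Proof.
move=> h; exists (B `\` A)%mset; apply/mset_ext => x.
by rewrite msetDE msetE2 subnKC.
Qed.

Lemma mset_mem A x : (0 < A x)%N -> exists C, A = [mset x] + C.
Proof.
move=> h; apply: mset_le => y; rewrite msetnE.
by case: eqP => [->|].
Qed.

Lemma mset1E (x y : K) : [mset x] y = (y == x).
Proof. by rewrite msetnE; case: eqP. Qed.

Lemma mset_ind (Q : {mset K} -> Prop) :
  Q 0 -> (forall x A, Q A -> Q ([mset x] + A)) -> forall A, Q A.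
Proof.
move=> Q0 QS A; have [n] := ubnP (size A); elim: n A => // n IH A.
have [->//|/eqP A0 sA] := eqVneq A 0.
have /hasP[x xA _] : has predT A.
  by rewrite has_predT lt0n; apply/eqP => /size_mset_eq0R.
have [C AC] : exists C, A = [mset x] + C.
  by apply: mset_mem; rewrite mset_gt0.
rewrite AC; apply/QS/IH.
by move: sA; rewrite AC size_msetD size_mset1.
Qed.

(** Riesz refinement of two decompositions of one element of a free abelian monoid: [C] takes as
    much from [A] as it can, and the rest from [B]. *)
Lemma riesz A B C R : C + R = A + B ->
  exists A1 A2 B1 B2, [/\ C = A1 + B1, R = A2 + B2, A = A1 + A2 & B = B1 + B2].
Proof.
move=> e.
have ex x : (C x + R x = A x + B x)%N by rewrite -!msetDE e.
exists (C `&` A)%mset, (A `\` C)%mset, (C `\` A)%mset, (B `\` (C `\` A))%mset.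
by split; apply/mset_ext => x; rewrite !msetE2; have := ex x; lia.
Qed.

Lemma sum_msetE s x : (\sum_(U <- s) U) x = (\sum_(U <- s) U x)%N.
Proof.
elim: s => [|U s IH]; first by rewrite !big_nil mset0RE.
by rewrite !big_cons msetDE IH.
Qed.

Lemma size_sum_mset s : size (\sum_(U <- s) U : {mset K}) = (\sum_(U <- s) size U)%N.
Proof.
elim: s => [|U s IH]; first by rewrite !big_nil size_mset0R.
by rewrite !big_cons size_msetD IH.
Qed.

Lemma riesz_seq s A B : \sum_(U <- s) U = A + B ->
  exists t : seq ({mset K} * {mset K}),
    [/\ s = [seq c.1 + c.2 | c <- t], \sum_(c <- t) c.1 = A & \sum_(c <- t) c.2 = B].
Proof.
elim: s A B => [|U s IH] A B.
  rewrite big_nil => /esym/mset_addI0[-> ->]; exists [::]; by rewrite !big_nil.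
rewrite big_cons => /riesz[A1 [A2 [B1 [B2 [-> e -> ->]]]]].
have [t [-> <- <-]] := IH _ _ e.
by exists ((A1, B1) :: t); rewrite /= !big_cons.
Qed.

(** The additive extension of [f] to the free monoid. Integer values give weights, multiset values
    give homomorphisms between free monoids. *)
Definition msum (V : nmodType) (f : K -> V) A : V := \sum_(p <- (A : seq K)) f p.

Lemma msum0 (V : nmodType) (f : K -> V) : msum f 0 = 0.
Proof. by rewrite /msum enum_mset0 big_nil. Qed.

Lemma msumD (V : nmodType) (f : K -> V) A B : msum f (A + B) = msum f A + msum f B.
Proof. by rewrite /msum (perm_big _ (perm_msetD A B)) big_cat. Qed.

Lemma msum1 (V : nmodType) (f : K -> V) x : msum f [mset x] = f x.
Proof. by rewrite /msum enum_msetn /= big_seq1. Qed.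

Lemma msum_sum (V : nmodType) (f : K -> V) s :
  msum f (\sum_(U <- s) U) = \sum_(U <- s) msum f U.
Proof.
elim: s => [|U s IH]; first by rewrite !big_nil msum0.
by rewrite !big_cons msumD IH.
Qed.

Lemma msumMn (V : nmodType) (f : K -> V) A n : msum f (A *+ n) = msum f A *+ n.
Proof.
elim: n => [|n IH]; first by rewrite !mulr0n msum0.
by rewrite !mulrS msumD IH.
Qed.

End Multisets.

Section Saturated.
Variable K : choiceType.
Implicit Types (Z : {mset K} -> Prop) (S T U A B : {mset K}) (s t x y : seq {mset K}).

(** These are the submonoids of a free monoid whose inclusion is a divisor homomorphism. *)
Definition saturated Z : Prop :=
  [/\ Z 0, forall S T, Z S -> Z T -> Z (S + T) & forall S T, Z S -> Z (S + T) -> Z T].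

Definition zatom Z U : Prop :=
  [/\ Z U, U <> 0 & forall A B, U = A + B -> Z A -> Z B -> A = 0 \/ B = 0].

Definition zfact Z S s : Prop :=
  (forall U, U \in s -> zatom Z U) /\ \sum_(U <- s) U = S.

Definition zlen Z S : set nat := [set n | exists2 s, zfact Z S s & size s = n].

Variable Z : {mset K} -> Prop.
Hypothesis satZ : saturated Z.

Lemma zsum s : (forall U, U \in s -> Z U) -> Z (\sum_(U <- s) U).
Proof.
move=> h; rewrite big_seq; apply: big_ind => //; by case: satZ.
Qed.

Lemma zfactZ S s : zfact Z S s -> Z S.
Proof. by move=> [h <-]; apply: zsum => U /h[]. Qed.

Lemma zfact_cat S T s t : zfact Z S s -> zfact Z T t -> zfact Z (S + T) (s ++ t).
Proof.
move=> [hs <-] [ht <-]; split; last by rewrite big_cat.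
by move=> U; rewrite mem_cat => /orP[/hs|/ht].
Qed.

Lemma zfact_catl S s t : zfact Z S (s ++ t) -> zfact Z (\sum_(U <- s) U) s.
Proof. by move=> [h _]; split=> // U Us; apply: h; rewrite mem_cat Us. Qed.

Lemma zfact_catr S s t : zfact Z S (s ++ t) -> zfact Z (\sum_(U <- t) U) t.
Proof. by move=> [h _]; split=> // U Us; apply: h; rewrite mem_cat Us orbT. Qed.

Lemma zfact_perm S s t : perm_eq s t -> zfact Z S s -> zfact Z S t.
Proof.
move=> p [h <-]; split; last by rewrite (perm_big _ p).
by move=> U; rewrite -(perm_mem p); apply: h.
Qed.

Lemma zfact_nil : zfact Z 0 [::].
Proof. by split=> //; rewrite big_nil. Qed.

Lemma zfact1 U : zatom Z U -> zfact Z U [:: U].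
Proof. by move=> h; split; rewrite ?big_seq1// => V; rewrite inE => /eqP->. Qed.

Lemma zatom_size U : zatom Z U -> (0 < size U)%N.
Proof. by move=> [_ U0 _]; rewrite lt0n; apply/eqP => /size_mset_eq0R. Qed.

Lemma zfact_size S s : zfact Z S s -> (size s <= size S)%N.
Proof.
move=> [h <-]; rewrite size_sum_mset -sum1_size !big_seq.
by apply: leq_sum => U /h/zatom_size.
Qed.

Lemma zfact_exists S : Z S -> exists s, zfact Z S s.
Proof.
have [n] := ubnP (size S); elim: n S => // n IH S sS ZS.
have [->|/eqP S0] := eqVneq S 0; first by exists [::]; apply: zfact_nil.
have [aS|naS] := pselect (zatom Z S); first by exists [:: S]; apply: zfact1.
have [A [B [SE ZA ZB A0 B0]]] : exists A B, [/\ S = A + B, Z A, Z B, A != 0 & B != 0].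
  apply: contrapT => h; apply: naS; split=> // A B SE ZA ZB.
  have [->|A0] := eqVneq A 0; first by left.
  have [->|B0] := eqVneq B 0; first by right.
  by case: h; exists A, B.
have sA : (0 < size A)%N by rewrite lt0n; apply/eqP => /size_mset_eq0R/eqP; apply/negP.
have sB : (0 < size B)%N by rewrite lt0n; apply/eqP => /size_mset_eq0R/eqP; apply/negP.
move: sS; rewrite SE size_msetD => sS.
have [s fs] := IH A ltac:(lia) ZA; have [t ft] := IH B ltac:(lia) ZB.
by exists (s ++ t); apply: zfact_cat.
Qed.

(** By saturation the cofactor of [A] in [U] lies in [Z], so irreducibility of [U] kills it: atoms
    are the minimal nonzero elements of [Z]. *)
Lemma zatom_eq U A : zatom Z U -> Z A -> A <> 0 -> (forall p, (A p <= U p)%N) -> U = A.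
Proof.
move=> [ZU U0 h] ZA A0 /mset_le[B UB].
have ZB : Z B by case: satZ => _ _; apply; [exact: ZA|rewrite -UB].
by case: (h _ _ UB ZA ZB) => [//|B0]; rewrite UB B0 addr0.
Qed.

(* Each prime of T lies in some factor, so |T| of the factors already cover T. *)
Lemma zfact_cover T R s : \sum_(U <- s) U = T + R ->
  exists s0 s1 R0, [/\ perm_eq s (s0 ++ s1), (size s0 <= size T)%N &
    \sum_(U <- s0) U = T + R0].
Proof.
move=> /riesz_seq[t [-> <- _]] {T R}; pose P := fun c : {mset K} * {mset K} => c.1 != 0.
pose f := fun c : {mset K} * {mset K} => c.1 + c.2.
have e : \sum_(c <- t) c.1 = \sum_(c <- filter P t) c.1.
  rewrite (bigID P) /= big_filter [X in _ + X]big1 ?addr0//.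
  by move=> c /negPn/eqP.
exists (map f (filter P t)), (map f (filter (predC P) t)), (\sum_(c <- filter P t) c.2).
split.
- by rewrite -map_cat perm_map// perm_sym perm_filterC.
- rewrite size_map e -(big_map fst predT id) size_sum_mset big_map.
  rewrite -sum1_size !big_seq; apply: leq_sum => c.
  rewrite mem_filter => /andP[/eqP c0 _].
  by rewrite lt0n; apply/eqP => /size_mset_eq0R.
- by rewrite big_map e big_split.
Qed.

End Saturated.

Lemma saturatedMn (K : choiceType) (Z : {mset K} -> Prop) (S : {mset K}) n :
  saturated Z -> Z S -> Z (S *+ n).
Proof.
move=> [Z0 ZD _] ZS; elim: n => [|n IH]; first by rewrite mulr0n.
by rewrite mulrS; apply: ZD.
Qed.

(** * Finiteness from Dickson's lemma *)

Lemma uniform_bound (I : eqType) (Q : I -> nat -> Prop) (s : seq I) :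
  (forall i m n, (m <= n)%N -> Q i m -> Q i n) -> (forall i, i \in s -> exists m, Q i m) ->
  exists m, forall i, i \in s -> Q i m.
Proof.
move=> mono; elim: s => [|i s IH] h; first by exists 0%N.
have [m hm] := h i (mem_head _ _).
have [n hn] := IH (fun k ks => h k (mem_behead (s := i :: s) ks)).
exists (maxn m n) => k; rewrite inE => /orP[/eqP->|/hn].
  by apply: mono hm; exact: leq_maxl.
by apply: mono; exact: leq_maxr.
Qed.

(** Dickson's lemma. If [l1] settles the functions in [fs] and [k] bounds [f] on [l1], then elements
    with [f x >= k] lie above a member of [l1]; the finitely many slices [f x = j] with [j < k] are
    settled one by one. *)
Lemma dickson (X : eqType) (fs : seq (X -> nat)) (Q : X -> Prop) :
  exists l : seq X, (forall x, x \in l -> Q x) /\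
    forall x, Q x -> exists2 x0, x0 \in l & all (fun f : X -> nat => f x0 <= f x)%N fs.
Proof.
elim: fs Q => [|f fs IH] Q.
  have [[x Qx]|nQ] := pselect (exists x, Q x).
    exists [:: x]; split=> [y|y _]; first by rewrite inE => /eqP->.
    by exists x; rewrite ?inE.
  by exists [::]; split=> // x Qx; case: nQ; exists x.
have [l1 [l1Q l1P]] := IH Q.
pose k := \max_(x <- l1) f x.
have [l2 [l2Q l2P]] : exists l2 : seq X, (forall x, x \in l2 -> Q x) /\
    forall x, Q x -> (f x < k)%N -> exists2 x0, x0 \in l2 &
      all (fun f : X -> nat => f x0 <= f x)%N (f :: fs).
  elim: k => [|k [l [lQ lP]]]; first by exists [::].
  have [m [mQ mP]] := IH (fun x => Q x /\ f x = k).
  exists (l ++ m); split=> [x|x Qx].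
    by rewrite mem_cat => /orP[/lQ|/mQ[]].
  rewrite ltnS leq_eqVlt => /orP[/eqP fx|fx].
    have [x0 x0m x0P] := mP x (conj Qx fx).
    exists x0; first by rewrite mem_cat x0m orbT.
    by have [_ /= ->] := mQ _ x0m; rewrite fx leqnn.
  by have [x0 x0l x0P] := lP x Qx fx; exists x0 => //; rewrite mem_cat x0l.
exists (l1 ++ l2); split=> [x|x Qx].
  by rewrite mem_cat => /orP[/l1Q|/l2Q].
have [fx|fx] := ltnP (f x) k.
  by have [x0 x0l x0P] := l2P x Qx fx; exists x0 => //; rewrite mem_cat x0l orbT.
have [x0 x0l x0P] := l1P x Qx; exists x0; first by rewrite mem_cat x0l.
by rewrite /= x0P andbT (leq_trans _ fx)// /k leq_bigmax_seq.
Qed.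

Lemma count_perm_cat (T : eqType) (a x0 x : seq T) :
  {subset x0 <= a} -> (forall u, u \in a -> count_mem u x0 <= count_mem u x)%N ->
  exists x1, perm_eq x (x0 ++ x1).
Proof.
move=> sub h.
have /count_subseqP[s /perm_to_subseq[x1 p] q] :
    forall u, (count_mem u x0 <= count_mem u x)%N.
  move=> u; have [/h//|ua] := boolP (u \in a).
  rewrite (count_memPn _)//; apply: contra ua; exact: sub.
by exists x1; rewrite (perm_trans p)// perm_cat2r perm_sym.
Qed.

Lemma flatten_nseq_size (T : Type) n (s : seq T) :
  size (flatten (nseq n s)) = (n * size s)%N.
Proof. by elim: n => [//|n IH]; rewrite /= size_cat IH mulSn. Qed.

Section FiniteSupport.
Variables (K : choiceType) (Z : {mset K} -> Prop) (C : seq K).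
Implicit Types (S T U R e : {mset K}) (s t x y z p q : seq {mset K}).
Hypothesis satZ : saturated Z.
Hypothesis suppZ : forall S, Z S -> forall c, (0 < S c)%N -> c \in C.

Lemma zatoms_finite : exists a : seq {mset K}, forall U, zatom Z U -> U \in a.
Proof.
have [l [lQ lP]] := dickson [seq (fun S : {mset K} => S c) | c <- C]
  (fun S : {mset K} => Z S /\ S <> 0).
exists l => U aU; case: (aU) => ZU U0 _.
have [A Al] := lP U (conj ZU U0); rewrite all_map => /allP hA.
have [ZA A0] := lQ _ Al.
suff -> : U = A by [].
apply: (zatom_eq satZ aU) => // c.
have [cC|cC] := boolP (c \in C); first exact: hA.
by rewrite leqNgt; apply: contra cC => cA; apply: (suppZ ZA); lia.
Qed.

Lemma zatom_size_bound : exists A : nat, forall U, zatom Z U -> (size U <= A)%N.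
Proof.
have [a aP] := zatoms_finite; exists (\max_(U <- a) size U) => U /aP Ua.
exact: leq_bigmax_seq.
Qed.

(** Pairs of factorizations of one element are compared by the multiplicities of the finitely many
    atoms. Every pair satisfying [Q] contains one of finitely many such pairs, which again satisfies
    [Q]. *)
Lemma zfact_pair_dickson (Q : seq {mset K} -> seq {mset K} -> Prop) :
  exists B : nat, forall S x y, zfact Z S x -> zfact Z S y -> Q x y ->
    exists x0 x1 y0 y1, [/\ perm_eq x (x0 ++ x1), perm_eq y (y0 ++ y1),
      \sum_(U <- x0) U = \sum_(U <- y0) U, Q x0 y0 & (size x0 <= B)%N /\ (size y0 <= B)%N].
Proof.
have [a aP] := zatoms_finite.
pose X := (seq {mset K} * seq {mset K})%type.
pose fs : seq (X -> nat) :=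
  [seq (fun z : X => count_mem U z.1) | U <- a] ++ [seq (fun z : X => count_mem U z.2) | U <- a].
have [l [lQ lP]] := dickson fs (fun z : X => (exists S, zfact Z S z.1 /\ zfact Z S z.2) /\ Q z.1 z.2).
exists (\max_(z <- l) (size z.1 + size z.2)%N) => S x y fx fy qxy.
have [[x0 y0] l0] := lP (x, y) (conj (ex_intro _ S (conj fx fy)) qxy).
rewrite all_cat !all_map => /andP[/allP /= hx /allP /= hy].
have [[T /= [[ax0 ex0] [ay0 ey0]]] q0] := lQ _ l0.
have [x1 px] : exists x1, perm_eq x (x0 ++ x1).
  by apply: (@count_perm_cat _ a) => [U /ax0/aP|U Ua]//; apply: hx.
have [y1 py] : exists y1, perm_eq y (y0 ++ y1).
  by apply: (@count_perm_cat _ a) => [U /ay0/aP|U Ua]//; apply: hy.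
exists x0, x1, y0, y1; split=> //; first by rewrite ex0 ey0.
have := @leq_bigmax_seq _ l predT (fun z : X => (size z.1 + size z.2)%N) _ l0 isT.
by rewrite /=; lia.
Qed.

(** With [Q] the strict increase of length, trading [x0] for [y0] in [x] lengthens it by a positive
    and bounded amount. *)
Lemma zlen_gap_bound : exists2 G, (0 < G)%N & forall S m n, zlen Z S m -> zlen Z S n ->
  (m < n)%N -> exists k, [/\ zlen Z S k, (m < k)%N & (k <= m + G)%N].
Proof.
have [B hB] := zfact_pair_dickson (fun x y => size x < size y)%N.
exists B.+1 => // S _ _ [x fx <-] [y fy <-] xy.
have [x0 [x1 [y0 [y1 [px py e q0 [sx sy]]]]]] := hB _ _ _ fx fy xy.
have sp : size x = (size x0 + size x1)%N by rewrite (perm_size px) size_cat.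
rewrite /= in q0; exists (size y0 + size x1)%N; split; try lia.
exists (y0 ++ x1); last by rewrite size_cat.
have [ax ex] := zfact_perm px fx; have [ay ey] := zfact_perm py fy.
split; last by rewrite -ex !big_cat /= e.
by move=> U; rewrite mem_cat => /orP[Uy|Ux]; [apply: ay|apply: ax]; rewrite mem_cat ?Uy ?Ux ?orbT.
Qed.

(** With [Q] a fixed difference of lengths, the small pair has the same difference, so trading [x0]
    for [y0] turns [x] into a factorization of exactly the length of [y]. *)
Lemma zfact_exchange_bound D : exists B : nat, forall S x y, zfact Z S x -> zfact Z S y ->
  (size x <= size y + D)%N -> (size y <= size x + D)%N ->
  exists x0 x1 y0, [/\ perm_eq x (x0 ++ x1), zfact Z (\sum_(U <- x0) U) y0,
    (size y0 + size x1 = size y)%N & (size x0 <= B)%N /\ (size y0 <= B)%N].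
Proof.
(* A pair [(i, j)] encodes the difference [i - j] between the lengths of [y] and [x], without
   subtraction in [nat]. *)
pose I := ('I_D.+1 * 'I_D.+1)%type.
pose Q (ij : I) B := forall S x y, zfact Z S x -> zfact Z S y ->
  (size x + ij.1 = size y + ij.2)%N ->
  exists x0 x1 y0, [/\ perm_eq x (x0 ++ x1), zfact Z (\sum_(U <- x0) U) y0,
    (size y0 + size x1 = size y)%N & (size x0 <= B)%N /\ (size y0 <= B)%N].
have [||B hB] := @uniform_bound _ Q (enum [set: I]).
- move=> ij m n mn h S x y fx fy e.
  have [x0 [x1 [y0 [p f s [s1 s2]]]]] := h S x y fx fy e.
  by exists x0, x1, y0; split=> //; lia.
- move=> [i j] _.
  have [B hB] := zfact_pair_dickson (fun x y => size x + i = size y + j)%N.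
  exists B => S x y fx fy xy.
  have [x0 [x1 [y0 [y1 [px py e q0 s0]]]]] := hB _ _ _ fx fy xy.
  exists x0, x1, y0; split=> //; last first.
    have spx : size x = (size x0 + size x1)%N by rewrite (perm_size px) size_cat.
    have spy : size y = (size y0 + size y1)%N by rewrite (perm_size py) size_cat.
    by rewrite /= in q0 xy; lia.
  by rewrite e; apply: zfact_catl (zfact_perm py fy).
exists B => S x y fx fy xy yx.
have i1 : (size y - size x < D.+1)%N by lia.
have i2 : (size x - size y < D.+1)%N by lia.
by apply: (hB (Ordinal i1, Ordinal i2)) fx fy _; rewrite ?mem_enum ?inE//=; lia.
Qed.

End FiniteSupport.

(** * Lengths over finitely many primes *)

Definition zDelta (K : choiceType) (Z : {mset K} -> Prop) : set nat :=
  [set d | exists S m, [/\ zlen Z S m, zlen Z S (m + d)%N, (0 < d)%N &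
    forall k, zlen Z S k -> ~ (m < k < m + d)%N]].

Section Lengths.
Variables (K : choiceType) (Z : {mset K} -> Prop) (C : seq K).
Implicit Types (S T U R e : {mset K}) (s t x y z p q : seq {mset K}).
Hypothesis satZ : saturated Z.
Hypothesis suppZ : forall S, Z S -> forall c, (0 < S c)%N -> c \in C.

Lemma zfact_nseq S n s : zfact Z S s -> zfact Z (S *+ n) (flatten (nseq n s)).
Proof.
move=> f; elim: n => [|n IH]; first by rewrite mulr0n; apply: zfact_nil.
by rewrite mulrS /=; apply: zfact_cat.
Qed.

Lemma msetMnE S n c : (S *+ n) c = (n * S c)%N.
Proof.
elim: n => [|n IH]; first by rewrite mulr0n mset0RE.
by rewrite mulrS msetDE IH mulSn.
Qed.

Lemma size_msetMn S n : size (S *+ n : {mset K}) = (n * size S)%N.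
Proof.
elim: n => [|n IH]; first by rewrite mulr0n size_mset0R.
by rewrite mulrS size_msetD IH mulSn.
Qed.

Lemma mset_le_size S c : (S c <= size S)%N.
Proof. by rewrite -count_mem_mset count_size. Qed.

Lemma zfact_pull m S T R x t : (forall U, zatom Z U -> (size U <= m)%N) ->
  zfact Z S x -> S = T + R -> zfact Z T t ->
  exists r, [/\ zfact Z R r, (size r + size t <= size x + m.+1 * size T)%N &
    (size x <= size r + m.+1 * size T)%N].
Proof.
move=> hm fx ST ft; have [ax ex] := fx.
have [x0 [x1 [R0 [px sx0 e0]]]] : exists s0 s1 R0, [/\ perm_eq x (s0 ++ s1),
    (size s0 <= size T)%N & \sum_(U <- s0) U = T + R0].
  by apply: (@zfact_cover _ T R x); rewrite ex.
have fp := zfact_perm px fx; have f1 := zfact_catr fp.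
have ZR0 : Z R0.
  case: satZ => _ _; apply; first exact: zfactZ ft.
  by rewrite -e0; apply: zfactZ (zfact_catl fp).
have [r0 fr0] := zfact_exists ZR0.
have RE : R = R0 + \sum_(U <- x1) U.
  apply: (@cancel_addI _ T); rewrite -ST addrA -e0 -ex (perm_big _ px).
  by rewrite big_cat.
have sR0 : (size R0 <= m * size T)%N.
  have le1 : (size R0 <= \sum_(U <- x0) size U)%N.
    by rewrite -size_sum_mset e0 size_msetD leq_addl.
  have le2 : (\sum_(U <- x0) size U <= \sum_(U <- x0) m)%N.
    rewrite !big_seq; apply: leq_sum => U Ux0; apply/hm/ax.
    by rewrite (perm_mem px) mem_cat Ux0.
  apply: (leq_trans (leq_trans le1 le2)).
  by rewrite big_const_seq count_predT iter_addn_0 leq_mul2l sx0 orbT.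
have sr0 := zfact_size fr0; have st := zfact_size ft.
have sp : size x = (size x0 + size x1)%N by rewrite (perm_size px) size_cat.
exists (r0 ++ x1); split; first by rewrite RE; apply: zfact_cat.
- by rewrite size_cat sp mulSn; lia.
- by rewrite size_cat sp mulSn; lia.
Qed.

Lemma count_mset_le (C1 : seq K) S n : Z S -> (forall c, c \notin C1 -> (S c <= n)%N) ->
  (count (predC (mem C1)) S <= n * size C)%N.
Proof.
move=> ZS h.
suff le (A : {mset K}) : (forall c, (0 < A c)%N -> c \in C) ->
    (count (predC (mem C1)) A <= \sum_(c <- C | c \notin C1) A c)%N.
  apply: leq_trans (le _ (suppZ ZS)) _.
  rewrite -[X in (_ <= X)%N](_ : \sum_(c <- C) n = n * size C)%N; last first.
    by rewrite big_const_seq count_predT iter_addn_0.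
  by rewrite big_mkcond; apply: leq_sum => c _; case: ifP => // /h.
move: A; apply: mset_ind => [|a A IH] hA; first by rewrite enum_mset0.
have aC : a \in C by apply: hA; rewrite msetDE mset1E eqxx.
have {}IH := IH (fun c cA => hA c ltac:(rewrite msetDE; lia)).
have -> : count (predC (mem C1)) ([mset a] + A : {mset K}) =
    ((a \notin C1) + count (predC (mem C1)) A)%N.
  by have /permP -> := perm_msetD [mset a] A; rewrite count_cat enum_msetn /= addn0.
under eq_bigr => c _ do rewrite msetDE.
rewrite big_split leq_add//=.
have [//|aC1] := boolP (a \in C1); rewrite (big_rem a)//= aC1 mset1E eqxx; exact: leq_addr.
Qed.

Definition supported (C1 : seq K) S := forall c, c \notin C1 -> S c = 0%N.

Lemma supportedD C1 S T : supported C1 S -> supported C1 T -> supported C1 (S + T).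
Proof. by move=> hS hT c cC; rewrite msetDE hS// hT. Qed.

(** [z1] collects the atoms with a prime outside [C1]. Counted with multiplicity, [S] has at most
    [n * size C] such primes, so [z1] is short and [T] is small. *)
Lemma zfact_split (C1 : seq K) S n m z : (forall U, zatom Z U -> (size U <= m)%N) ->
  (forall c, c \notin C1 -> (S c <= n)%N) -> zfact Z S z ->
  exists z1 z0 T e, [/\ perm_eq z (z1 ++ z0), zfact Z T z1, zfact Z e z0, S = T + e &
    supported C1 e /\ (size T <= m * (n * size C))%N].
Proof.
move=> hm hn fz; have [az ez] := fz.
pose P := fun U : {mset K} => has (predC (mem C1)) U.
pose z1 := filter P z; pose z0 := filter (predC P) z.
have pz : perm_eq z (z1 ++ z0) by rewrite perm_sym perm_filterC.
have fp := zfact_perm pz fz.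
have SE : S = \sum_(U <- z1) U + \sum_(U <- z0) U.
  by rewrite -big_cat -(perm_big _ pz).
exists z1, z0, (\sum_(U <- z1) U), (\sum_(U <- z0) U); split=> //.
- exact: zfact_catl fp.
- exact: zfact_catr fp.
split=> [c cC1|].
  rewrite sum_msetE big_seq big1// => U; rewrite mem_filter => /andP[/hasPn h _].
  by apply/eqP; rewrite mset_eq0; apply/negP => /h /=; rewrite cC1.
have s1 : (size z1 <= n * size C)%N.
  apply: leq_trans (count_mset_le (zfactZ satZ fz) hn).
  rewrite -ez (perm_big _ pz) /= big_cat /=.
  have /permP -> := perm_msetD (\sum_(U <- z1) U) (\sum_(U <- z0) U).
  rewrite count_cat; apply: leq_trans (leq_addr _ _).
  have : all P z1 by apply: filter_all.
  elim: z1 {pz fp SE} => [//|U s IH] /= /andP[hU hs]; rewrite big_cons.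
  have /permP -> := perm_msetD U (\sum_(V <- s) V).
  by rewrite count_cat -add1n leq_add ?IH// -has_count.
rewrite size_sum_mset.
apply: (@leq_trans (\sum_(U <- z1) m)%N).
  rewrite !big_seq; apply: leq_sum => U; rewrite mem_filter => /andP[_ /az]; exact: hm.
by rewrite big_const_seq count_predT iter_addn_0 leq_mul2l s1 orbT.
Qed.

Lemma zlen_predecessor (G : nat) S : (forall m n, zlen Z S m -> zlen Z S n ->
  (m < n)%N -> exists k, [/\ zlen Z S k, (m < k)%N & (k <= m + G)%N]) ->
  forall a b j, zlen Z S a -> zlen Z S b -> (a <= j)%N -> (j < b)%N ->
  exists r, [/\ zlen Z S r, (r <= j)%N & (j < r + G)%N].
Proof.
move=> hG a b j La Lb aj jb.
pose Q := fun k => `[< zlen Z S k >] && (k <= j)%N.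
have exQ : exists k, Q k by exists a; rewrite /Q aj andbT; apply/asboolP.
have ubQ k : Q k -> (k <= j)%N by case/andP.
case: (ex_maxnP exQ ubQ) => r /andP[/asboolP Lr rj] rmax.
exists r; split=> //; rewrite ltnNge; apply/negP => rGj.
have [k [Lk rk kr]] := hG _ _ Lr Lb (leq_ltn_trans rj jb).
have /rmax : Q k by rewrite /Q; apply/andP; split; [apply/asboolP|lia].
lia.
Qed.

Section MinDistance.
Variables (C1 : seq K) (d : nat) (e0 : {mset K}) (p q : seq {mset K}).
Hypotheses (d0 : (0 < d)%N) (fp : zfact Z e0 p) (fq : zfact Z e0 q)
  (pq : size q = (size p + d)%N) (e0C1 : supported C1 e0).
Hypothesis dmin : forall e x y, supported C1 e -> zfact Z e x -> zfact Z e y ->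
  (size x < size y)%N -> (size x + d <= size y)%N.

(* A length difference r + s d with 0 < r < d, combined with s copies of the
   pair (p, q), would give the smaller difference r. *)
Lemma zlen_mod e x y : supported C1 e -> zfact Z e x -> zfact Z e y ->
  size x = size y %[mod d].
Proof.
suff le u v : supported C1 e -> zfact Z e u -> zfact Z e v -> (size u <= size v)%N ->
    size u = size v %[mod d].
  move=> se fx fy; have [xy|yx] := leqP (size x) (size y); first exact: le.
  by apply/esym/le => //; apply: ltnW.
move=> se fu fv uv; set D := (size v - size u)%N.
have DE : D = (D %/ d * d + D %% d)%N by apply: divn_eq.
set s := (D %/ d)%N in DE; set r := (D %% d)%N in DE.
have rd : (r < d)%N by rewrite ltn_mod.
have [r0|r0] := posnP r.
  have -> : size v = (size u + s * d)%N by rewrite /D in DE; lia.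
  by rewrite addnC modnMDl.
have f1 : zfact Z (e + e0 *+ s) (u ++ flatten (nseq s q)) by apply/zfact_cat/zfact_nseq.
have f2 : zfact Z (e + e0 *+ s) (v ++ flatten (nseq s p)) by apply/zfact_cat/zfact_nseq.
have sup : supported C1 (e + e0 *+ s).
  by apply: supportedD => // c cC1; rewrite msetMnE e0C1// muln0.
have := dmin sup f1 f2; rewrite !size_cat !flatten_nseq_size pq.
by move: DE; rewrite /D; nia.
Qed.

(** Although [d] is minimal only over [C1], it is a distance of [Z], because distinct lengths of
    [e0] differ by at least [d]. *)
Lemma zDelta_min : zDelta Z d.
Proof.
exists e0, (size p); split=> //; first by exists p.
  by exists q.
move=> k [x fx <-] /andP[pk kq].
by have := dmin e0C1 fp fx pk; lia.
Qed.

End MinDistance.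

End Lengths.

(** With [lo] and [hi] the extreme lengths, this says that at distance at least [M] from both ends
    the set of lengths consists of complete residue classes modulo [d]: each class met by some
    length, even near an end, is filled. *)
Definition periodic_interior (K : choiceType) (Z : {mset K} -> Prop) d M S : Prop :=
  forall lo hi l j, zlen Z S lo -> zlen Z S hi -> zlen Z S l ->
    (lo + M <= j)%N -> (j + M <= hi)%N -> l = j %[mod d] -> zlen Z S j.

Section Interior.
Variables (K : choiceType) (Z : {mset K} -> Prop) (C : seq K).
Implicit Types (S T U R e : {mset K}) (s t x y z p q : seq {mset K}).
Hypotheses (satZ : saturated Z) (uC : uniq C).
Hypothesis suppZ : forall S, Z S -> forall c, (0 < S c)%N -> c \in C.
Variable d0 : nat.
Hypothesis Zd0 : zDelta Z d0.

Lemma periodic_interior_le d M M' S : (M <= M')%N ->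
  periodic_interior Z d M S -> periodic_interior Z d M' S.
Proof. by move=> le h lo hi l j Llo Lhi Ll lj jh; apply: h Llo Lhi Ll _ _; lia. Qed.

(** If elements over [C1] have only one length, the lengths of [S] differ by a bounded amount, and
    for large [M] the interior is empty. *)
Lemma periodic_interior_half_factorial (C1 : seq K) n :
  (forall e x y, supported C1 e -> zfact Z e x -> zfact Z e y -> size x = size y) ->
  exists M : nat, forall S, Z S -> (forall c, c \notin C1 -> (S c <= n)%N) ->
    periodic_interior Z d0 M S.
Proof.
move=> hf; have [m hm] := zatom_size_bound satZ suppZ.
exists (m.+1 * (m * (n * size C))).+1 => S ZS hn lo hi l j [x fx <-] [y fy <-] _ lj jh _.
have [y1 [y0 [T [e [py f1 f0 SE [se sT]]]]]] := zfact_split satZ suppZ hm hn fy.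
have [r [fr s1 s2]] := zfact_pull satZ hm fx SE f1.
have er := hf _ _ _ se fr f0.
have sp : size y = (size y1 + size y0)%N by rewrite (perm_size py) size_cat.
have le : (m.+1 * size T <= m.+1 * (m * (n * size C)))%N by rewrite leq_mul2l sT orbT.
move: (m.+1 * size T)%N (m.+1 * (m * (n * size C)))%N s1 s2 le lj jh => a b.
lia.
Qed.

(* All lengths of S congruent to that of z modulo d are reached by first forcing
   N copies of p and the part of z outside C1 into a factorization, which costs
   a bounded number of factors, and then trading copies of p for copies of q. *)
Lemma periodic_interior_large_support (C1 : seq K) n :
  exists R M : nat, forall S, Z S -> (forall c, c \notin C1 -> (S c <= n)%N) ->
    (forall c, c \in C1 -> (R <= S c)%N) ->
    exists2 d, zDelta Z d & periodic_interior Z d M S.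
Proof.
have [m hm] := zatom_size_bound satZ suppZ.
pose Q := fun d => `[< (0 < d)%N /\ exists e p q, [/\ supported C1 e, zfact Z e p,
  zfact Z e q & size q = (size p + d)%N] >].
have [exQ|nQ] := pselect (exists d, Q d); last first.
  have hf e x y : supported C1 e -> zfact Z e x -> zfact Z e y -> size x = size y.
    wlog xy : x y / (size x < size y)%N.
      move=> h se fx fy; case: (ltngtP (size x) (size y)) => // xy; first exact: h.
      by apply/esym/h.
    move=> se fx fy; case: nQ; exists (size y - size x)%N; apply/asboolP.
    by split; [lia|exists e, x, y; split=> //; lia].
  have [M hM] := periodic_interior_half_factorial n hf.
  by exists 0%N, M => S ZS hn _; exists d0 => //; apply: hM.
case: (ex_minnP exQ) => d /asboolP[dpos [e0 [p [q [se0 fp fq pq]]]]] dmin'.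
have dmin e x y : supported C1 e -> zfact Z e x -> zfact Z e y ->
    (size x < size y)%N -> (size x + d <= size y)%N.
  move=> se fx fy xy; suff : (d <= size y - size x)%N by lia.
  apply: dmin'; apply/asboolP; split; first lia.
  by exists e, x, y; split=> //; lia.
have Zd : zDelta Z d by apply: (zDelta_min dpos fp fq pq se0 dmin).
have [N N0 hN] := zlen_gap_bound satZ suppZ.
(* [L] bounds the part [T] made of atoms that leave [C1]. If all coordinates in [C1] are at least
   [tm], removing [T] leaves room for [N] copies of [e0]; [tm] also bounds the size of
   [T + e0 *+ N]. *)
pose L := (m * (n * size C))%N; pose tm := (L + N * size e0)%N.
exists tm, (m.+1 * tm + tm + N)%N => S ZS hn hR; exists d => //.
move=> lo hi l j [x fx <-] [y fy <-] [z fz <-] lj jh lmod.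
have [z1 [z0 [T [e [pz f1 f0 SE [se sT]]]]]] := zfact_split satZ suppZ hm hn fz.
have [b eE] : exists b, e = e0 *+ N + b.
  apply: mset_le => c; rewrite msetMnE.
  have [cC|cC] := boolP (c \in C1); last by rewrite se0// muln0.
  have := hR c cC; rewrite SE msetDE /tm /L.
  have := mset_le_size T c; have := mset_le_size e0 c; nia.
have sb : supported C1 b.
  by move=> c cC; have := se c cC; rewrite eE msetDE; lia.
pose t := z1 ++ flatten (nseq N p); pose T' : {mset K} := T + e0 *+ N.
have ft : zfact Z T' t by apply: zfact_cat => //; apply: zfact_nseq.
have SE' : S = T' + b by rewrite SE eE addrA.
have sT' : (size T' <= tm)%N.
  by rewrite size_msetD size_msetMn leq_add2r.
have [rx [frx sx1 sx2]] := zfact_pull satZ hm fx SE' ft.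
have [ry [fry sy1 sy2]] := zfact_pull satZ hm fy SE' ft.
have st : (size t <= tm)%N by apply: leq_trans (zfact_size ft) sT'.
have le : (m.+1 * size T' <= m.+1 * tm)%N by rewrite leq_mul2l sT' orbT.
(* The largest length [r] of [b] with [size t + r <= j] misses [j] by less than [N]. The deficit
   turns out to be a multiple of [d], so at most [N] trades of [p] for [q] make it up. *)
have [r [Lr rj jr]] : exists r, [/\ zlen Z b r, (r <= j - size t)%N &
    (j - size t < r + N)%N].
  apply: (zlen_predecessor (hN b) (a := size rx) (b := size ry)).
  - by exists rx.
  - by exists ry.
  - move: (m.+1 * size T')%N (m.+1 * tm)%N sx1 lj le => u v; lia.
  - move: (m.+1 * size T')%N (m.+1 * tm)%N sy2 jh le => u v; lia.
have [w fw sw] := Lr.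
have tj : (size t <= j)%N by move: (m.+1 * tm)%N lj => v; lia.
have fpw : zfact Z e (flatten (nseq N p) ++ w).
  by rewrite eE; apply: zfact_cat => //; apply: zfact_nseq.
have emod := zlen_mod dpos fp fq pq se0 dmin se f0 fpw.
have sz : size z = (size z1 + size z0)%N by rewrite (perm_size pz) size_cat.
have sizet : size t = (size z1 + N * size p)%N.
  by rewrite size_cat flatten_nseq_size.
have /eqP : j = size t + r %[mod d].
  rewrite -lmod sz sizet -modnDmr emod modnDmr size_cat flatten_nseq_size sw.
  by rewrite addnA.
rewrite eqn_mod_dvd; last lia.
case/dvdnP => k jk; have kN : (k <= N)%N.
  by apply: leq_trans (leq_pmulr k dpos) _; rewrite -jk; lia.
exists (z1 ++ (flatten (nseq (N - k) p) ++ flatten (nseq k q)) ++ w).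
  rewrite SE eE; apply: zfact_cat => //; apply: zfact_cat => //.
  by rewrite -{1}(subnK kN) mulrnDr; apply: zfact_cat; apply: zfact_nseq.
rewrite !size_cat !flatten_nseq_size pq sw.
move: jk sizet; rewrite mulnDr mulnBl => jk sizet.
have := leq_mul kN (leqnn (size p)) => kNp.
by move: (N * size p)%N (k * size p)%N (k * d)%N kNp jk sizet => u v v' ? ? ?; lia.
Qed.

(** Induction on the size of [C1]: either all coordinates in [C1] reach the threshold [R] of large
    support, or one stays below it; its prime then leaves [C1], and [n] grows to [maxn n R]. *)
Lemma periodic_interior_uniform_support k (C1 : seq K) n : uniq C1 -> size C1 = k ->
  exists M : nat, forall S, Z S -> (forall c, c \notin C1 -> (S c <= n)%N) ->
    exists2 d, zDelta Z d & periodic_interior Z d M S.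
Proof.
elim: k C1 n => [|k IH] C1 n uC1 sC1; have [R [M hM]] := periodic_interior_large_support C1 n.
  by exists M => S ZS hn; apply: hM => // c; rewrite (size0nil sC1).
pose Q c M := forall S, Z S -> (forall c', c' \notin rem c C1 -> (S c' <= maxn n R)%N) ->
    exists2 d, zDelta Z d & periodic_interior Z d M S.
have [||M' hM'] := @uniform_bound _ Q C1.
- move=> c a b ab h S ZS hS; have [d Zd hd] := h S ZS hS.
  by exists d => //; apply: periodic_interior_le hd.
- by move=> c cC1; apply: IH; rewrite ?rem_uniq// size_rem// sC1.
exists (maxn M M') => S ZS hn.
have [/allP hR|/allPn[c cC1]] := boolP (all (fun c => R <= S c)%N C1).
  have [d Zd hd] := hM S ZS hn hR.
  by exists d => //; apply: periodic_interior_le hd; exact: leq_maxl.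
rewrite -ltnNge => cR.
have [|d Zd hd] := hM' c cC1 S ZS.
  move=> c'; rewrite (mem_rem_uniq c uC1) inE negb_and negbK => /orP[/eqP->|/hn]; lia.
by exists d => //; apply: periodic_interior_le hd; exact: leq_maxr.
Qed.

Lemma zlen_periodic_interior : exists M : nat, forall S, Z S ->
  exists2 d, zDelta Z d & periodic_interior Z d M S.
Proof.
have [M hM] := @periodic_interior_uniform_support _ C 0 uC erefl.
exists M => S ZS; apply: hM => // c cC; rewrite leqn0; apply/negPn; rewrite -lt0n.
by apply: contra cC; exact: suppZ.
Qed.

End Interior.

(** * Transfer homomorphisms *)

Lemma perm_map_cat (T U : eqType) (f : T -> U) (x : seq T) (a b : seq U) :
  perm_eq (map f x) (a ++ b) ->
  exists x0 x1, [/\ perm_eq x (x0 ++ x1), map f x0 = a & map f x1 = b].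
Proof.
have ex (t : seq U) y : perm_eq (map f y) t -> exists2 y', perm_eq y y' & map f y' = t.
  elim: t y => [|u t IH] y.
    move=> /perm_size; rewrite size_map => /size0nil ->; by exists [::].
  move=> p; have : u \in map f y by rewrite (perm_mem p) mem_head.
  case/mapP => v vy uE; have pv := perm_to_rem vy.
  have [|y' py' ft] := IH (rem v y).
    by rewrite -(perm_cons u) (perm_trans _ p)// perm_sym uE -map_cons perm_map.
  exists (v :: y'); last by rewrite /= ft uE.
  by rewrite (perm_trans pv)// perm_cons.
case/ex => y p fy; exists (take (size a) y), (drop (size a) y); split.
- by rewrite cat_take_drop.
- by rewrite map_take fy take_size_cat.
- by rewrite map_drop fy drop_size_cat.
Qed.

Section Transfer.
Variables (P K : choiceType) (Z : {mset P} -> Prop) (Z' : {mset K} -> Prop).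
Variable g : P -> {mset K}.
Implicit Types (S : {mset P}) (s : seq {mset P}) (t : seq {mset K}).
Local Notation gam := (msum g).

(** Transfer homomorphisms, for maps that extend to the ambient free monoids. The second clause is
    what lifts factorizations and makes sets of lengths agree. *)
Definition transfer : Prop := [/\ forall S, Z S -> Z' (gam S),
  forall S X' Y', Z S -> gam S = X' + Y' -> Z' X' -> Z' Y' ->
    exists X Y, [/\ S = X + Y, Z X, Z Y, gam X = X' & gam Y = Y'],
  forall S, Z S -> gam S = 0 -> S = 0 &
  forall S' : {mset K}, Z' S' -> exists2 S, Z S & gam S = S'].

Hypotheses (satZ : saturated Z) (satZ' : saturated Z') (tr : transfer).

Lemma transfer_atom S : Z S -> zatom Z S <-> zatom Z' (gam S).
Proof.
have [t1 t2 t3 _] := tr; move=> ZS; split=> [[_ S0 h]|[_ S0 h]]; split=> //.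
- exact: t1.
- by move=> /(t3 _ ZS).
- move=> X' Y' e ZX ZY; have [X [Y [SE ZX' ZY' <- <-]]] := t2 _ _ _ ZS e ZX ZY.
  by case: (h _ _ SE ZX' ZY') => ->; rewrite msum0; [left|right].
- by move=> SE; apply: S0; rewrite SE msum0.
- move=> X Y SE ZX ZY; have e : gam S = gam X + gam Y by rewrite SE msumD.
  by case: (h _ _ e (t1 _ ZX) (t1 _ ZY)) => /t3; [left|right]; auto.
Qed.

Lemma transfer_zfact S s : zfact Z S s -> zfact Z' (gam S) (map gam s).
Proof.
move=> [h <-]; split; last by rewrite big_map msum_sum.
move=> U /mapP[V Vs ->]; have aV := h V Vs.
by apply/transfer_atom => //; case: aV.
Qed.

Lemma transfer_lift S t : Z S -> zfact Z' (gam S) t ->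
  exists2 s, zfact Z S s & map gam s = t.
Proof.
have [t1 t2 t3 _] := tr.
elim: t S => [|U t IH] S ZS [ht et].
  exists [::] => //; suff -> : S = 0 by apply: zfact_nil.
  by apply: t3 => //; rewrite -et big_nil.
have aU : zatom Z' U by apply: ht; rewrite mem_head.
have ht' V : V \in t -> zatom Z' V by move=> Vt; apply: ht; rewrite inE Vt orbT.
rewrite big_cons in et.
have [||X [Y [SE ZX ZY gX gY]]] := t2 S U (\sum_(V <- t) V) ZS (esym et).
- by case: aU.
- by apply: zsum => // V /ht'[].
have [|s fs es] := IH Y ZY; first by rewrite gY.
exists (X :: s); last by rewrite /= gX es.
rewrite SE; apply: (zfact_cat (zfact1 _) fs).
by apply/transfer_atom; rewrite ?gX.
Qed.

Lemma transfer_zlen S : Z S -> zlen Z S = zlen Z' (gam S).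
Proof.
move=> ZS; apply/seteqP; split=> n.
  by move=> [s /transfer_zfact fs <-]; exists (map gam s); rewrite ?size_map.
by move=> [t /(transfer_lift ZS)[s fs <-] <-]; exists s; rewrite ?size_map.
Qed.

Lemma transfer_zDelta : zDelta Z = zDelta Z'.
Proof.
apply/seteqP; split=> d [S [m [Lm Ln d0 h]]].
  have [s /(zfactZ satZ) ZS _] := Lm.
  by exists (gam S), m; rewrite -transfer_zlen.
have [s /(zfactZ satZ') ZS _] := Lm; have [_ _ _ t4] := tr.
have [S1 ZS1 gS] := t4 _ ZS; exists S1, m.
by rewrite transfer_zlen// gS.
Qed.

End Transfer.

Lemma transfer_exchange_bound (P K : choiceType) (Z : {mset P} -> Prop) (Z' : {mset K} -> Prop)
    (g : P -> {mset K}) (C : seq K) D :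
  saturated Z -> saturated Z' -> (forall S, Z' S -> forall c, (0 < S c)%N -> c \in C) ->
  transfer Z Z' g ->
  exists B : nat, forall S (x y : seq {mset P}), zfact Z S x -> zfact Z S y ->
  (size x <= size y + D)%N -> (size y <= size x + D)%N ->
  exists x0 x1 y0, [/\ perm_eq x (x0 ++ x1), zfact Z (\sum_(U <- x0) U) y0,
    (size y0 + size x1 = size y)%N & (size x0 <= B)%N /\ (size y0 <= B)%N].
Proof.
move=> satZ satZ' suppZ' tr; have [B hB] := zfact_exchange_bound satZ' suppZ' D.
exists B => S x y fx fy xy yx.
have fgx := transfer_zfact tr fx; have fgy := transfer_zfact tr fy.
have [||x0' [x1' [y0' [p f0 sz [s1 s2]]]]] := hB _ _ _ fgx fgy; rewrite ?size_map//.
have [x0 [x1 [px e0 e1]]] := perm_map_cat p.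
have fx0 := zfact_catl (zfact_perm px fx).
move: f0; rewrite -e0 big_map -msum_sum.
move=> /(transfer_lift satZ' tr (zfactZ satZ fx0))[y0 f0 ey].
exists x0, x1, y0; split=> //.
  by move: sz; rewrite -e1 -ey !size_map.
by move: s1 s2; rewrite -e0 -ey !size_map.
Qed.

(** The image of a prime has at most one element and falls on one side as a whole; primes with empty
    image go to [Y]. *)
Lemma msum_split (P K : choiceType) (g : P -> {mset K}) : (forall p, (size (g p) <= 1)%N) ->
  forall S X' Y', msum g S = X' + Y' ->
  exists X Y, [/\ S = X + Y, msum g X = X' & msum g Y = Y'].
Proof.
move=> g1; apply: mset_ind => [|p A IH] X' Y'.
  rewrite msum0 => /esym/mset_addI0[-> ->]; exists 0, 0; by rewrite add0r msum0.
rewrite msumD msum1 => /riesz[A1 [A2 [B1 [B2 [gE e -> ->]]]]].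
have [X [Y [-> <- <-]]] := IH _ _ e.
have := g1 p; rewrite gE size_msetD.
have [/size_mset_eq0R A10 _|A1p le] := posnP (size A1).
  by exists X, ([mset p] + Y); split; rewrite ?msumD ?msum1 ?gE ?A10 ?add0r// addrCA.
have B10 : B1 = 0 by apply: size_mset_eq0R; lia.
by exists ([mset p] + X), Y; split; rewrite ?msumD ?msum1 ?gE ?B10 ?addr0 ?add0r// addrA.
Qed.

Lemma msum_neg_mem (P : choiceType) (w : P -> int) B : msum w B < 0 ->
  exists p A, B = [mset p] + A /\ w p < 0.
Proof.
move: B; apply: mset_ind => [|p A hA]; first by rewrite msum0.
rewrite msumD msum1 => lt; have [wp|wp] := ltP (w p) 0; first by exists p, A.
have [|q [B [-> wq]]] := hA; first lia.
by exists q, ([mset p] + B); rewrite addrCA.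
Qed.

Definition wt0 (P : choiceType) (w : P -> int) (S : {mset P}) : Prop := msum w S = 0.

Lemma wt0_saturated (P : choiceType) (w : P -> int) : saturated (wt0 w).
Proof.
rewrite /wt0; split=> [|S T eS eT|S T eS]; first by rewrite msum0.
  by rewrite msumD eS eT.
by rewrite msumD eS add0r.
Qed.

(** This symmetry exchanges the roles of the positive and the negative classes. *)
Lemma wt0_opp (P : choiceType) (w : P -> int) : wt0 (fun p => - w p) = wt0 w.
Proof.
apply/funext => S; rewrite /wt0; suff -> : msum (fun p => - w p) S = - msum w S.
  by apply/propext; split=> [e|->]; rewrite ?oppr0// -[LHS]opprK e oppr0.
by rewrite /msum sumrN.
Qed.

(** * Transfer to zero-sum sequences over the classes *)

Section ClassTransfer.
Variable GP : set int.

Definition class_zero_sum (S : {mset int}) : Prop :=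
  msum id S = 0 /\ forall c, (0 < S c)%N -> GP c.

Lemma class_zero_sum_saturated : saturated class_zero_sum.
Proof.
split=> [|S T [eS hS] [eT hT]|S T [eS hS] []].
- by split=> [|c]; rewrite ?msum0// mset0RE.
- split=> [|c]; first by rewrite msumD eS eT.
  by rewrite msetDE addn_gt0 => /orP[/hS|/hT].
- rewrite msumD eS add0r => eT hT; split=> // c Tc; apply: hT.
  by rewrite msetDE addn_gt0 Tc orbT.
Qed.

Variables (P : choiceType) (w : P -> int).
Hypothesis wGP : range w = GP.

Lemma msum_class S : msum id (msum (fun p => [mset w p]) S) = msum w S.
Proof.
move: S; apply: mset_ind => [|p A IH]; first by rewrite !msum0.
by rewrite !msumD IH !msum1.
Qed.

Lemma class_transfer : transfer (wt0 w) class_zero_sum (fun p => [mset w p]).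
Proof.
have sz S : size (msum (fun p => [mset w p]) S : {mset int}) = size S.
  move: S; apply: mset_ind => [|p A IH]; first by rewrite !msum0 !size_mset0R.
  by rewrite msumD msum1 !size_msetD IH !size_mset1.
split=> [S ZS|S X' Y' ZS e [eX hX] [eY hY]|S _ e|S' [eS' hS']].
- split; first by rewrite msum_class.
  move=> c; rewrite -wGP {ZS}; move: S; apply: mset_ind => [|p A IH].
    by rewrite msum0 mset0RE.
  rewrite msumD msum1 msetDE mset1E addn_gt0 => /orP[|/IH//].
  by case: eqP => // ->; exists p.
- have [|X [Y [SE gX gY]]] := @msum_split _ _ _ _ S X' Y' e.
    by move=> p; rewrite size_mset1.
  by exists X, Y; split=> //; rewrite /wt0 -msum_class ?gX ?gY.
- by apply: size_mset_eq0R; rewrite -sz e size_mset0R.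
- suff [S gS] : exists S, msum (fun p => [mset w p]) S = S'.
    by exists S => //; rewrite /wt0 -msum_class gS.
  move: S' hS' {eS'}; apply: mset_ind => [|c A IH] h; first by exists 0; rewrite msum0.
  have [c' c'A|S gS] := IH; first by apply: h; rewrite msetDE addn_gt0 c'A orbT.
  have : GP c by apply: h; rewrite msetDE mset1E eqxx.
  by rewrite -wGP => -[p _ <-]; exists ([mset p] + S); rewrite msumD msum1 gS.
Qed.

End ClassTransfer.

(** * Transfer to residues when there is a single negative class *)

Section ResidueTransfer.
Variables (GP : set int) (n : nat).
Hypothesis n0 : (0 < n)%N.

Definition residue_zero_sum (S : {mset int}) : Prop :=
  (exists k : int, msum id S = k * n%:Z) /\
  forall c, (0 < S c)%N -> exists g : int, [/\ GP g, 0 <= g & c = (g %% n)%Z].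

Lemma residue_zero_sum_saturated : saturated residue_zero_sum.
Proof.
split=> [|S T [[k eS] hS] [[l eT] hT]|S T [[k eS] hS] [[l]]].
- split=> [|c]; last by rewrite mset0RE.
  by exists 0; rewrite msum0 mul0r.
- split=> [|c]; first by exists (k + l); rewrite msumD eS eT mulrDl.
  by rewrite msetDE addn_gt0 => /orP[/hS|/hT].
- rewrite msumD eS => eT hT; split; first by exists (l - k); lia.
  by move=> c Tc; apply: hT; rewrite msetDE addn_gt0 Tc orbT.
Qed.

Variables (P : choiceType) (w : P -> int).
Hypotheses (wGP : range w = GP) (GPn : GP (- n%:Z))
  (negn : forall p, w p < 0 -> w p = - n%:Z).

(** Primes of class [-n] are sent to the empty multiset and not to the residue 0, so that moving
    them between factors is invisible in the image. *)
Definition residue_mset p : {mset int} := if w p < 0 then 0 else [mset (w p %% n)%Z].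
Local Notation g := residue_mset.

Lemma residue_msum S : exists k : int, msum id (msum g S) = msum w S + k * n%:Z.
Proof.
move: S; apply: mset_ind => [|p A [k IH]]; first by exists 0; rewrite !msum0 mul0r.
rewrite !msumD IH !msum1 /g; case: ifP => [/negn ->|_].
  by exists (k + 1); rewrite msum0; lia.
exists (k - (w p %/ n)%Z); rewrite msum1 {2}(divz_eq (w p) n); lia.
Qed.

(** The weight of [Y] is negative as long as [X] has an excess, so [Y] contains a prime of class
    [-n]. Moving it to [X] lowers the excess by [n] and changes no image. *)
Lemma residue_rebalance (k : nat) X Y : msum w X = k%:Z * n%:Z -> msum w (X + Y) = 0 ->
  exists X1 Y1, [/\ X + Y = X1 + Y1, msum g X1 = msum g X, msum g Y1 = msum g Y &
    msum w X1 = 0].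
Proof.
elim: k X Y => [|k IH] X Y eX eXY; first by exists X, Y; split=> //; lia.
have : msum w Y < 0 by move: eXY; rewrite msumD eX; nia.
move=> /msum_neg_mem[p [Y1 [YE wp]]].
have [||X2 [Y2 [e gX gY wX]]] := IH ([mset p] + X) Y1.
- by rewrite msumD msum1 eX negn//; lia.
- by move: eXY; rewrite YE !msumD; lia.
exists X2, Y2; split=> //.
- by rewrite YE -e addrCA addrA.
- by rewrite gX msumD msum1 /g wp add0r.
- by rewrite gY YE msumD msum1 /g wp add0r.
Qed.

Lemma residue_transfer : transfer (wt0 w) residue_zero_sum g.
Proof.
have gs p : (size (g p) <= 1)%N.
  by rewrite /g; case: ifP => _; rewrite ?size_mset0R ?size_mset1.
split=> [S ZS|S X' Y' ZS e [[k eX] hX] [[l eY] hY]|S ZS|S' [[k eS'] hS']].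
- split; first by have [k ->] := residue_msum S; exists k; rewrite ZS add0r.
  move=> c; rewrite {ZS}; move: S; apply: mset_ind => [|p A IH].
    by rewrite msum0 mset0RE.
  rewrite msumD msum1 msetDE addn_gt0 => /orP[|/IH//].
  rewrite /g; case: ltP => [_|wp]; first by rewrite mset0RE.
  by rewrite mset1E; case: eqP => // -> _; exists (w p); split=> //; rewrite -wGP; exists p.
- have [X [Y [SE gX gY]]] := msum_split gs e.
  have [a ea] := residue_msum X; have [b eb] := residue_msum Y.
  have eXY : msum w (X + Y) = 0 by rewrite -SE.
  have wX : msum w X = (k - a) * n%:Z by move: ea; rewrite gX eX; lia.
  have wY : msum w Y = (a - k) * n%:Z by move: eXY; rewrite msumD wX; lia.
  (* [X] and [Y] have opposite weights, multiples of [n]; the part with an excess takes primes of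
     class [-n] from the other. *)
  have [ka|ka] := leP 0 (k - a).
    have [X1 [Y1 [e1 g1 g2 w1]]] := @residue_rebalance `|k - a|%N X Y
      ltac:(rewrite wX gez0_abs//) eXY.
    exists X1, Y1; split; rewrite ?SE ?g1 ?g2//.
    by move: eXY; rewrite e1 msumD w1 add0r.
  rewrite addrC in eXY; have [|Y1 [X1 [e1 g1 g2 w1]]] := @residue_rebalance `|a - k|%N Y X _ eXY.
    by rewrite wY gez0_abs//; lia.
  exists X1, Y1; split; rewrite ?SE ?g1 ?g2//; first by rewrite addrC e1 addrC.
  by move: eXY; rewrite e1 msumD w1 add0r.
(* An element with empty image consists of primes of class [-n] only, so weight 0 makes it
   trivial. *)
- have neg A : msum g A = 0 -> msum w A = - (size A)%:Z * n%:Z.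
    move: A; apply: mset_ind => [|p A IH]; first by rewrite !msum0 size_mset0R oppr0 mul0r.
    rewrite !msumD !msum1 => /mset_addI0[e1 e2]; rewrite (IH e2); move: e1; rewrite /g; case: ifP => [wp _|_ e].
      by rewrite size_msetD size_mset1 negn//; lia.
    by move: (congr1 (fun B : {mset int} => size B) e); rewrite size_mset1 size_mset0R.
  move=> /neg; rewrite ZS => e; apply: size_mset_eq0R; nia.
(* A lift by primes of class at least 0 has as weight a nonnegative multiple of [n], which copies of
   a prime of class [-n] cancel. *)
- have [S gS wS] : exists2 S, msum g S = S' & 0 <= msum w S.
    move: S' hS' {eS'}; apply: mset_ind => [|c A IH] h.
      by exists 0; rewrite msum0.
    have [c' c'A|S gS wS] := IH; first by apply: h; rewrite msetDE addn_gt0 c'A orbT.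
    have [|b [GPb b0 ->]] := h c; first by rewrite msetDE mset1E eqxx.
    move: GPb; rewrite -wGP => -[p _ wp]; exists ([mset p] + S); rewrite msumD msum1.
      by rewrite gS /g wp ltNge b0.
    by rewrite wp addr_ge0.
  have [a ea] := residue_msum S; rewrite gS eS' in ea.
  move: GPn; rewrite -wGP => -[q _ wq].
  exists (S + [mset q] *+ `|k - a|%N).
    rewrite /wt0 msumD msumMn msum1 wq -mulr_natr natz; nia.
  by rewrite msumD msumMn msum1 /g wq ltrNl oppr0 ltz_nat n0 mul0rn addr0.
Qed.

End ResidueTransfer.

(** * Factorizations in H *)

Lemma least_le (A : set nat) n : A n -> enat_le (least A) n.
Proof.
move=> An; rewrite /least; case: pselect => [h /=|]; last first.
  by case; exists n; apply/asboolP.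
by case: ex_minnP => m _; apply; apply/asboolP.
Qed.

Lemma least_leP (A : set nat) n : enat_le (least A) n -> exists2 m, A m & (m <= n)%N.
Proof.
rewrite /least; case: pselect => //= h; case: ex_minnP => m /asboolP Am _ mn.
by exists m.
Qed.

Lemma enat_le_trans x m n : enat_le x m -> (m <= n)%N -> enat_le x n.
Proof. by case: x => //= k; apply: leq_trans. Qed.

Lemma esupremum_neq_None (A : set enat) :
  esupremum A <> None <-> exists N, forall x, A x -> enat_le x N.
Proof.
rewrite /esupremum; split=> [|[N hN]].
  rewrite /least; case: pselect => //= h _.
  by have [m /asboolP hm _] := ex_minnP h; exists m.
have := @least_le [set N | forall x, A x -> enat_le x N] N hN.
by case: least.
Qed.

Section Distance.
Variable H : cmonoidType.
Implicit Types (z u v : {mset atoms H}).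

Lemma distE z u : dist z u = maxn (size (z `\` u)%mset) (size (u `\` z)%mset).
Proof.
have e (a b : {mset atoms H}) : (a `\` (a `&` b))%mset = (a `\` b)%mset.
  by apply/mset_ext => x; rewrite !msetE2; lia.
by rewrite /dist e msetIC e.
Qed.

Lemma distC z u : dist z u = dist u z.
Proof. by rewrite !distE maxnC. Qed.

Lemma size_mset_le (K : choiceType) (A B : {mset K}) :
  (forall x, (A x <= B x)%N) -> (size A <= size B)%N.
Proof. by move=> /mset_le[C ->]; rewrite size_msetD leq_addr. Qed.

Lemma dist_refl z : dist z z = 0%N.
Proof. by rewrite distE maxnn msetBxx size_mset0. Qed.

Lemma dist_triangle z u v : (dist z v <= dist z u + dist u v)%N.
Proof.
have tri (a b c : {mset atoms H}) :
    (size (a `\` c)%mset <= size (a `\` b)%mset + size (b `\` c)%mset)%N.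
  rewrite -size_msetD; apply: size_mset_le => x; rewrite msetDE !msetE2; lia.
have := tri z u v; have := tri v u z; rewrite !distE.
lia.
Qed.

Lemma dist_add z u v : dist (z + u)%R (z + v)%R = dist u v.
Proof.
have e (a b : {mset atoms H}) : ((z + a)%R `\` (z + b)%R)%mset = (a `\` b)%mset.
  exact: msetBDl.
by rewrite !distE !e.
Qed.

Lemma dist_le z u v : (dist (z + u)%R (z + v)%R <= maxn (size u) (size v))%N.
Proof.
rewrite dist_add distE geq_max; apply/andP; split; rewrite leq_max.
  by apply/orP; left; apply: size_mset_le => x; rewrite msetE2 leq_subr.
by apply/orP; right; apply: size_mset_le => x; rewrite msetE2 leq_subr.
Qed.

Lemma dist_size z u : (size z <= size u + dist z u)%N.
Proof.
rewrite distE; apply: leq_trans (leq_add (leqnn _) (leq_maxl _ _)).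
rewrite -size_msetD; apply: size_mset_le => x; rewrite msetDE msetE2; lia.
Qed.

End Distance.

(** * Transport of factorizations along a divisor homomorphism *)

Section DivisorHom.
Variables (H : cmonoidType) (P : choiceType) (phi : {additive H -> {mset P}}).
Hypothesis phi_div : divisor_hom phi.

Definition phi_image (S : {mset P}) : Prop := exists a, phi a = S.
Local Notation Z := phi_image.

Lemma phi_image_saturated : saturated Z.
Proof.
split=> [|_ _ [a <-] [b <-]|_ T [a <-] [b e]].
- by exists 0; rewrite raddf0.
- by exists (a + b); rewrite raddfD.
- have [|c bE] := phi_div (a := a) (b := b); first by exists T.
  by exists c; apply: (@cancel_addI _ (phi a)); rewrite -e bE raddfD.
Qed.

Definition psi (x : reduced H) : {mset P} := phi (repr x).

Lemma phi_unit a : is_unit a -> phi a = 0.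
Proof. by move=> [b /(congr1 phi)]; rewrite raddfD raddf0 => /mset_addI0[]. Qed.

Lemma psi_class a : psi (assoc_class a) = phi a.
Proof.
have /assoc_classP[e ue aE] := assoc_class_repr (assoc_class a).
by rewrite /psi {2}aE raddfD (phi_unit ue) addr0.
Qed.

Lemma psi_image x : Z (psi x).
Proof. by exists (repr x). Qed.

Lemma psi_surj S : Z S -> exists x, psi x = S.
Proof. by move=> [a <-]; exists (assoc_class a); rewrite psi_class. Qed.

(** Elements with equal images divide each other, as [phi] is a divisor homomorphism, and hence are
    associated. *)
Lemma psi_inj : injective psi.
Proof.
move=> x y; rewrite -(assoc_class_repr x) -(assoc_class_repr y) !psi_class.
move: (repr x) (repr y) => a b e; apply/assoc_classP.
have [|c bE] := phi_div (a := a) (b := b); first by exists 0; rewrite addr0.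
have [|d aE] := phi_div (a := b) (b := a); first by exists 0; rewrite addr0.
exists c => //; exists d; apply: (@cancel_addI _ a).
by rewrite addrA -bE addr0 -aE.
Qed.

Lemma psiD x y : psi (x + y) = psi x + psi y.
Proof.
rewrite -(assoc_class_repr x) -(assoc_class_repr y) [in LHS]/GRing.add /=.
by rewrite [X in psi X]assoc_class_add !psi_class raddfD.
Qed.

Lemma psi0 : psi 0 = 0.
Proof. by rewrite [0 in LHS]/(assoc_class 0) psi_class raddf0. Qed.

Lemma psi_sum (I : Type) (s : seq I) (f : I -> reduced H) :
  psi (\sum_(i <- s) f i) = \sum_(i <- s) psi (f i).
Proof.
elim: s => [|i s IH]; first by rewrite !big_nil psi0.
by rewrite !big_cons psiD IH.
Qed.

Lemma reduced_unit (x : reduced H) : is_unit x <-> x = 0.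
Proof.
split=> [[y /(congr1 psi)]|->]; last by exists 0; rewrite addr0.
by rewrite psiD psi0 => /mset_addI0[e _]; apply: psi_inj; rewrite psi0.
Qed.

Lemma psi_atom x : is_atom x <-> zatom Z (psi x).
Proof.
split=> [[nu h]|[_ S0 h]]; split.
- exact: psi_image.
- by rewrite -psi0 => /psi_inj x0; apply/nu/reduced_unit.
- move=> A B e /psi_surj[y yA] /psi_surj[t tB]; move: e; rewrite -yA -tB -psiD => /psi_inj/h.
  by case=> /reduced_unit->; rewrite psi0; [left|right].
- by move=> /reduced_unit x0; apply: S0; rewrite x0 psi0.
- move=> y t e; case: (h (psi y) (psi t)); rewrite ?e ?psiD//; try exact: psi_image.
    by rewrite -psi0 => /psi_inj ->; left; apply/reduced_unit.
  by rewrite -psi0 => /psi_inj ->; right; apply/reduced_unit.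
Qed.

Definition apsi (u : atoms H) : {mset P} := psi (val u).

Lemma apsi_inj : injective apsi.
Proof. by move=> u v /psi_inj/val_inj. Qed.

Lemma apsi_atom u : zatom Z (apsi u).
Proof. by apply/psi_atom/asboolP; exact: (valP u). Qed.

Lemma apsi_lift (t : seq {mset P}) : (forall U, U \in t -> zatom Z U) ->
  exists z : seq (atoms H), map apsi z = t.
Proof.
elim: t => [|U t IH] h; first by exists [::].
have [|z zt] := IH; first by move=> V Vt; apply: h; rewrite inE Vt orbT.
have aU : zatom Z U by apply: h; rewrite mem_head.
have [x xU] : exists x, psi x = U by apply: psi_surj; case: aU.
have ax : `[< is_atom x >] by apply/asboolP/psi_atom; rewrite xU.
by exists (exist _ x ax :: z); rewrite /= zt /apsi /= xU.
Qed.

Lemma factor_prodE (z : {mset atoms H}) : factor_prod z = \sum_(u <- (z : seq (atoms H))) val u.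
Proof. by rewrite big_mset /factor_prod; apply: eq_bigr. Qed.

Lemma factor_prodD (y z : {mset atoms H}) : factor_prod (y + z) = factor_prod y + factor_prod z.
Proof. by rewrite !factor_prodE (perm_big _ (perm_msetD y z)) big_cat. Qed.

Lemma psi_factor_prod (z : {mset atoms H}) :
  psi (factor_prod z) = \sum_(U <- map apsi z) U.
Proof. by rewrite factor_prodE psi_sum big_map. Qed.

Lemma Zfact_zfact x (z : {mset atoms H}) : Zfact x z <-> zfact Z (psi x) (map apsi z).
Proof.
split=> [<-|[_]].
  split; last by rewrite psi_factor_prod.
  by move=> U /mapP[u _ ->]; apply: apsi_atom.
by rewrite -psi_factor_prod => /psi_inj.
Qed.

Lemma zfact_Zfact x (t : seq {mset P}) : zfact Z (psi x) t ->
  exists z : {mset atoms H}, [/\ Zfact x z, perm_eq (map apsi z) t & size z = size t].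
Proof.
move=> ft; have [a _] := ft; have [s st] := apsi_lift a.
have p : perm_eq (map apsi (seq_mset s)) t by rewrite -st perm_map// perm_eq_seq_mset.
exists (seq_mset s); split=> //; last by rewrite -(size_map apsi) (perm_size p).
by apply/Zfact_zfact; apply: zfact_perm ft; rewrite perm_sym.
Qed.

Lemma zlen_lengths x (k : int) :
  lengths x k <-> exists2 n : nat, zlen Z (psi x) n & k = n%:Z.
Proof.
split=> [[z /Zfact_zfact fz <-]|[n [t /zfact_Zfact[z [fz _ <-]] <-] ->]].
  by exists (size z) => //; exists (map apsi z); rewrite ?size_map.
by exists z.
Qed.

(** The atoms in [X1] are common to both factorizations and cancel in the distance; only the
    exchanged parts count. *)
Lemma Zfact_replace x (z : {mset atoms H}) (X0 X1 Y : seq {mset P}) : Zfact x z ->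
  perm_eq (map apsi z) (X0 ++ X1) -> zfact Z (\sum_(U <- X0) U) Y ->
  exists z' : {mset atoms H}, [/\ Zfact x z', perm_eq (map apsi z') (Y ++ X1) &
    (dist z z' <= maxn (size X0) (size Y))%N].
Proof.
move=> fz p fY; have [z0 [z1 [pz e0 e1]]] := perm_map_cat p.
have [y yY] := apsi_lift fY.1.
have zE : z = seq_mset z1 + seq_mset z0.
  apply/mset_ext => u; rewrite msetDE !mset_seqE -count_mem_mset.
  by have /permP -> := pz; rewrite count_cat addnC.
pose z' : {mset atoms H} := seq_mset z1 + seq_mset y.
have p' : perm_eq (map apsi z') (Y ++ X1).
  rewrite perm_sym perm_catC -e1 -yY -map_cat perm_map// perm_sym.
  rewrite (perm_trans (perm_msetD _ _))//.
  by rewrite perm_cat// perm_eq_seq_mset.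
exists z'; split=> //.
  apply/Zfact_zfact; apply: (@zfact_perm _ _ _ (Y ++ X1)); first by rewrite perm_sym.
  move: fz => /Zfact_zfact fz; have fp := zfact_perm p fz.
  have [_ <-] := fp; rewrite big_cat; apply: zfact_cat => //; exact: zfact_catr fp.
rewrite zE; apply: leq_trans (dist_le _ _ _) _.
by rewrite !(perm_size (perm_eq_seq_mset _)) -(size_map apsi z0) e0 -(size_map apsi y) yY.
Qed.

Lemma adjacent_lengths x (k l : int) : adjacent (lengths x) k l <->
  exists m n : nat, [/\ k = m%:Z, l = n%:Z, m <> n, zlen Z (psi x) m /\ zlen Z (psi x) n &
    forall i, zlen Z (psi x) i -> ~ (minn m n < i < maxn m n)%N].
Proof.
split=> [[kl e]|[m [n [-> -> mn [Lm Ln] h]]]].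
  have hk : [set k; l] k by left.
  have hl : [set k; l] l by right.
  move: (hk) (hl); rewrite -e => -[/zlen_lengths[m Lm km] _] [/zlen_lengths[n Ln ln] _].
  exists m, n; split=> //; first by move=> mn; apply: kl; rewrite km ln mn.
  move=> i Li mi.
  have : [set k; l] i%:Z.
    by rewrite -e; split; [apply/zlen_lengths; exists i|rewrite /= km ln; lia].
  by rewrite km ln => -[]/= []; lia.
split; first by move=> [].
apply/seteqP; split=> [i [/zlen_lengths[j Lj ->] /= hj]|i [|] /= ->].
- have := h _ Lj; have [->|jm] := eqVneq j m; first by left.
  by have [->|jn] := eqVneq j n; [right|lia].
- by split; [apply/zlen_lengths; exists m|rewrite /=; lia].
- by split; [apply/zlen_lengths; exists n|rewrite /=; lia].
Qed.

Lemma Delta_zDelta : Delta H = zDelta Z.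
Proof.
apply/seteqP; split=> d.
  move=> [a _ [k [l [/adjacent_lengths[m [n [-> -> mn [Lm Ln] h]]] ->]]]].
  have [lt|lt|//] := ltngtP m n.
    exists (psi (assoc_class a)), m; split=> //; try lia.
      by have -> : (m + `|m%:Z - n%:Z| = n)%N by lia.
    by move=> i /h; lia.
  exists (psi (assoc_class a)), n; split=> //; try lia.
    by have -> : (n + `|m%:Z - n%:Z| = m)%N by lia.
  by move=> i /h; lia.
move=> [S [m [Lm Ln d0 h]]].
have [s /(zfactZ phi_image_saturated)[a aS] _] := Lm.
rewrite -aS -psi_class in Lm Ln h.
exists a => //; exists m%:Z, (m + d)%:Z; split; last lia.
apply/adjacent_lengths; exists m, (m + d)%N; split=> //; first lia.
by move=> i /h; lia.
Qed.

End DivisorHom.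

(** * A gap in a set of lengths *)

Lemma leq_sum_ord (k : nat) (f g : nat -> nat) : (forall i, (i < k)%N -> (f i <= g i)%N) ->
  (\sum_(i < k) f i <= \sum_(i < k) g i)%N.
Proof. by move=> h; apply: leq_sum => i _; apply: h. Qed.

(* The i-th atom consists of nG i elements G, nH i elements -H, s i elements g,
   t i elements -h and a rest of weight phi i and size c i. *)
Lemma atom_count_gap (k G H g h F Fc L : nat) (nG nH s t Phi c : nat -> nat) (phi : nat -> int) :
  (0 < g)%N -> (0 < h)%N ->
  (forall i, (i < k)%N -> [/\
     G%:Z * (nG i)%:Z + g%:Z * (s i)%:Z + phi i = H%:Z * (nH i)%:Z + h%:Z * (t i)%:Z,
     (`|phi i| <= Phi i)%N,
     (h <= s i)%N -> (g <= t i)%N -> [/\ nG i = 0, nH i = 0 & s i = h]%N &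
     (0 < nG i + nH i + s i + t i + c i)%N]) ->
  (\sum_(i < k) nG i = 2 * h)%N -> (\sum_(i < k) nH i = 2 * g)%N ->
  (\sum_(i < k) s i = 2 * H)%N -> (\sum_(i < k) t i = 2 * G)%N ->
  (\sum_(i < k) Phi i = F)%N -> (\sum_(i < k) c i = Fc)%N ->
  (2 * g * h * h + F + 2 * h * g * g + h * (g * h + F) * L < H)%N -> (F + g * h <= H)%N ->
  (2 * g * H + F + h * g <= G)%N ->
  (k <= 2 * h + 2 * g + 2 * F + Fc)%N \/ (L <= k)%N.
Proof.
move=> g0 h0 hi eG eH es et eF ec Hbig HF Gbig.
have [/existsP[i0 /andP[G0 H0]]|/existsPn no] :=
  boolP [exists i : 'I_k, (0 < nG i)%N && (0 < nH i)%N]; [right|left].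
  have nHle i : (i < k)%N -> (nH i <= 2 * g)%N.
    by move=> ik; rewrite -eH (bigD1 (Ordinal ik))//= leq_addr.
  have Phile i : (i < k)%N -> (Phi i <= F)%N.
    by move=> ik; rewrite -eF (bigD1 (Ordinal ik))//= leq_addr.
  (* In the sum over all atoms [2 * h * G] cancels, and an atom with both [G] and [-H] leaves at
     least [H] on the left, which forces [k] to be large. The case distinction rests on the fact
     that an atom containing [G] or [-H] has fewer than [h] elements [g] or fewer than [g] elements
     [-h]. *)
  have pt i : (i < k)%N -> (h * t i + H * (if (0 < nG i)%N then nH i else 0) <=
      (G + g * h) * nG i + Phi i + h * g * nH i + h * (g * h + F))%N.
    move=> ik; have [e ph h2 _] := hi i ik; have nHi := nHle i ik; have Phii := Phile i ik.
    case: posnP => [nG0|nGp].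
      rewrite nG0 !muln0 addn0 add0n.
      have [nH0|nHp] := posnP (nH i).
        rewrite nG0 nH0 in e; have [gt|tg] := leqP (g)%N (t i).
          have sh : (s i <= h)%N.
            by rewrite leqNgt; apply/negP => hs; have [_ _ sE] := h2 (ltnW hs) gt; lia.
          have : (g * s i <= g * h)%N by rewrite leq_mul2l sh orbT.
          nia.
        nia.
      have sh : (h <= s i)%N.
        rewrite -(leq_pmul2l g0); have : (H <= H * nH i)%N by rewrite leq_pmulr.
        by rewrite nG0 in e; nia.
      have tg : (t i < g)%N.
        by rewrite ltnNge; apply/negP => gt; have [_ nH0 _] := h2 sh gt; lia.
      have : (h * t i <= h * g)%N by rewrite leq_mul2l ltnW ?orbT.
      have : (h * g <= h * g * nH i)%N by rewrite leq_pmulr.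
      nia.
    have tg : (g <= t i)%N.
      rewrite -(leq_pmul2l h0); have : (G <= G * nG i)%N by rewrite leq_pmulr.
      have : (H * nH i <= H * (2 * g))%N by rewrite leq_mul2l nHi orbT.
      nia.
    have sh : (s i < h)%N.
      by rewrite ltnNge; apply/negP => hs; have [nG0 _ _] := h2 hs tg; lia.
    have : (g * s i <= g * h)%N by rewrite leq_mul2l ltnW ?orbT.
    have : (g * h <= g * h * nG i)%N by rewrite leq_pmulr.
    nia.
  have := leq_sum_ord pt; rewrite !big_split /= -!big_distrr /= eG eH et eF.
  rewrite sum_nat_const card_ord.
  have : (1 <= \sum_(i < k) (if 0 < nG i then nH i else 0))%N.
    by rewrite (bigD1 i0)//= G0; lia.
  move: (\sum_(i < k) _)%N => N N1 le.
  have HN : (H <= H * N)%N by rewrite leq_pmulr.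
  rewrite leqNgt; apply/negP => kL.
  have : (k * (h * (g * h + F)) <= h * (g * h + F) * L)%N.
    by rewrite mulnC leq_mul2l ltnW ?orbT.
  move: le HN Hbig; rewrite (mulnCA h k).
  move: (H * N)%N (h * (g * h + F) * L)%N (k * (h * (g * h + F)))%N => a b c'.
  lia.
have one i : (i < k)%N -> ~~ ((0 < nG i) && (0 < nH i))%N by move=> ik; apply: (no (Ordinal ik)).
(* If no atom contains both [G] and [-H], the total weights leave at most [F] elements [-h] to atoms
   without [G], and by [p2] at most [F] elements [g] to atoms without [-H]. By [p3] each atom
   contains an element counted here, a [G], a [-H] or a part of the rest. *)
have p1 i : (i < k)%N -> (G * nG i + (if nG i == 0 then t i else 0) <= h * t i + Phi i)%N.
  move=> ik; have [e ph _ _] := hi i ik; have := one i ik; rewrite negb_and -!leqNgt !leqn0.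
  case: eqP => [->|] /=; first by rewrite muln0 add0n; nia.
  by move=> _ /eqP nH0; rewrite nH0 in e; nia.
have p2 i : (i < k)%N -> (H * nH i + (if nH i == 0 then s i else 0) <= g * s i + Phi i)%N.
  move=> ik; have [e ph _ _] := hi i ik; have := one i ik; rewrite negb_and -!leqNgt !leqn0.
  rewrite orbC; case: eqP => [->|] /=; first by rewrite muln0 add0n; nia.
  by move=> _ /eqP nG0; rewrite nG0 in e; nia.
have p3 i : (i < k)%N -> (1 <= nG i + nH i + (if nG i == 0 then t i else 0) +
    (if nH i == 0 then s i else 0) + c i)%N.
  by move=> ik; have [_ _ _ pos] := hi i ik; case: eqP; case: eqP; lia.
have := leq_sum_ord p1; have := leq_sum_ord p2; have := leq_sum_ord p3.
rewrite !big_split /= -!big_distrr /= eG eH es et eF ec sum_nat_const card_ord muln1.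
move: (\sum_(i < k) (if nG i == 0 then _ else _))%N (\sum_(i < k) (if nH i == 0 then _ else _))%N => a b.
nia.
Qed.

(** Refinement against a power of one prime, all parts of which are powers of it. Applied four
    times, it yields the multiplicities that enter [atom_count_gap]. *)
Lemma riesz_copies (P : choiceType) (p : P) (n k : nat) (f : nat -> {mset P}) (B : {mset P}) :
  \sum_(i < k) f i = [mset p] *+ n + B ->
  exists (m : nat -> nat) (b : nat -> {mset P}), [/\
    forall i, (i < k)%N -> f i = [mset p] *+ m i + b i,
    (\sum_(i < k) m i = n)%N & \sum_(i < k) b i = B].
Proof.
elim: k n B => [|k IH] n B.
  rewrite big_ord0 => /esym/mset_addI0[e ->].
  exists (fun=> 0%N), (fun=> 0); split=> //; rewrite !big_ord0//.
  by have := size_msetMn [mset p] n; rewrite e size_mset0R size_mset1 muln1.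
rewrite big_ord_recr /= addrC => /riesz[A1 [A2 [B1 [B2 [fE rE nE ->]]]]].
have le x : ((A1 x + A2 x) = n * (x == p))%N.
  by rewrite -msetDE -nE msetMnE mset1E.
have copies (A : {mset P}) : (forall x, x != p -> A x = 0%N) -> A = [mset p] *+ A p.
  move=> h; apply/mset_ext => x; rewrite msetMnE mset1E.
  by have [->|/h ->] := eqVneq x p; rewrite ?muln1 ?muln0.
have A1E : A1 = [mset p] *+ A1 p.
  by apply: copies => x xp; have := le x; rewrite (negbTE xp); lia.
have A2E : A2 = [mset p] *+ A2 p.
  by apply: copies => x xp; have := le x; rewrite (negbTE xp); lia.
rewrite A2E in rE; have [m [b [fi ms bs]]] := IH _ _ rE.
exists (fun i => if i == k then A1 p else m i), (fun i => if i == k then B1 else b i); split.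
- move=> i; rewrite ltnS leq_eqVlt; case: eqP => [-> _|_ /= ik]; first by rewrite fE -A1E.
  exact: fi.
- rewrite big_ord_recr /= eqxx; under eq_bigr => i _ do rewrite (ltn_eqF (ltn_ord i)).
  by rewrite ms; have := le p; rewrite eqxx; lia.
- rewrite big_ord_recr /= eqxx; under eq_bigr => i _ do rewrite (ltn_eqF (ltn_ord i)).
  by rewrite bs addrC.
Qed.

Lemma count_msetD (P : choiceType) (a : pred P) (A B : {mset P}) :
  count a (A + B : {mset P}) = (count a A + count a B)%N.
Proof. by have /permP -> := perm_msetD A B; rewrite count_cat. Qed.

Lemma count_msetMn (P : choiceType) (a : pred P) (p : P) n :
  count a ([mset p] *+ n : {mset P}) = (n * a p)%N.
Proof.
elim: n => [|n IH]; first by rewrite mulr0n enum_mset0.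
by rewrite mulrS count_msetD IH enum_msetn /= addn0 mulSn.
Qed.

Lemma count_sum_mset (P : choiceType) (a : pred P) (s : seq {mset P}) :
  count a (\sum_(U <- s) U : {mset P}) = (\sum_(U <- s) count a U)%N.
Proof.
elim: s => [|U s IH]; first by rewrite !big_nil enum_mset0.
by rewrite !big_cons count_msetD IH.
Qed.

Lemma zfact_count_ge (P : choiceType) (Z : {mset P} -> Prop) (a : pred P) S s :
  (forall U, zatom Z U -> (0 < count a U)%N) -> zfact Z S s -> (size s <= count a S)%N.
Proof.
move=> h [hs <-]; rewrite count_sum_mset -sum1_size !big_seq.
by apply: leq_sum => U /hs/h.
Qed.

Lemma zfact_count_le (P : choiceType) (Z : {mset P} -> Prop) (a : pred P) n S s :
  (forall U, zatom Z U -> (count a U <= n)%N) -> zfact Z S s -> (count a S <= n * size s)%N.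
Proof.
move=> h [hs <-]; rewrite count_sum_mset.
apply: (@leq_trans (\sum_(U <- s) n)%N); last by rewrite big_const_seq count_predT iter_addn_0.
by rewrite !big_seq; apply: leq_sum => U /hs/h.
Qed.

(** Nonempty sums of negative primes have negative weight. This bounds lengths by the number of
    primes of class at least 0. *)
Lemma zatom_nonneg (P : choiceType) (w : P -> int) U : zatom (wt0 w) U ->
  (0 < count (fun p => (0 <= w p)%R) U)%N.
Proof.
move=> [ZU U0 _]; rewrite lt0n; apply/eqP => c0.
have : msum w U <= - (size U)%:Z.
  rewrite {ZU U0}; move: U c0; apply: mset_ind => [|p A IH].
    by rewrite msum0 size_mset0R.
  rewrite count_msetD enum_msetn /= addn0 msumD msum1 size_msetD size_mset1.
  by case: leP => // wp /IH; lia.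
rewrite ZU => le; apply: U0; apply: size_mset_eq0R; lia.
Qed.

(** [S] is twice [X1 + X2] plus [F], with [X1] of type [G^h (-h)^G] and [X2] of type [(-H)^g g^H]. A
    short and a long factorization of [X1 + X2] produce the lengths on both sides of the gap. Two
    low lengths, from [x] and [y], and two high ones, [b] and [b'], allow the gap to be kept away
    from both ends of the set of lengths, as (b4) demands. *)
Lemma wt0_zlen_gap (P : choiceType) (w : P -> int) (F : {mset P}) x y (L : nat) :
  (forall n : nat, exists p, n%:Z <= w p) -> (forall n : nat, exists p, w p <= - n%:Z) ->
  zfact (wt0 w) F x -> zfact (wt0 w) F y ->
  exists S m K b b', [/\ zlen (wt0 w) S (m + size x)%N /\ zlen (wt0 w) S (m + size y)%N,
    zlen (wt0 w) S b /\ zlen (wt0 w) S b',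
    [/\ (m + size x <= K)%N, (m + size y <= K)%N, (K + L <= b)%N & (b + L <= b')%N] &
    forall k, zlen (wt0 w) S k -> (k <= K)%N \/ (K + L <= k)%N].
Proof.
move=> pos neg fx fy; have satw := wt0_saturated w.
have [p0 wp0] := pos 1%N; have [q0 wq0] := neg 1%N.
pose g := `|w p0|%N; pose h := `|w q0|%N.
have wp0E : w p0 = g%:Z by rewrite /g; lia.
have wq0E : w q0 = - h%:Z by rewrite /h; lia.
have g0 : (0 < g)%N by rewrite /g; lia.
have h0 : (0 < h)%N by rewrite /h; lia.
pose absw (A : {mset P}) := (\sum_(p <- (A : seq P)) `|w p|)%N.
have abswD A B : absw (A + B) = (absw A + absw B)%N.
  by rewrite /absw (perm_big _ (perm_msetD A B)) big_cat.
have absw0 : absw 0 = 0%N by rewrite /absw enum_mset0 big_nil.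
have abswP A : (`|msum w A| <= absw A)%N.
  move: A; apply: mset_ind => [|p A IH]; first by rewrite msum0 absw0.
  have -> : absw ([mset p] + A) = (`|w p| + absw A)%N.
    by rewrite abswD /absw enum_msetn /= big_seq1.
  by rewrite msumD msum1; lia.
pose Fw := absw F; pose Fc := size F.
(* [K] is the bound of [atom_count_gap] when no atom mixes [G] and [-H]; [q] takes the place of [L]
   there. *)
pose K := (2 * h + 2 * g + 2 * Fw + Fc)%N; pose q := (K + L)%N.
(* [H0] gathers the lower bounds required of [H], with 1 for the strict inequality; [G] depends on
   [H] and is chosen after it. The summands [h * q] here and [g * q] in [G0] make room for [q]
   copies of [B0] in [X1 + X2]. *)
pose H0 := (2 * g * h * h + Fw + 2 * h * g * g + h * (g * h + Fw) * q + 1 + Fw + g * h + h * q)%N.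
have [pH wpH] := neg H0; pose H := `|w pH|%N.
have HE : w pH = - H%:Z by rewrite /H; lia.
have HH0 : (H0 <= H)%N by rewrite /H; lia.
pose G0 := (2 * g * H + Fw + h * g + g * q)%N.
have [pG wpG] := pos G0; pose G := `|w pG|%N.
have GE : w pG = G%:Z by rewrite /G; lia.
have GG0 : (G0 <= G)%N by rewrite /G; lia.
clearbody H G; clearbody g h.
pose X1 : {mset P} := [mset pG] *+ h + [mset q0] *+ G.
pose X2 : {mset P} := [mset pH] *+ g + [mset p0] *+ H.
pose B0 : {mset P} := [mset p0] *+ h + [mset q0] *+ g.
pose R : {mset P} := [mset pG] *+ h + [mset q0] *+ (G - g * q) + [mset pH] *+ g + [mset p0] *+ (H - h * q).
have wM p n : msum w ([mset p] *+ n) = w p * n%:Z by rewrite msumMn msum1 -mulr_natr natz.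
have ZX1 : wt0 w X1 by rewrite /wt0 msumD !wM GE wq0E; lia.
have ZX2 : wt0 w X2 by rewrite /wt0 msumD !wM HE wp0E; lia.
have ZB0 : wt0 w B0 by rewrite /wt0 msumD !wM wp0E wq0E; lia.
have hqH : (h * q <= H)%N by apply: leq_trans HH0; rewrite leq_addl.
have gqG : (g * q <= G)%N by apply: leq_trans GG0; rewrite leq_addl.
have EE : X1 + X2 = B0 *+ q + R.
  apply/mset_ext => c; rewrite /X1 /X2 /B0 /R !msetDE !msetMnE !msetDE !msetMnE.
  rewrite !mulnBl; have := leq_mul gqG (leqnn ([mset q0] c)).
  have := leq_mul hqH (leqnn ([mset p0] c)); lia.
have ZR : wt0 w R.
  have [_ ZD ZB] := satw; apply: (ZB (B0 *+ q)); first exact: saturatedMn.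
  by rewrite -EE; apply: ZD.
have [x1 f1] := zfact_exists ZX1; have [x2 f2] := zfact_exists ZX2.
have [r fr] := zfact_exists ZR; have [z0 fz0] := zfact_exists ZB0.
(* Each atom has a prime of nonnegative class, and [X1] has only [h] of these; for [X2] the argument
   is repeated with opposite signs. *)
have s1 : (size x1 <= h)%N.
  have := zfact_count_ge (@zatom_nonneg _ w) f1.
  rewrite /X1 count_msetD !count_msetMn GE wq0E; lia.
have s2 : (size x2 <= g)%N.
  rewrite -wt0_opp in f2; have := zfact_count_ge (@zatom_nonneg _ (fun p => - w p)) f2.
  rewrite /X2 count_msetD !count_msetMn HE wp0E; lia.
have sz0 : (0 < size z0)%N.
  rewrite lt0n; apply/eqP => /size0nil e; have [_] := fz0; rewrite e big_nil => /esym B00.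
  have := size_msetMn [mset p0] h; have [-> _] := mset_addI0 B00.
  by rewrite size_mset0R size_mset1; lia.
pose zeta := flatten (nseq q z0) ++ r.
have fzeta : zfact (wt0 w) (X1 + X2) zeta by rewrite EE; apply/zfact_cat => //; apply: zfact_nseq.
have szeta : (q <= size zeta)%N.
  by rewrite size_cat flatten_nseq_size; have := leq_pmulr q sz0; lia.
pose eta := x1 ++ x2.
have feta : zfact (wt0 w) (X1 + X2) eta by apply: zfact_cat.
have seta : (size eta <= h + g)%N by rewrite size_cat leq_add.
pose S := X1 + X2 + (X1 + X2) + F.
have sx : (size x <= Fc)%N := zfact_size fx.
have sy : (size y <= Fc)%N := zfact_size fy.
exists S, (size eta + size eta)%N, K, (size zeta + size eta + size x)%N, (size zeta + size zeta + size x)%N.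
split.
- split; [exists (eta ++ eta ++ x)|exists (eta ++ eta ++ y)].
  + by rewrite catA; apply: zfact_cat => //; apply: zfact_cat.
  + by rewrite !size_cat !addnA.
  + by rewrite catA; apply: zfact_cat => //; apply: zfact_cat.
  + by rewrite !size_cat !addnA.
- split; [exists (zeta ++ eta ++ x)|exists (zeta ++ zeta ++ x)].
  + by rewrite catA; apply: zfact_cat => //; apply: zfact_cat.
  + by rewrite !size_cat !addnA.
  + by rewrite catA; apply: zfact_cat => //; apply: zfact_cat.
  + by rewrite !size_cat !addnA.
- by split; rewrite /K /q in szeta *; lia.
move=> _ [s [hs es] <-].
have es' : \sum_(i < size s) nth 0 s i = [mset pG] *+ (2 * h) +
    ([mset q0] *+ (2 * G) + ([mset pH] *+ (2 * g) + ([mset p0] *+ (2 * H) + F))).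
  have -> : \sum_(i < size s) nth 0 s i = S by rewrite -es [RHS](big_nth 0) big_mkord.
  rewrite /S /X1 /X2; apply/mset_ext => c.
  by rewrite !msetDE !msetMnE; lia.
have [nG [b1 [E1 S1 /riesz_copies[t [b2 [E2 S2 /riesz_copies[nH [b3 [E3 S3]]]]]]]]] := riesz_copies es'.
move=> /riesz_copies[n0 [b4 [E4 S4 S5]]].
apply: (@atom_count_gap (size s) G H g h Fw Fc (K + L) nG nH n0 t (fun i => absw (b4 i))
  (fun i => size (b4 i)) (fun i => msum w (b4 i))) => //.
- move=> i ik; have aU := hs _ (mem_nth 0 ik).
  have UE : nth 0 s i = [mset pG] *+ nG i + ([mset q0] *+ t i + ([mset pH] *+ nH i +
    ([mset p0] *+ n0 i + b4 i))) by rewrite E1// E2// E3// E4.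
  split.
  + have [] := aU; rewrite {1}UE /wt0 !msumD !wM GE HE wp0E wq0E; lia.
  + exact: abswP.
  + move=> hn gt.
    have UB : nth 0 s i = B0.
      apply: (zatom_eq satw aU ZB0).
        move=> e; have := size_msetMn [mset p0] h; have [-> _] := mset_addI0 e.
        by rewrite size_mset0R size_mset1; lia.
      move=> c; rewrite UE /B0 !msetDE !msetMnE.
      have := leq_mul hn (leqnn ([mset p0] c)); have := leq_mul gt (leqnn ([mset q0] c)); lia.
    have e0 : B0 + ([mset pG] *+ nG i + [mset q0] *+ (t i - g) + [mset pH] *+ nH i) + ([mset p0] *+ (n0 i - h) + b4 i) = B0.
      rewrite -[RHS]UB UE; apply/mset_ext => c; rewrite /B0 !msetDE !msetMnE !mulnBl.
      have := leq_mul hn (leqnn ([mset p0] c)); have := leq_mul gt (leqnn ([mset q0] c)); lia.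
    have {}e0 : [mset pG] *+ nG i + [mset q0] *+ (t i - g) + [mset pH] *+ nH i +
        ([mset p0] *+ (n0 i - h) + b4 i) = 0.
      by apply: (@cancel_addI _ B0); rewrite addrA e0 addr0.
    have := congr1 (fun A : {mset P} => size A) e0.
    by rewrite !size_msetD !size_msetMn !size_mset1 size_mset0R; split; lia.
  + have := zatom_size aU; rewrite UE !size_msetD !size_msetMn !size_mset1; lia.
- rewrite /Fw -S5; elim: (size s) => [|n IH]; first by rewrite !big_ord0 absw0.
  by rewrite !big_ord_recr /= abswD IH.
- rewrite /Fc -S5; elim: (size s) => [|n IH]; first by rewrite !big_ord0 size_mset0R.
  by rewrite !big_ord_recr /= size_msetD IH.
- by apply: leq_trans HH0; rewrite /H0 /q; lia.
- by apply: leq_trans HH0; rewrite /H0; lia.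
- by apply: leq_trans GG0; rewrite /G0; lia.
Qed.

(** * Atoms with finitely many negative classes *)

Lemma perm_union (T : choiceType) (x a b a' b' : seq T) :
  perm_eq x (a ++ b) -> perm_eq x (a' ++ b') ->
  exists c d e e', [/\ perm_eq x (c ++ d), (size c <= size a + size a')%N,
    perm_eq c (a ++ e) & perm_eq c (a' ++ e')].
Proof.
move=> /permP p /permP p'.
pose c : {mset T} := (seq_mset a `|` seq_mset a')%mset.
have cE u : count_mem u (c : seq T) = maxn (count_mem u a) (count_mem u a').
  by rewrite count_mem_mset msetE2 !mset_seqE.
have [|u _|d pd] := @count_perm_cat _ (c : seq T) c x; first by [].
  by rewrite cE; have := p (pred1 u); have := p' (pred1 u); rewrite !count_cat; lia.
have sub (s : seq T) : (forall u, count_mem u s <= count_mem u (c : seq T))%N ->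
    exists e, perm_eq (c : seq T) (s ++ e).
  by move=> h; apply: (@count_perm_cat _ s) => // u _.
have [|e pe] := sub a; first by move=> u; rewrite cE; lia.
have [|e' pe'] := sub a'; first by move=> u; rewrite cE; lia.
exists c, d, e, e'; split=> //.
rewrite -(perm_size (perm_eq_seq_mset a)) -(perm_size (perm_eq_seq_mset a')) -size_msetD.
by apply: size_mset_le => u; rewrite msetDE msetE2; lia.
Qed.

(* The J largest values are on average at least as large as all of them. *)
Lemma perm_top (T : eqType) (f : T -> nat) (J v : nat) (x : seq T) :
  (v <= \sum_(u <- x) f u)%N -> (v * size x <= J * \sum_(u <- x) f u)%N ->
  exists a b, [/\ perm_eq x (a ++ b), (size a <= J)%N & (v <= \sum_(u <- a) f u)%N].
Proof.
move=> vx vJ; have [xJ|Jx] := leqP (size x) J.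
  by exists x, [::]; rewrite cats0.
pose r := fun a b : T => (f b <= f a)%N; pose s := sort r x.
have ps : perm_eq x (take J s ++ drop J s) by rewrite cat_take_drop perm_sym perm_sort.
have : pairwise r (take J s ++ drop J s).
  rewrite cat_take_drop -sorted_pairwise; first by apply: sort_sorted => a b; apply: leq_total.
  by move=> a b c h1 h2; apply: leq_trans h2 h1.
rewrite pairwise_cat => /andP[/allrelP h _].
have st : size (take J s) = J by rewrite size_takel// size_sort ltnW.
exists (take J s), (drop J s); split=> //; first by rewrite st.
have sx : size x = (J + size (drop J s))%N by rewrite (perm_size ps) size_cat st.
move: vJ; rewrite (perm_big _ ps) /= big_cat /= mulnDr => vJ.
have cross : (J * \sum_(u <- drop J s) f u <= size (drop J s) * \sum_(u <- take J s) f u)%N.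
  apply: (@leq_trans (\sum_(u <- drop J s) \sum_(v <- take J s) f v)%N); last first.
    by rewrite big_const_seq count_predT iter_addn_0 mulnC.
  rewrite big_distrr /= !big_seq; apply: leq_sum => u ud.
  apply: (@leq_trans (\sum_(v <- take J s) f u)%N).
    by rewrite big_const_seq count_predT iter_addn_0 st mulnC.
  by rewrite !big_seq; apply: leq_sum => t ta; apply: h.
have [x0|xpos] := posnP (size x); first by rewrite x0 in Jx.
rewrite -(leq_pmul2r xpos); apply: leq_trans vJ _.
by rewrite sx mulnDr (mulnC _ J) leq_add2l [leqRHS]mulnC.
Qed.

Lemma mset_count_mem (P : choiceType) (a : pred P) (A : {mset P}) : (0 < count a A)%N ->
  exists p B, A = [mset p] + B /\ a p.
Proof.
rewrite -has_count => /hasP[p pA ap]; have [|B ->] := @mset_mem _ A p.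
  by rewrite mset_gt0.
by exists p, B.
Qed.

Section Tame.
Variables (P : choiceType) (w : P -> int) (N : nat).
Hypotheses (N0 : (0 < N)%N) (lbw : forall p, - N%:Z <= w p).
Implicit Types (S U V A B R : {mset P}) (s x y : seq {mset P}).
Local Notation Z := (wt0 w).
Local Notation nonneg := (count (fun p => 0 <= w p)).
Local Notation cl := (msum (fun p => [mset w p])).

(** Negative primes of [R] are appended while the partial sum is positive; each lowers it by at most
    [N], so it stays above [-N]. *)
Lemma refill_neg n A R : size R = n -> msum w (A + R) = 0 -> - N%:Z < msum w A ->
  exists B R', [/\ R = B + R', nonneg B = 0%N & - N%:Z < msum w (A + B) <= 0].
Proof.
elim: n A R => [|n IH] A R sR.
  rewrite (size_mset_eq0R sR) addr0 => eA lA; exists 0, 0.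
  by rewrite addr0 enum_mset0 addr0 eA lexx andbT; split=> //; lia.
move=> eAR lA; have [le|gt] := leP (msum w A) 0.
  by exists 0, R; rewrite add0r addr0 enum_mset0 lA le.
have [|q [R1 [RE wq]]] := @msum_neg_mem _ w R; first by move: eAR; rewrite msumD; lia.
move: sR; rewrite RE size_msetD size_mset1 => -[sR1].
have [||B [R' [R1E cB hB]]] := IH (A + [mset q]) R1 sR1.
- by rewrite -addrA -RE.
- by rewrite msumD msum1; have := lbw q; lia.
exists ([mset q] + B), R'; rewrite R1E addrA; split=> //; last by rewrite addrA.
by rewrite count_msetD enum_msetn /= cB leNgt wq.
Qed.

(* Order an atom so that a nonnegative prime is appended only when the partial
   sum is <= 0 and a negative one otherwise. The partial sums before the
   nonnegative primes lie in ]-N, 0], and they are distinct. *)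
Lemma zatom_nonneg_le U : zatom Z U -> (nonneg U <= N)%N.
Proof.
move=> [ZU U0 irr]; rewrite leqNgt; apply/negP => NU.
have chain j : (j <= nonneg U)%N -> exists f : nat -> {mset P},
    forall i, (i <= j)%N -> [/\ exists R, U = f i + R, nonneg (f i) = i,
      - N%:Z < msum w (f i) <= 0 & forall k, (k <= i)%N -> exists B, f i = f k + B].
  elim: j => [_|j IH jU].
    exists (fun=> 0) => i; rewrite leqn0 => /eqP ->; split.
    - by exists U; rewrite add0r.
    - by rewrite enum_mset0.
    - by rewrite msum0; lia.
    - by move=> k _; exists 0; rewrite addr0.
  have [f hf] := IH (ltnW jU); have [[R UE] cj wj mono] := hf j (leqnn j).
  have [|p [R1 [RE wp]]] := @mset_count_mem _ (fun p => 0 <= w p) R.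
    by move: jU; rewrite UE count_msetD cj; lia.
  have [||B [R' [R1E cB hB]]] := @refill_neg _ (f j + [mset p]) R1 erefl.
  - by rewrite -addrA -RE -UE.
  - by rewrite msumD msum1; lia.
  exists (fun i => if (i <= j)%N then f i else f j + [mset p] + B) => i.
  rewrite leq_eqVlt => /orP[/eqP->|]; last first.
    rewrite ltnS => ij; rewrite ij; have [h1 h2 h3 h4] := hf i ij; split=> // k ki.
    by rewrite (leq_trans ki ij); apply: h4.
  rewrite ltnn; split=> //.
  - by exists R'; rewrite UE RE R1E !addrA.
  - by rewrite !count_msetD cj cB enum_msetn /= wp; lia.
  - move=> k; rewrite leq_eqVlt => /orP[/eqP->|]; first by exists 0; rewrite ltnn addr0.
    rewrite ltnS => kj; rewrite kj; have [D ->] := mono k kj.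
    by exists (D + [mset p] + B); rewrite !addrA.
have [f hf] := chain _ (leqnn _).
have lt (i : 'I_N.+1) : (`|msum w (f i)| < N)%N.
  have [_ _ h _] := hf i (ltnW (leq_trans (ltn_ord i) NU)); lia.
pose F i : 'I_N := Ordinal (lt i).
(* There are [N + 1] prefixes but only [N] possible partial sums. The difference of two prefixes
   with equal sums is a nontrivial part of weight 0, and a proper one since [b <= N < nonneg U]. *)
have /injectivePn[a [b ab Fab]] : ~~ injectiveb F.
  apply/negP => /injectiveP/leq_card; rewrite !card_ord; lia.
wlog {ab} ab : a b Fab / (a < b)%N.
  move=> h; move: ab; rewrite -val_eqE /= neq_ltn => /orP[ab|ba]; first exact: (h a b).
  exact: (h b a).
have [_ ca wa _] := hf a (ltnW (leq_trans (ltn_ord a) NU)).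
have [[R UE] cb wb mono] := hf b (ltnW (leq_trans (ltn_ord b) NU)).
have [B fb] := mono a (ltnW ab).
have eab : msum w (f a) = msum w (f b) by move: (congr1 val Fab) => /=; lia.
have ZB : Z B by move: eab; rewrite fb msumD /wt0; lia.
have ZR : Z (f a + R) by move: ZU; rewrite /wt0 UE fb !msumD; rewrite /wt0 in ZB; lia.
have UE' : U = B + (f a + R) by rewrite UE fb addrA (addrC B).
case: (irr _ _ UE' ZB ZR) => [B0|/mset_addI0[_ R0]].
  by move: cb; rewrite fb B0 addr0 ca; lia.
by move: NU; rewrite UE R0 addr0 cb ltnNge -ltnS ltn_ord.
Qed.

End Tame.

(** * Exchanging primes of equal class between atoms *)

Section Classes.
Variables (P : choiceType) (w : P -> int).
Implicit Types (S U V A B R : {mset P}) (s x y : seq {mset P}).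
Local Notation Z := (wt0 w).
Local Notation nonneg := (count (fun p => 0 <= w p)).
Local Notation cl := (msum (fun p => [mset w p])).

Lemma class_count A c : cl A c = count (fun p => w p == c) A.
Proof.
move: A; apply: mset_ind => [|p A IH]; first by rewrite msum0 mset0RE enum_mset0.
by rewrite msumD msum1 msetDE IH count_msetD enum_msetn /= addn0 mset1E eq_sym.
Qed.

(** The nonnegative part [A] will be covered prime by prime, the negative part [B] only class by
    class. *)
Lemma class_part U : exists A B, [/\ U = A + B, size A = nonneg U &
  forall c, cl U c = if 0 <= c then cl A c else cl B c].
Proof.
move: U; apply: mset_ind => [|p U [A [B [-> sA h]]]].
  exists 0, 0; rewrite addr0 size_mset0R enum_mset0 msum0; split=> // c.
  by rewrite mset0RE if_same.
rewrite count_msetD enum_msetn /= addn0.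
have clp (D : {mset P}) c : cl ([mset p] + D) c = ((c == w p) + cl D c)%N.
  by rewrite msumD msum1 msetDE mset1E.
have [wp|wp] := leP 0 (w p).
  exists ([mset p] + A), B; rewrite addrA size_msetD size_mset1 sA; split=> // c.
  rewrite -addrA !clp h; case: leP => // c0.
  by have -> : (c == w p) = false by lia.
exists A, ([mset p] + B); rewrite sA; split=> //; first by rewrite addrCA.
move=> c; rewrite !clp h; case: leP => // c0.
by have -> : (c == w p) = false by lia.
Qed.

Lemma class_swap_step S y U U' R : zfact Z S y -> U \in y -> cl U' = cl U -> S = U' + R ->
  U' != U -> exists V r U1 V1, [/\ perm_eq y ([:: U; V] ++ r),
    zfact Z (\sum_(W <- [:: U; V]) W) [:: U1; V1], cl U1 = cl U &
    (size (U' `\` U1)%mset < size (U' `\` U)%mset)%N].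
Proof.
move=> fy Uy clUU SE nUU; have [hy ey] := fy; have tr := @class_transfer _ _ w erefl.
have eU : exists W A B, [/\ U' = W + A, U = W + B & forall p, (0 < A p)%N -> B p = 0%N].
  exists (U' `&` U)%mset, (U' `\` U)%mset, (U `\` U')%mset; split.
  - by apply/mset_ext => p; rewrite msetDE !msetE2; lia.
  - by apply/mset_ext => p; rewrite msetDE !msetE2; lia.
  - by move=> p; rewrite !msetE2; lia.
have [W [A [B [U'E UE disj]]]] := eU.
have clAB : cl A = cl B.
  by apply: (@cancel_addI _ (cl W)); rewrite -!msumD -U'E -UE.
have [p [A1 AE]] : exists p A1, A = [mset p] + A1.
  have [A0|/eqP A0] := eqVneq A 0.
    have szcl (D : {mset P}) : size (cl D : {mset int}) = size D.
      move: D; apply: mset_ind => [|q D IH]; first by rewrite msum0 !size_mset0R.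
      by rewrite msumD msum1 !size_msetD IH !size_mset1.
    have B0 : B = 0 by apply: size_mset_eq0R; rewrite -szcl -clAB A0 msum0 size_mset0R.
    by move/eqP: nUU; rewrite U'E UE A0 B0.
  have [|q [A1 [-> _]]] := @mset_count_mem _ predT A; last by exists q, A1.
  by rewrite count_predT lt0n; apply/eqP => /size_mset_eq0R.
have [q [B1 [BE /eqP wq]]] : exists q B1, B = [mset q] + B1 /\ w q == w p.
  apply: mset_count_mem; rewrite -class_count -clAB AE msumD msum1 msetDE mset1E eqxx; lia.
pose r := rem U y; have pr : perm_eq y (U :: r) := perm_to_rem Uy.
(* [p] occurs in [U'], hence in [S], more often than in [U]. *)
have [V Vr pV] : exists2 V, V \in r & (0 < V p)%N.
  have : (0 < \sum_(V <- r) V p)%N.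
    have : (U p + \sum_(V <- r) V p = U' p + R p)%N.
      by rewrite -!msetDE -SE -ey (perm_big _ pr) /= big_cons msetDE sum_msetE.
    have := disj p; rewrite AE U'E UE AE !msetDE mset1E eqxx; lia.
  have [/hasP[V Vr pV] _|/hasPn no] := boolP (has (fun V : {mset P} => 0 < V p)%N r).
    by exists V.
  by rewrite big_seq big1// => V /no; rewrite -leqNgt leqn0 => /eqP.
have [V1 VE] := mset_mem pV.
have Vy : V \in y by rewrite (perm_mem pr) inE Vr orbT.
have atom_cl X X' : zatom Z X -> cl X' = cl X -> zatom Z X'.
  move=> aX e; have ZX' : Z X' by rewrite /wt0 -msum_class e msum_class; case: aX.
  by apply/(transfer_atom tr ZX'); rewrite e; apply/(transfer_atom tr) => //; case: aX.
exists V, (rem V r), (W + [mset p] + B1), ([mset q] + V1); split.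
- by rewrite (perm_trans pr)//= perm_cons perm_to_rem.
- split.
    move=> X; rewrite !inE => /orP[]/eqP->.
      by apply: (atom_cl U); [exact: hy|rewrite UE BE !msumD !msum1 wq addrA].
    by apply: (atom_cl V); [exact: hy|rewrite VE !msumD !msum1 wq].
  rewrite !big_cons !big_nil UE VE BE; apply/mset_ext => c; rewrite !msetDE; lia.
- by rewrite UE BE !msumD !msum1 wq addrA.
- have -> : size (U' `\` U)%mset = size A.
    congr (size (_ : {mset P})); apply/mset_ext => c; rewrite msetE2 U'E UE !msetDE.
    by have := disj c; lia.
  rewrite AE size_msetD size_mset1 ltnS; apply: size_mset_le => c.
  by rewrite msetE2 U'E AE !msetDE; lia.
Qed.

End Classes.

(** * Covering an atom up to classes by boundedly many others *)

Section TameFactorizations.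
Variables (P : choiceType) (w : P -> int) (negs : seq int) (N : nat).
Hypotheses (N0 : (0 < N)%N) (negw : forall p, w p < 0 -> w p \in negs)
  (lbw : forall p, - N%:Z <= w p).
Implicit Types (S U V A B R : {mset P}) (s x y : seq {mset P}).
Local Notation Z := (wt0 w).
Local Notation nonneg := (count (fun p => 0 <= w p)).
Local Notation cl := (msum (fun p => [mset w p])).
Local Notation m := (size negs).

(** For each of the [m] negative classes, fewer than a fraction [1/m] of the factors exceed [m]
    times the average multiplicity; hence some factor is excessive in no class. *)
Lemma light_factor S y : zfact Z S y -> y <> [::] -> exists2 U, U \in y &
  forall c, c \in negs -> (cl U c * size y <= m * cl S c)%N.
Proof.
move=> [hy ey] y0; have ypos : (0 < size y)%N by case: y y0 {hy ey}.
pose bad c U := (m * cl S c < cl U c * size y)%N.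
have [/hasP[U Uy /hasPn h]|/hasPn h] := boolP (has (fun U => ~~ has (bad^~ U) negs) y).
  by exists U => // c /h; rewrite /bad -leqNgt.
have badc c : (m * \sum_(U <- y) bad c U < size y)%N.
  rewrite ltnNge; apply/negP => le.
  have : ((\sum_(U <- y) bad c U) * (m * cl S c).+1 <= cl S c * size y)%N.
    have -> : (cl S c * size y = \sum_(U <- y) cl U c * size y)%N.
      rewrite -big_distrl /= -ey msum_sum; congr (_ * _)%N.
      by rewrite -(big_map _ predT id) sum_msetE big_map.
    rewrite big_distrl /=; apply: leq_sum => U _.
    by rewrite /bad; case: ltnP => //; rewrite mul1n.
  rewrite mulnS; have : (size y * cl S c <= m * (\sum_(U <- y) bad c U) * cl S c)%N.
    by rewrite leq_mul2r le orbT.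
  move: (\sum_(U <- y) bad c U)%N le => b le; nia.
have : (size y <= \sum_(c <- negs) \sum_(U <- y) bad c U)%N.
  rewrite exchange_big /= -sum1_size !big_seq; apply: leq_sum => U /h.
  rewrite negbK => /hasP[c cn bc]; rewrite (big_rem c)//= bc; lia.
move=> le; have mpos : (0 < m)%N.
  by case: negs le => // ; rewrite big_nil; case: (size y) ypos.
have : (m * \sum_(c <- negs) \sum_(U <- y) bad c U <= \sum_(c <- negs) (size y).-1)%N.
  by rewrite big_distrr /=; apply: leq_sum => c _; rewrite -ltnS prednK ?badc.
rewrite big_const_seq count_predT iter_addn_0.
move: (\sum_(c <- negs) _)%N le => b yb mb.
have : (m * size y <= m * b)%N by rewrite leq_mul2l yb orbT.
by move: mb; rewrite mulnC; case: (size y) ypos => // n _; nia.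
Qed.

(** At most [size A] factors cover [A], and for each class in [vs] the [J] factors richest in it
    suffice by [perm_top]; [x0] is the union of these choices. *)
Lemma light_factors_cover x A (vs : seq int) (v : int -> nat) J : x <> [::] ->
  (forall c, c \in vs -> (v c <= cl (\sum_(U <- x) U)%R c)%N /\
    (v c * size x <= J * cl (\sum_(U <- x) U)%R c)%N) ->
  (exists R, \sum_(U <- x) U = A + R) ->
  exists x0 x1, [/\ perm_eq x (x0 ++ x1), (size x0 <= size A + size vs * J)%N,
    exists R, \sum_(U <- x0) U = A + R &
    forall c, c \in vs -> (v c <= cl (\sum_(U <- x0) U)%R c)%N].
Proof.
move=> x_neq0 hv [R xAR].
have clsum (s : seq {mset P}) c : cl (\sum_(U <- s) U)%R c = (\sum_(U <- s) cl U c)%N.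
  by rewrite msum_sum -(big_map _ predT id) sum_msetE big_map.
elim: vs hv => [_|c vs IH hv].
  have [x0 [x1 [R0 [px sx e]]]] := zfact_cover xAR.
  by exists x0, x1; split=> //; [lia|exists R0].
have [|x0 [x1 [px sx [R0 e0] h0]]] := IH.
  by move=> c' c'vs; apply: hv; rewrite inE c'vs orbT.
have [vc vJ] := hv c (mem_head _ _); rewrite !clsum in vc vJ.
have [a [b [pa sa va]]] := perm_top vc vJ.
have [d [d' [e [e' [pd sd pe pe']]]]] := perm_union px pa.
exists d, d'; split=> //.
- by rewrite /= mulSn [leqRHS]addnCA [leqRHS]addnC; apply: leq_trans sd (leq_add sx sa).
- by exists (R0 + \sum_(U <- e) U); rewrite (perm_big _ pe) /= big_cat e0 addrA.
- move=> c'; rewrite inE => /orP[/eqP ->|/h0 h].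
    by rewrite (perm_big _ pe') /= big_cat msumD msetDE !clsum; apply: leq_trans va (leq_addr _ _).
  by rewrite (perm_big _ pe) /= big_cat msumD msetDE; apply: leq_trans h (leq_addr _ _).
Qed.

(** For a light factor [U] of [y], boundedly many factors of [x] contain all classes of [U] with
    multiplicity, hence also an element [U'] with the same classes, which is again an atom. *)
Lemma zfact_tame : exists D : nat, forall S x y, zfact Z S x -> zfact Z S y -> y <> [::] ->
  exists U U' x0 x1 y0, [/\ U \in y, cl U' = cl U, perm_eq x (x0 ++ x1),
    zfact Z (\sum_(V <- x0) V) (U' :: y0) & (size x0 <= D)%N /\ (size y0 <= D)%N].
Proof.
(* As [size x <= N * size y], a light [U] satisfies [cl U c * size x <= N * m * cl S c], which gives
   [J]. In [D], [N] counts the nonnegative primes of [U], and [J] is spent on each negative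
   class. *)
have satw := wt0_saturated w; pose J := (m * N)%N; pose D := (N + m * J)%N.
have nn U : zatom Z U -> (nonneg U <= N)%N by apply: zatom_nonneg_le N0 lbw _.
exists (N * D + D)%N => S x y fx fy y0.
have [U Uy lightU] := light_factor fy y0.
have aU : zatom Z U by case: fy => h _; apply: h.
have [R SE] : exists R, S = U + R.
  have [_ <-] := fy; exists (\sum_(V <- rem U y) V).
  by rewrite (perm_big _ (perm_to_rem Uy)) /= big_cons.
have [_ ex] := fx.
have x_neq0 : x <> [::].
  move=> x0; have [_ U0 _] := aU; apply: U0.
  by move: ex; rewrite x0 big_nil SE => /esym/mset_addI0[].
have xNy : (size x <= N * size y)%N.
  exact: leq_trans (zfact_count_ge (@zatom_nonneg _ w) fx) (zfact_count_le nn fy).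
have [A [B [UE sA clU]]] := class_part w U.
have [x0 [x1 [px sx [R0 e0] h0]]] := @light_factors_cover x A negs (cl U) J x_neq0
  ltac:(rewrite ex => c /lightU h; split; [by rewrite SE msumD msetDE leq_addr|
   rewrite /J; nia]) ltac:(exists (B + R); rewrite ex SE UE addrA//).
have sx0 : (size x0 <= D)%N by have := nn U aU; rewrite -sA /D; lia.
have clle c : (cl U c <= cl (\sum_(V <- x0) V)%R c)%N.
  have [c0|c0] := leP 0 c; first by rewrite clU c0 e0 msumD msetDE leq_addr.
  have [/h0//|cn] := boolP (c \in negs).
  suff -> : cl U c = 0%N by [].
  rewrite class_count; apply/eqP; rewrite -leqn0 leqNgt -has_count.
  by apply: contra cn => /hasP[p _ /eqP wp]; rewrite -wp negw// wp.
have [Y' clE] := mset_le clle.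
have [|U' [Y [e1 clU' clY]]] := @msum_split _ _ _ _ _ _ _ clE.
  by move=> p; rewrite size_mset1.
have tr := @class_transfer _ _ w erefl.
have aU' : zatom Z U'.
  have ZU' : Z U' by rewrite /wt0 -msum_class clU' msum_class; case: aU.
  apply/(transfer_atom tr ZU'); rewrite clU'; apply/(transfer_atom tr) => //; by case: aU.
have fx0 := zfact_catl (zfact_perm px fx).
have ZY : Z Y.
  have [_ _ ZB] := satw; apply: (ZB U'); first by case: aU'.
  by rewrite -e1; apply: zfactZ satw _ _ fx0.
have [y1 fy1] := zfact_exists ZY.
exists U, U', x0, x1, y1; split=> //; first by rewrite e1; apply: (zfact_cat (zfact1 aU') fy1).
split; first by lia.
apply: leq_trans (zfact_count_ge (@zatom_nonneg _ w) fy1) _.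
apply: (@leq_trans (nonneg ((\sum_(V <- x0) V)%R : {mset P}))).
  by rewrite e1 count_msetD leq_addl.
apply: leq_trans (zfact_count_le nn fx0) _.
by apply: leq_trans (leq_addr _ _); rewrite leq_mul2l sx0 orbT.
Qed.

End TameFactorizations.

(** * Chains of factorizations *)

Section ChainConditions.
Variable H : cmonoidType.
Implicit Types (x : reduced H) (z y : {mset atoms H}).

Lemma cond_b2P : cond_b2 H <-> exists N : nat, forall z (k : nat), (0 < k)%N ->
  adjacent (lengths (factor_prod z)) k%:Z (size z)%:Z ->
  exists z', [/\ Zfact (factor_prod z) z', size z' = k & (dist z z' <= N)%N].
Proof.
split=> [/esupremum_neq_None[N hN]|[N hN]].
  exists N => z k k0 adj; have /least_leP[n hn nN] := hN _ (imageT (@succ_dist H) z).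
  have /least_leP[_ [_ [z' [-> [fz' [sz']] ->]]] le] := hn k k0 adj.
  by exists z'; split=> //; lia.
apply/esupremum_neq_None; exists N => _ [z _ <-]; apply: least_le => k k0 adj.
have [z' [fz' sz' le]] := hN z k k0 adj; apply: enat_le_trans le; apply: least_le.
by exists z, z'; split=> //; split=> //; rewrite sz'.
Qed.

Lemma cond_b3P : cond_b3 H <-> exists N : nat, forall x z z', Zfact x z -> Zfact x z' ->
  monotone_chain x N z z'.
Proof.
have path_mono m n (s : seq {mset atoms H}) z : (m <= n)%N ->
    path (fun y y' => (dist y y' <= m)%N) z s -> path (fun y y' => (dist y y' <= n)%N) z s.
  by move=> mn; apply: sub_path => u v /leq_trans; apply.
split=> [/esupremum_neq_None[N hN]|[N hN]].
  exists N => x z z' fz fz'; rewrite -(assoc_class_repr x) in fz fz' *.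
  have /least_leP[n hn nN] := hN _ (imageT (@cmon H) (repr x)).
  have [s [h1 h2 h3 h4]] := hn _ _ fz fz'; exists s; split=> //.
  exact: path_mono nN h3.
apply/esupremum_neq_None; exists N => _ [a _ <-]; apply: least_le => z z'; exact: hN.
Qed.

Lemma monotone_path_between (r : rel nat) (rtr : transitive r) (rrefl : reflexive r)
    (s : seq {mset atoms H}) z :
  path (fun y y' => r (size y) (size y')) z s -> r (size z) (size (last z s)).
Proof.
elim: s z => [|y s IH] z /=; first by rewrite rrefl.
by move=> /andP[zy /IH]; apply: rtr.
Qed.

(** A monotone chain between adjacent lengths [k] and [l] meets no other length, so one of its steps
    leads from [k] to [l]. The order [r] is [leq] or [geq]. *)
Lemma monotone_crossing (r : rel nat) (rtr : transitive r) (rrefl : reflexive r)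
    x N (s : seq {mset atoms H}) z k l : size z = k -> size (last z s) = l -> k <> l ->
  Zfact x z -> (forall y, y \in s -> Zfact x y) ->
  (forall y, Zfact x y -> r k (size y) -> r (size y) l -> size y = k \/ size y = l) ->
  path (fun y y' => (dist y y' <= N)%N) z s -> path (fun y y' => r (size y) (size y')) z s ->
  exists u v, [/\ Zfact x u, Zfact x v, size u = k, size v = l & (dist u v <= N)%N].
Proof.
elim: s z => [|y s IH] z /= sz sl kl fz fs adj; first by case: kl; rewrite -sz -sl.
move=> /andP[dzy ps] /andP[rzy rs].
have fy : Zfact x y by apply: fs; rewrite mem_head.
have ryl : r (size y) l by rewrite -sl; apply: monotone_path_between rs.
case: (adj y fy _ ryl) => [|yk|yl]; first by rewrite -sz.
  by apply: IH yk sl kl fy _ adj ps rs => y' y's; apply: fs; rewrite inE y's orbT.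
by exists z, y.
Qed.

Lemma set_dist_le x (k l : nat) z z' N : Zfact x z -> size z = k -> Zfact x z' -> size z' = l ->
  (dist z z' <= N)%N -> enat_le (set_dist (Zfact_len k%:Z x) (Zfact_len l%:Z x)) N.
Proof.
move=> fz sz fz' sz' le; apply: enat_le_trans le; apply: least_le.
by exists z, z'; split=> //; split=> //; rewrite ?sz ?sz'.
Qed.

End ChainConditions.

Section Krull.
Variables (H : cmonoidType) (P : choiceType) (phi : {additive H -> {mset P}}).
Hypothesis phi_div : divisor_hom phi.
Implicit Types (x : reduced H) (z y : {mset atoms H}).
Local Notation Z := (phi_image phi).
Local Notation psi := (psi phi).
Local Notation apsi := (apsi phi).

Lemma cond_b3_b4 : cond_b3 H -> cond_b4 H.
Proof.
move=> /cond_b3P[N hN]; exists N.+1 => // a lo hi k l _ _ adj _ _.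
have [m [n [-> -> mn [[s /(zfact_Zfact phi_div)[z [fz _ sz]] sm]
  [t /(zfact_Zfact phi_div)[z' [fz' _ sz']] tn]] h]]] := (adjacent_lengths phi_div _ _ _).1 adj.
have {}sz : size z = m by rewrite sz.
have {}sz' : size z' = n by rewrite sz'.
have Ly y : Zfact (assoc_class a) y -> zlen Z (psi (assoc_class a)) (size y).
  by move=> /(Zfact_zfact phi_div) fy; exists (map apsi y); rewrite ?size_map.
have [c [cs cl cd [cm|cm]]] := hN _ _ _ fz fz'.
- have [||u [v [fu fv su sv uv]]] := @monotone_crossing H leq leq_trans leqnn
    (assoc_class a) N c z m n sz _ mn fz cs _ cd cm.
  + by rewrite cl.
  + by move=> y /Ly/h; lia.
  + exact: set_dist_le fu su fv sv (leqW uv).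
- have [|||u [v [fu fv su sv uv]]] := @monotone_crossing H geq _ leqnn
    (assoc_class a) N c z m n sz _ mn fz cs _ cd cm.
  + by move=> p q r /= h1 h2; apply: leq_trans h2 h1.
  + by rewrite cl.
  + by move=> y /Ly/h /=; lia.
  + exact: set_dist_le fu su fv sv (leqW uv).
Qed.

(** Supplies the positivity of adjacent lengths that the successive distance asks for. *)
Lemma zlen0 x : zlen Z (psi x) 0%N -> forall n, zlen Z (psi x) n -> n = 0%N.
Proof.
move=> [s [_ e] /size0nil s0] n [t ft <-]; have := zfact_size ft.
by rewrite -e s0 big_nil size_mset0R; lia.
Qed.

Lemma cond_b2_b4 : cond_b2 H -> cond_b4 H.
Proof.
move=> /cond_b2P[N hN]; exists N.+1 => // a lo hi k l _ _ adj _ _.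
have [m [n [km ln mn [Lm Ln] h]]] := (adjacent_lengths phi_div _ _ _).1 adj.
have [s /(zfact_Zfact phi_div)[z [fz _ sz]] sm] := Lm.
have {}sz : size z = m by rewrite sz.
have n0 : (0 < n)%N.
  by rewrite lt0n; apply/eqP => n0; rewrite n0 in Ln mn; apply/mn/(zlen0 Ln).
have adj' : adjacent (lengths (factor_prod z)) n%:Z (size z)%:Z.
  rewrite fz sz; apply/(adjacent_lengths phi_div); exists n, m; split=> //.
    by move=> nm; apply: mn.
  by move=> i /h; rewrite minnC maxnC.
have [z' [fz' sz' le]] := hN z n n0 adj'; rewrite km ln.
by rewrite fz in fz'; exact: set_dist_le fz sz fz' sz' (leqW le).
Qed.

(** The walk passes through successive adjacent lengths. Every step brings the length strictly
    closer to [l], so there are at most [D] of them, each of distance at most [N]. *)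
Lemma length_walk (N : nat) :
  (forall z (k : nat), (0 < k)%N -> adjacent (lengths (factor_prod z)) k%:Z (size z)%:Z ->
    exists z', [/\ Zfact (factor_prod z) z', size z' = k & (dist z z' <= N)%N]) ->
  forall D x z l, Zfact x z -> zlen Z (psi x) l ->
    (size z <= l + D)%N -> (l <= size z + D)%N ->
  exists s : seq {mset atoms H}, [/\ forall y, y \in s -> Zfact x y, size (last z s) = l,
    path (fun y y' => (dist y y' <= N)%N) z s,
    ((size z <= l)%N -> path (fun y y' : {mset atoms H} => (size y <= size y')%N) z s) /\
    ((l <= size z)%N -> path (fun y y' : {mset atoms H} => (size y >= size y')%N) z s) &
    (dist z (last z s) <= N * D)%N].
Proof.
move=> hN; elim=> [|D IH] x z l fz Ll zl lz.
  exists [::]; split=> //=; last by rewrite dist_refl muln0.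
  by apply/eqP; rewrite eqn_leq; move: zl lz; rewrite !addn0 => -> ->.
have Lz : zlen Z (psi x) (size z).
  by move: fz => /(Zfact_zfact phi_div) fy; exists (map apsi z); rewrite ?size_map.
have [zl0|zl0] := eqVneq (size z) l.
  exists [::]; split=> //=.
  by rewrite dist_refl.
(* [k] is the length next to [size z] in the direction of [l]. *)
have [k [Lk zk kl kz]] : exists k, [/\ zlen Z (psi x) k, k != size z,
    (minn l (size z) <= k <= maxn l (size z))%N &
    forall i, zlen Z (psi x) i -> ~ (minn k (size z) < i < maxn k (size z))%N].
  have [lt|gt] := ltnP (size z) l.
    pose Q := fun k => `[< zlen Z (psi x) k >] && (size z < k)%N.
    have exQ : exists k, Q k by exists l; rewrite /Q lt andbT; apply/asboolP.
    case: (ex_minnP exQ) => k /andP[/asboolP Lk zk] kmin; exists k; split=> //; try lia.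
      by have : (k <= l)%N; [apply: kmin; rewrite /Q lt andbT; apply/asboolP|lia].
    move=> i Li hi; have : (k <= i)%N; last lia.
    by apply: kmin; rewrite /Q; apply/andP; split; [apply/asboolP|lia].
  pose Q := fun k => `[< zlen Z (psi x) k >] && (k < size z)%N.
  have lt : (l < size z)%N by rewrite ltn_neqAle eq_sym zl0.
  have exQ : exists k, Q k by exists l; rewrite /Q lt andbT; apply/asboolP.
  have ubQ k : Q k -> (k <= size z)%N by case/andP => _ /ltnW.
  case: (ex_maxnP exQ ubQ) => k /andP[/asboolP Lk zk] kmax; exists k; split=> //; try lia.
    by have : (l <= k)%N; [apply: kmax; rewrite /Q lt andbT; apply/asboolP|lia].
  move=> i Li hi; have : (i <= k)%N; last lia.
  by apply: kmax; rewrite /Q; apply/andP; split; [apply/asboolP|lia].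
have k0 : (0 < k)%N.
  by rewrite lt0n; apply/eqP => k0; rewrite k0 in Lk zk; have := zlen0 Lk Lz; lia.
have [|y [fy sy zy]] := hN z k k0.
  by rewrite fz; apply/(adjacent_lengths phi_div); exists k, (size z); split=> //; apply/eqP.
rewrite fz in fy.
have [||s [s1 s2 s3 [s4 s5] s6]] := IH x y l fy Ll; try lia.
exists (y :: s); split=> //=.
- by move=> y'; rewrite inE => /orP[/eqP ->//|/s1].
- by rewrite zy.
- split=> h.
    have {}h : (size z <= l)%N by exact: h.
    have e1 : (size z <= size y)%N by lia.
    have e2 : (size y <= l)%N by lia.
    by apply/andP; split; [exact: e1|exact: s4 e2].
  have {}h : (l <= size z)%N by exact: h.
  have e1 : (size y <= size z)%N by lia.
  have e2 : (l <= size y)%N by lia.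
  by apply/andP; split; [exact: e1|exact: s5 e2].
- by rewrite mulnS; apply: leq_trans (dist_triangle z y _) (leq_add zy s6).
Qed.

End Krull.

(** Chains inside [Z_n(x)]: having constant length, they are monotone in both directions, and can be
    reversed. *)
Inductive equal_chain (H : cmonoidType) (M : nat) (x : reduced H) (n : nat) :
    {mset atoms H} -> {mset atoms H} -> Prop :=
| EqualChain0 z : Zfact x z -> size z = n -> equal_chain M x n z z
| EqualChainS z y z' : Zfact x z -> size z = n -> (dist z y <= M)%N ->
    equal_chain M x n y z' -> equal_chain M x n z z'.

Section EqualChains.
Variable H : cmonoidType.
Implicit Types (x : reduced H) (z y u v : {mset atoms H}).

Lemma equal_chain_fact M x n z z' : equal_chain M x n z z' -> Zfact x z /\ size z = n.
Proof. by case. Qed.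

Lemma equal_chain_fact_last M x n z z' : equal_chain M x n z z' -> Zfact x z' /\ size z' = n.
Proof. by elim. Qed.

Lemma equal_chain_trans M x n z y z' : equal_chain M x n z y -> equal_chain M x n y z' ->
  equal_chain M x n z z'.
Proof. by elim=> // u v y' fu su uv _ IH /IH; apply: EqualChainS. Qed.

Lemma equal_chain_le M M' x n z z' : (M <= M')%N -> equal_chain M x n z z' ->
  equal_chain M' x n z z'.
Proof.
move=> le; elim=> [u fu su|u v y fu su uv _]; first exact: EqualChain0.
by apply: EqualChainS => //; apply: leq_trans uv le.
Qed.

Lemma equal_chain_sym M x n z z' : equal_chain M x n z z' -> equal_chain M x n z' z.
Proof.
elim=> [u fu su|u v y fu su uv c IH]; first exact: EqualChain0.
have [fv sv] := equal_chain_fact c; apply: equal_chain_trans IH _.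
by apply: (EqualChainS fv sv _ (EqualChain0 _ fu su)); rewrite distC.
Qed.

Lemma equal_chain_add M x n y z z' : equal_chain M x n z z' ->
  equal_chain M (factor_prod y + x) (size y + n) (y + z) (y + z').
Proof.
elim=> [u fu su|u v t fu su uv _ IH].
  by apply: EqualChain0; rewrite ?size_msetD ?su// /Zfact /= factor_prodD fu.
apply: EqualChainS IH; rewrite ?size_msetD ?su ?dist_add//.
by rewrite /Zfact /= factor_prodD fu.
Qed.

Lemma equal_chain_monotone M x n z z' : equal_chain M x n z z' ->
  exists s : seq {mset atoms H}, [/\ forall y, y \in s -> Zfact x y, last z s = z',
    path (fun y y' => (dist y y' <= M)%N) z s &
    path (fun y y' : {mset atoms H} => (size y <= size y')%N) z s /\
    path (fun y y' : {mset atoms H} => (size y >= size y')%N) z s].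
Proof.
elim=> [u fu su|u v t fu su uv c [s [h1 h2 h3 [h4 h5]]]]; first by exists [::].
have [fv sv] := equal_chain_fact c.
exists (v :: s); split=> //=; first by move=> y; rewrite inE => /orP[/eqP->|/h1].
  by rewrite uv.
have e : size u = size v by rewrite su sv.
by split; apply/andP; split=> //; apply: eq_leq; rewrite e.
Qed.

End EqualChains.

Section KrullChains.
Variables (H : cmonoidType) (P : choiceType) (phi : {additive H -> {mset P}}).
Variables (w : P -> int) (negs : seq int) (N : nat).
Hypotheses (phi_div : divisor_hom phi) (phiw : phi_image phi = wt0 w).
Hypotheses (N0 : (0 < N)%N) (negw : forall p, w p < 0 -> w p \in negs)
  (lbw : forall p, - N%:Z <= w p).
Implicit Types (x : reduced H) (z y : {mset atoms H}) (U : {mset P}).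
Local Notation Z := (phi_image phi).
Local Notation psi := (psi phi).
Local Notation apsi := (apsi phi).
Local Notation cl := (msum (fun p => [mset w p])).

(** Swaps are repeated until [U'] itself appears. Their number [k] is not bounded uniformly, but
    each replaces only two atoms by two. *)
Lemma class_swap_chain x U' R : psi x = U' + R -> forall k z U, Zfact x z ->
  U \in map apsi z -> cl U' = cl U -> (size (U' `\` U)%mset < k)%N ->
  exists2 z', equal_chain 2 x (size z) z z' & U' \in map apsi z'.
Proof.
move=> xE; elim=> // k IH z U fz Uz clU lt.
have [<-|nUU] := eqVneq U U'; first by exists z => //; apply: EqualChain0.
rewrite eq_sym in nUU.
have fz' : zfact (wt0 w) (psi x) (map apsi z) by rewrite -phiw; apply/(Zfact_zfact phi_div).
have [V [r [U1 [V1 [pz f1 cl1 lt1]]]]] := class_swap_step fz' Uz clU xE nUU.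
rewrite -phiw in f1; have [y [fy py dy]] := Zfact_replace phi_div fz pz f1.
have [||z' c Uz'] := IH y U1 fy _ _ (leq_trans lt1 lt).
- by rewrite (perm_mem py) mem_head.
- by rewrite cl1.
have sy : size y = size z.
  by rewrite -(size_map apsi y) (perm_size py) -(size_map apsi z) (perm_size pz).
exists z' => //; rewrite sy in c; exact: EqualChainS fz erefl dy c.
Qed.

Lemma apsi_mem U z : U \in map apsi z -> exists u y, apsi u = U /\ z = [mset u] + y.
Proof.
move=> /mapP[u uz ->]; have [|y ->] := @mset_mem _ z u; first by rewrite mset_gt0.
by exists u, y.
Qed.

(* Once z has been modified so as to share an atom with z', that atom is
   cancelled and finiteness of the successive distance brings the rest back to
   the original length. *)
Lemma equal_chains : cond_b2 H -> exists M : nat, forall n x z z', Zfact x z -> Zfact x z' ->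
  size z = n -> size z' = n -> equal_chain M x n z z'.
Proof.
move=> /cond_b2P[B hB]; have [D hD] := zfact_tame N0 negw lbw.
(* The summands pay for the swaps on the side of [z'], the exchange of [x0] for [U' :: y0] in [z],
   and the correction of the length, which is off by at most [D.+1]. *)
pose M := (2 + D.+1 + B * D.+1)%N; exists M; elim=> [|n IH] x z z' fz fz' sz sz'.
  have -> : z' = z by rewrite (size_mset_eq0R sz) (size_mset_eq0R sz').
  exact: EqualChain0.
have zf y : Zfact x y -> zfact (wt0 w) (psi x) (map apsi y).
  by move=> fy; rewrite -phiw; apply/(Zfact_zfact phi_div).
have z'0 : map apsi z' <> [::] by move=> /(congr1 size); rewrite size_map sz'.
have [U [U' [x0 [x1 [y0 [Uz' clU px fx0 [sx0 sy0]]]]]]] := hD _ _ _ (zf _ fz) (zf _ fz') z'0.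
rewrite -phiw in fx0; have [y [fy py dy]] := Zfact_replace phi_div fz px fx0.
have U'y : U' \in map apsi y by rewrite (perm_mem py) mem_head.
have [R xE] : exists R, psi x = U' + R.
  have [_ <-] := zf _ fy; exists (\sum_(V <- rem U' (map apsi y)) V).
  by rewrite (perm_big _ (perm_to_rem U'y)) /= big_cons.
(* [z'] contains [U], whereas [y] contains [U']; swaps of constant length turn the former into the
   latter. *)
have [y' c' U'y'] := class_swap_chain xE fz' Uz' clU (ltnSn _).
rewrite sz' in c'; have [fy' sy'] := equal_chain_fact_last c'.
have [u [t [uU' yE]]] := apsi_mem U'y.
have [u' [t' [u'U' y'E]]] := apsi_mem U'y'.
have uu' : u' = u by apply: (apsi_inj phi_div); rewrite uU' u'U'.
rewrite {}uu' in y'E; pose b := factor_prod t.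
have xb : x = factor_prod [mset u] + b by rewrite -fy yE factor_prodD.
have ft : Zfact b t by [].
have ft' : Zfact b t'.
  apply: (@cancel_addI _ (factor_prod [mset u])); rewrite -xb -factor_prodD -y'E; exact: fy'.
have st' : size t' = n by move: sy'; rewrite y'E size_msetD size_mset1 => -[].
have sy : (size y <= n.+1 + D.+1)%N /\ (n.+1 <= size y + D.+1)%N.
  have s1 : size y = ((size y0).+1 + size x1)%N.
    by rewrite -(size_map apsi y) (perm_size py) size_cat.
  have s2 : size z = (size x0 + size x1)%N.
    by rewrite -(size_map apsi z) (perm_size px) size_cat.
  by rewrite s1; move: sz; rewrite s2; lia.
have st : size y = (size t).+1 by rewrite yE size_msetD size_mset1.
have Ln : zlen Z (psi b) n.
  by exists (map apsi t'); [apply/(Zfact_zfact phi_div)|rewrite size_map].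
have [||s [s1 s2 s3 _ s5]] := length_walk phi_div hB (D := D.+1) ft Ln; try lia.
pose v := last t s.
have fv : Zfact b v.
  rewrite /v; have : last t s \in t :: s by apply: mem_last.
  by rewrite inE => /orP[/eqP ->//|/s1].
have c := equal_chain_add [mset u] (IH _ _ _ fv ft' s2 st').
rewrite -xb -y'E size_mset1 in c.
have dyv : (dist y ([mset u] + v)%R <= B * D.+1)%N by rewrite yE dist_add.
have dzv : (dist z ([mset u] + v)%R <= M)%N.
  apply: leq_trans (dist_triangle z y _) _; rewrite /M.
  have := leq_add dy dyv; rewrite /=; lia.
apply: (EqualChainS fz sz dzv); apply: equal_chain_trans c _.
by apply: equal_chain_sym; apply: equal_chain_le c'; rewrite /M; lia.
Qed.

(** A walk leads from [z] monotonically to the length of [z'], and a chain of constant length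
    completes it. *)
Lemma cond_b2_b3_of_bounded : cond_b2 H -> cond_b3 H.
Proof.
move=> b2; have [M hM] := equal_chains b2; have /cond_b2P[B hB] := b2.
apply/cond_b3P; exists (maxn M B) => x z z' fz fz'.
have Lz' : zlen Z (psi x) (size z').
  by exists (map apsi z'); [apply/(Zfact_zfact phi_div)|rewrite size_map].
have [||s [s1 s2 s3 [s4 s5] _]] :=
  length_walk phi_div hB (D := (size z + size z')%N) fz Lz'; try lia.
have fl : Zfact x (last z s).
  have : last z s \in z :: s by apply: mem_last.
  by rewrite inE => /orP[/eqP ->//|/s1].
have [t [t1 t2 t3 [t4 t5]]] := equal_chain_monotone (hM _ _ _ _ fl fz' s2 erefl).
exists (s ++ t); split.
- by move=> y; rewrite mem_cat => /orP[/s1|/t1].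
- by rewrite last_cat.
- rewrite cat_path; apply/andP; split.
    by apply: sub_path s3 => y y' le; apply: leq_trans le (leq_maxr _ _).
  by apply: sub_path t3 => y y' le; apply: leq_trans le (leq_maxl _ _).
- have [le|lt] := leqP (size z) (size z').
    by left; rewrite cat_path s4.
  by right; rewrite cat_path s5// ltnW.
Qed.

End KrullChains.

(** * The Structure Theorem *)

Lemma zDelta_le (K : choiceType) (Z : {mset K} -> Prop) (G d : nat) :
  (forall S m n, zlen Z S m -> zlen Z S n -> (m < n)%N ->
    exists k, [/\ zlen Z S k, (m < k)%N & (k <= m + G)%N]) ->
  zDelta Z d -> (d <= G)%N.
Proof.
move=> hG [S [m [Lm Ln d0 h]]]; have [|k [Lk mk km]] := hG S m (m + d)%N Lm Ln; first lia.
by have := h k Lk; lia.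
Qed.

(* For a long set of lengths the period consists of the classes modulo d that
   occur in it, seen from y = lo + M d; short sets go into the final part L2. *)
Lemma AAMP_periodic_interior (Ln : set nat) (d M B lo hi : nat) :
  (0 < d)%N -> Ln lo -> Ln hi -> (forall n, Ln n -> (lo <= n <= hi)%N) ->
  (forall l j, Ln l -> (lo + M <= j)%N -> (j + M <= hi)%N -> l = j %[mod d] -> Ln j) ->
  (M * d + M + d <= B)%N -> AAMP d B [set n%:Z | n in Ln].
Proof.
move=> d0 Llo Lhi bnd inner MB.
have dz : d%:Z != 0 :> int by lia.
have modE (n : int) : n = (n %% d)%Z + d%:Z * (n %/ d)%Z.
  by rewrite {1}(divz_eq n d) addrC mulrC.
have mod0 (n : int) : 0 <= (n %% d)%Z by apply: modz_ge0.
have modd (n : int) : (n %% d)%Z <= d%:Z.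
  by apply: ltW; apply: ltz_pmod; lia.
have [short|long] := ltnP hi (lo + M * d + M)%N.
  exists [set n | 0 <= n <= d%:Z]; split=> //=; try lia.
  exists lo%:Z, set0, [set 0], [set n | 0 < n /\ exists2 l, Ln l & lo%:Z + n = l%:Z], 0.
  split.
  - apply/seteqP; split=> n /=.
      move=> [l Ll <-]; exists (l%:Z - lo%:Z); last lia.
      have := bnd l Ll; have [->|ne] := eqVneq l lo; first by left; right; rewrite subrr.
      by right; split; [lia|exists l => //; lia].
    by move=> [i [[//|->]|[i0 [l Ll e]]] <-]; [exists lo => //; lia|exists l].
  - move=> n _ /=; exists (n - lo%:Z); last lia.
    exists ((n - lo%:Z) %% d)%Z; first by rewrite /= mod0 modd.
    by exists ((n - lo%:Z) %/ d)%Z; apply: modE.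
  - split; [exact: finite_set1|by exists 0| |].
      by split=> // i ->.
    by split=> // i ->.
  - apply/seteqP; split=> n /=; last lia.
    move=> ->; split; last lia.
    by exists 0; [rewrite /=; lia|exists 0; rewrite mulr0].
  - split=> n //= [n0 [l Ll e]]; exists n; rewrite /= ?add0r//.
    by have := bnd l Ll; lia.
(* [y] is congruent to [lo] modulo [d] and at least [lo + M]; [m] is the largest multiple of [d]
   with [y + m <= hi - M], so that 0 and [m] both belong to the central part. *)
pose y := (lo + M * d)%N; pose k := ((hi - M - y) %/ d)%N; pose m := (d * k)%N.
have mhi : (m <= hi - M - y)%N by rewrite /m mulnC leq_trunc_div.
have him : (hi - M - y < m + d)%N.
  by rewrite /m mulnC -mulSnr ltn_ceil.
pose D : set int := [set r | 0 <= r <= d%:Z /\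
  exists2 l, Ln l & exists q : int, l%:Z = y%:Z + r + d%:Z * q].
have perL n : Ln n -> periodic d D (n%:Z - y%:Z).
  move=> Lln; exists ((n%:Z - y%:Z) %% d)%Z.
    split; first by rewrite /= mod0 modd.
    by exists n => //; exists ((n%:Z - y%:Z) %/ d)%Z; have := modE (n%:Z - y%:Z); lia.
  by exists ((n%:Z - y%:Z) %/ d)%Z; apply: modE.
have D0 : D 0.
  by split; [lia|exists lo => //; exists (- M%:Z); rewrite /y; lia].
have per n : periodic d D n -> 0 <= n <= m%:Z -> exists2 l, Ln l & y%:Z + n = l%:Z.
  move=> [r [_ [l Ll [q lE]]] [q' nE]] nm; exists (y + `|n|)%N; last lia.
  have Md : (M <= M * d)%N by rewrite leq_pmulr.
  apply: (inner l) => //; try (rewrite /y in mhi him *; lia).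
  apply/eqP; rewrite -eqz_nat -!modz_nat; apply/eqP.
  have -> : l%:Z = (q - q') * d%:Z + (y + `|n|)%N%:Z by lia.
  by rewrite modzMDl.
exists D; split=> //.
- by split; [lia|exists lo => //; exists (- M%:Z - 1); rewrite /y; lia].
- by move=> r [].
exists y%:Z, [set n | n < 0 /\ exists2 l, Ln l & y%:Z + n = l%:Z],
  (periodic d D `&` [set n | 0 <= n <= m%:Z]),
  [set n | m%:Z < n /\ exists2 l, Ln l & y%:Z + n = l%:Z], m%:Z.
have P0 : periodic d D 0 by exists 0 => //; exists 0; rewrite mulr0.
have Pm : periodic d D m%:Z by exists 0 => //; exists k%:Z; rewrite /m; lia.
split=> //.
- apply/seteqP; split=> n /=.
    move=> [l Ll <-]; exists (l%:Z - y%:Z); last lia.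
    have [neg|pos] := ltP (l%:Z - y%:Z) 0; first by left; left; split=> //; exists l => //; lia.
    have [le|gt] := leP (l%:Z - y%:Z) m%:Z; last by right; split=> //; exists l => //; lia.
    by left; right; split; [exact: perL|apply/andP].
  move=> [i [[[_ [l Ll e]]|[Pi hi']]|[_ [l Ll e]]] <-]; try by exists l.
  by have [l Ll e] := per i Pi hi'; exists l.
- by move=> _ [l Ll <-]; exists (l%:Z - y%:Z); [exact: perL|lia].
- split.
  + apply: (@sub_finite_set _ _ [set i%:Z | i in `I_m.+1]); last exact/finite_image.
    by move=> n [_ /= hn]; exists `|n|%N; rewrite /=; lia.
  + by exists 0; split=> //=; lia.
  + by split; [split=> //=; lia|move=> n [_ /andP[]]].
  + by split; [split=> //=; lia|move=> n [_ /andP[]]].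
- split=> n /= [hn [l Ll e]]; have := bnd l Ll; first by rewrite /y in e; lia.
  by exists (n - m%:Z); rewrite /y in e mhi him *; lia.
Qed.

Lemma zlen_extrema (K : choiceType) (Z : {mset K} -> Prop) S : Z S ->
  exists lo hi, [/\ zlen Z S lo, zlen Z S hi & forall n, zlen Z S n -> (lo <= n <= hi)%N].
Proof.
move=> /zfact_exists[s fs].
pose Q := fun n => `[< zlen Z S n >].
have exQ : exists n, Q n by exists (size s); apply/asboolP; exists s.
have ubQ n : Q n -> (n <= size S)%N by move=> /asboolP[t /zfact_size le <-].
case: (ex_minnP exQ) => lo /asboolP Llo lomin.
case: (ex_maxnP exQ ubQ) => hi /asboolP Lhi himax.
exists lo, hi; split=> // n Ln.
by rewrite lomin ?himax//; apply/asboolP.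
Qed.

Section TransferFinite.
Variables (K : choiceType) (Z' : {mset K} -> Prop) (C : seq K).
Hypotheses (satZ' : saturated Z')
  (suppZ' : forall S, Z' S -> forall c, (0 < S c)%N -> c \in C).
Variables (H : cmonoidType) (P : choiceType) (phi : {additive H -> {mset P}}).
Hypothesis phi_div : divisor_hom phi.
Local Notation Z := (phi_image phi).
Variable g : P -> {mset K}.
Hypothesis tr : transfer Z Z' g.

(** Adjacent lengths differ by at most the gap bound [G] of [Z'], so the exchange bound for
    differences up to [G] applies to them. *)
Lemma transfer_cond_b2 : cond_b2 H.
Proof.
have satZ := phi_image_saturated phi_div.
have [G G0 hG] := zlen_gap_bound satZ' suppZ'.
have [B hB] := transfer_exchange_bound G satZ satZ' suppZ' tr.
apply/cond_b2P; exists B => z k k0 /(adjacent_lengths phi_div)[m [n [km zn mn [Lm Ln] h]]].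
have {km}km : k = m by lia.
have {zn}zn : size z = n by lia.
have ZS := psi_image phi (factor_prod z).
have gap a b : zlen Z (psi phi (factor_prod z)) a -> zlen Z (psi phi (factor_prod z)) b ->
    (a < b)%N -> (forall i, zlen Z (psi phi (factor_prod z)) i -> ~ (a < i < b)%N) ->
    (b <= a + G)%N.
  move=> La Lb ab no; move: La Lb; rewrite (transfer_zlen satZ' tr ZS) => La Lb.
  have [i [Li ai ia]] := hG _ _ _ La Lb ab; have := no i.
  by rewrite (transfer_zlen satZ' tr ZS) => /(_ Li); lia.
have [y fy sy] := Lm.
have fz : zfact Z (psi phi (factor_prod z)) (map (apsi phi) z) by apply/(Zfact_zfact phi_div).
have sz : size (map (apsi phi) z) = n by rewrite size_map.
have [le1 le2] : (m <= n + G)%N /\ (n <= m + G)%N.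
  have [lt|lt|//] := ltngtP m n.
    have := gap m n Lm Ln lt.
    by move=> le; split; [lia|apply: le => i /h; lia].
  have := gap n m Ln Lm lt => le; split; [apply: le => i /h; lia|lia].
have [||x0 [x1 [y0 [px f0 s0 [b1 b2]]]]] := hB _ _ _ fz fy; rewrite ?sz ?sy//.
have [z' [fz' p' d']] := Zfact_replace phi_div (erefl : Zfact _ z) px f0.
exists z'; split=> //.
  by rewrite -(size_map (apsi phi)) (perm_size p') size_cat s0 sy km.
by apply: leq_trans d' _; rewrite geq_max b1.
Qed.

Lemma transfer_structure (Ds : set nat) : uniq C -> Ds = zDelta Z' -> Ds !=set0 -> structure_theorem H Ds.
Proof.
move=> uC -> [d0 Zd0]; have [G G0 hG] := zlen_gap_bound satZ' suppZ'.
have [M hM] := zlen_periodic_interior satZ' uC suppZ' Zd0.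
have le d := zDelta_le (d := d) hG.
split.
- apply: (@sub_finite_set _ _ `I_G.+1); last exact: finite_II.
  by move=> d /le /=; rewrite ltnS.
- by exists d0.
- by move=> d [S [m []]].
- move=> a; have [s /(zfact_Zfact phi_div)[z [fz _ _]]] := zfact_exists (psi_image phi (assoc_class a)).
  by exists z.
(* All distances [d] are at most [G], so this bounds [M * d + M + d] uniformly. *)
exists (M * G + M + G)%N => a; set x := assoc_class a.
have ZS := psi_image phi x; have [t1 _ _ _] := tr; have ZS' := t1 _ ZS.
have [d Zd hd] := hM _ ZS'; exists d => //.
have [lo [hi [Llo Lhi bnd]]] := zlen_extrema ZS'.
have -> : lengths x = [set n%:Z | n in zlen Z' (msum g (psi phi x))].
  rewrite -(transfer_zlen satZ' tr ZS); apply/seteqP; split=> k.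
    by move=> /(zlen_lengths phi_div)[n Ln ->]; exists n.
  by move=> [n Ln <-]; apply/(zlen_lengths phi_div); exists n.
apply: (@AAMP_periodic_interior _ d M _ lo hi) => //.
- by have [S [m []]] := Zd.
- by move=> l j Ll; apply: hd.
- have := le d Zd => dG; have := leq_mul (leqnn M) dG; lia.
Qed.

End TransferFinite.

(** * The conditions of the theorem *)

Lemma card_one (T : Type) (A : set T) : (A #= `I_1)%card -> exists v, A = [set v].
Proof.
move=> /eq_cardSP[v Av]; rewrite II0 card_eq0 => /eqP Av0; exists v.
apply/seteqP; split=> [u Au|u -> //]; apply: contrapT => uv.
by have : (A `\ v) u by []; rewrite Av0.
Qed.

(** [Z'] depends on [GP] alone, so the same target serves [H] and the monoid of zero-sum sequences
    over [GP]; this is how the distances of the latter enter (b1). *)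
Lemma cond_a_transfer (GP : set int) : cond_a GP ->
  exists (Z' : {mset int} -> Prop) (C : seq int), [/\ saturated Z', uniq C,
    forall S, Z' S -> forall c, (0 < S c)%N -> c \in C &
    forall (P : choiceType) (w : P -> int), range w = GP ->
      exists g, transfer (wt0 w) Z' g].
Proof.
have residues (A : set int) (n : nat) : (0 < n)%N -> forall S, residue_zero_sum A n S ->
    forall c, (0 < S c)%N -> c \in [seq i%:Z | i <- iota 0 n].
  move=> n0 S [_ h] c /h[b [_ _ ->]].
  have b0 : 0 <= (b %% n)%Z by apply: modz_ge0; lia.
  have bn : (b %% n)%Z < n%:Z by apply: ltz_pmod; lia.
  apply/mapP; exists `|(b %% n)%Z|%N; last lia.
  by rewrite mem_iota; lia.
have uniq_res n : uniq [seq i%:Z | i <- iota 0 n].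
  by rewrite map_inj_uniq ?iota_uniq// => i j [].
case=> [/finite_seqP[s GPs]|[[/card_one[v posv] _]|[/card_one[v negv] _]]].
- exists (class_zero_sum GP), (undup s); split.
  + exact: class_zero_sum_saturated.
  + exact: undup_uniq.
  + by move=> S [_ h] c /h; rewrite GPs mem_undup.
  + by move=> P w wGP; exists (fun p => [mset w p]); apply: class_transfer.
(* A single positive class becomes a single negative one after changing all signs. *)
- have [GPv v0] : pos_part GP v by rewrite posv.
  pose A : set int := [set - c | c in GP].
  have n0 : (0 < `|v|)%N by rewrite /= in v0; lia.
  exists (residue_zero_sum A `|v|%N), [seq i%:Z | i <- iota 0 `|v|%N]; split=> //.
  + exact: residue_zero_sum_saturated.
  + exact: residues.
  + move=> P w wGP; exists (residue_mset `|v|%N (fun p => - w p)).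
    rewrite -wt0_opp; apply: residue_transfer => //.
    * by rewrite /A -wGP; apply/seteqP; split=> [_ [p _ <-]|_ [_ [p _ <-] <-]];
        [exists (w p) => //; exists p|exists p].
    * by exists v => //; rewrite /= in v0; lia.
    * move=> p wp; have : pos_part GP (w p) by split; [rewrite -wGP; exists p|rewrite /=; lia].
      by rewrite posv => /= ->; rewrite /= in v0; lia.
- have [GPv v0] : neg_part GP v by rewrite negv.
  have n0 : (0 < `|v|)%N by rewrite /= in v0; lia.
  have vE : v = - `|v|%N%:Z by rewrite /= in v0; lia.
  exists (residue_zero_sum GP `|v|%N), [seq i%:Z | i <- iota 0 `|v|%N]; split=> //.
  + exact: residue_zero_sum_saturated.
  + exact: residues.
  + move=> P w wGP; exists (residue_mset `|v|%N w); apply: residue_transfer => //.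
      by rewrite -vE.
    move=> p wp; have : neg_part GP (w p) by split; [rewrite -wGP; exists p|].
    by rewrite negv => /= ->.
Qed.

Lemma not_cond_c (P : choiceType) (w : P -> int) : ~ cond_c (range w) ->
  (forall n : nat, exists p, n%:Z <= w p) /\ (forall n : nat, exists p, w p <= - n%:Z).
Proof.
move=> nc; split=> n; apply: contrapT => no; apply: nc; [left|right].
- apply: (@sub_finite_set _ _ [set i%:Z | i in `I_n]); last exact/finite_image.
  move=> _ [[p _ <-] /= wp]; exists `|w p|%N; rewrite /=; last lia.
  by rewrite ltnNge; apply/negP => le; apply: no; exists p; lia.
- apply: (@sub_finite_set _ _ [set - i%:Z | i in `I_n]); last exact/finite_image.
  move=> _ [[p _ <-] /= wp]; exists `|w p|%N; rewrite /=; last lia.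
  by rewrite ltnNge; apply/negP => le; apply: no; exists p; lia.
Qed.

Lemma adjacent_across_gap (L : set nat) (K D a b : nat) : L a -> (a <= K)%N -> L b -> (K + D <= b)%N ->
  (forall k, L k -> (k <= K)%N \/ (K + D <= k)%N) -> (0 < D)%N ->
  exists k l, [/\ L k, L l, (a <= k <= K)%N, (K + D <= l <= b)%N &
    forall i, L i -> ~ (k < i < l)%N].
Proof.
move=> La aK Lb Kb gap D0.
pose Q1 := fun k => `[< L k >] && (k <= K)%N.
have ex1 : exists k, Q1 k by exists a; rewrite /Q1 aK andbT; apply/asboolP.
have ub1 k : Q1 k -> (k <= K)%N by case/andP.
pose Q2 := fun k => `[< L k >] && (K + D <= k)%N.
have ex2 : exists k, Q2 k by exists b; rewrite /Q2 Kb andbT; apply/asboolP.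
case: (ex_maxnP ex1 ub1) => k /andP[/asboolP Lk kK] kmax.
case: (ex_minnP ex2) => l /andP[/asboolP Ll Kl] lmin.
exists k, l; split=> //.
- by rewrite kK andbT; apply: kmax; rewrite /Q1 aK andbT; apply/asboolP.
- by rewrite Kl /=; apply: lmin; rewrite /Q2 Kb andbT; apply/asboolP.
- move=> i Li /andP[ki il]; case: (gap i Li) => hi.
    by have : (i <= k)%N; [apply: kmax; rewrite /Q1 hi andbT; apply/asboolP|lia].
  by have : (l <= i)%N; [apply: lmin; rewrite /Q2 hi andbT; apply/asboolP|lia].
Qed.

(** Already with [F = 0] the gap can be made as wide as desired. *)
Lemma zDelta_unbounded (P : choiceType) (w : P -> int) : ~ cond_c (range w) ->
  forall n, exists2 d, zDelta (wt0 w) d & (n < d)%N.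
Proof.
move=> /not_cond_c[pos neg] n.
have [S [m [K [b [b' [[La _] [Lb _] [aK _ Kb _] gap]]]]]] :=
  wt0_zlen_gap n.+1 pos neg (@zfact_nil _ (wt0 w)) (@zfact_nil _ (wt0 w)).
have [k [l [Lk Ll /andP[_ kK] /andP[Kl _] adj]]] := adjacent_across_gap La aK Lb Kb gap isT.
exists (l - k)%N; last lia.
exists S, k; split=> //; first by have -> : (k + (l - k) = l)%N by lia.
  lia.
by move=> i /adj; lia.
Qed.

(** * Zero-sum sequences as a Krull monoid *)

Section ZeroSumImage.
Variable GP : set int.

Definition zs_incl : {additive zero_sum_monoid GP -> {mset GP}} := val.

Lemma zs_incl_image : phi_image zs_incl = wt0 (val : GP -> int).
Proof.
have sE (S : {mset GP}) : sigma S = msum (val : GP -> int) S.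
  by rewrite /msum big_mset /sigma; apply: eq_bigr.
apply/funext => S; apply/propext; split=> [[[T /= ZT] <-]|ZS].
  by move: ZT; rewrite /zero_sum sE => /eqP.
have ZS' : zero_sum S by rewrite /zero_sum sE; apply/eqP.
by exists (ZeroSum ZS').
Qed.

Lemma zs_incl_div : divisor_hom zs_incl.
Proof.
move=> a b [c e]; have [_ _ ZB] := wt0_saturated (val : GP -> int).
have Zv (x : zero_sum_monoid GP) : wt0 (val : GP -> int) (zs_incl x).
  by rewrite -zs_incl_image; exists x.
have [d dc] : phi_image zs_incl c.
  by rewrite zs_incl_image; apply: (ZB (zs_incl a)); rewrite -?e.
by exists d; apply: val_inj; rewrite -[LHS]/(zs_incl b) e -dc -raddfD.
Qed.

Lemma range_zs_weight : range (val : GP -> int) = GP.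
Proof.
apply/seteqP; split=> [_ [c _ <-]|c GPc]; first exact: set_valP.
by exists (SigSub (mem_set GPc)).
Qed.

Lemma Delta_zero_sum : Delta (zero_sum_monoid GP) = zDelta (wt0 (val : GP -> int)).
Proof. by rewrite (Delta_zDelta zs_incl_div) zs_incl_image. Qed.

End ZeroSumImage.

(** * Divisor classes as integer weights *)

Section ClassGroup.
Variables (H : cmonoidType) (P : choiceType) (phi : {additive H -> {mset P}}).
Variable theta : {additive class_group phi -> int}.
Hypotheses (phi_div : divisor_hom phi) (theta_inj : injective theta).

Definition class_weight (p : P) : int := theta (divisor_class phi [mset p]).

Lemma divisor_classD (A B : {mset P}) :
  divisor_class phi (A + B) = divisor_class phi A + divisor_class phi B.
Proof. by rewrite /divisor_class to_qD; exact: Quotient.pi_add. Qed.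

Lemma divisor_class0 : divisor_class phi 0 = 0.
Proof.
by apply: (@addrI _ (divisor_class phi 0)); rewrite -divisor_classD !addr0.
Qed.

Lemma theta_divisor_class A : theta (divisor_class phi A) = msum class_weight A.
Proof.
move: A; apply: mset_ind => [|p A IH]; first by rewrite divisor_class0 raddf0 msum0.
by rewrite divisor_classD raddfD IH msumD msum1.
Qed.

(** An element of class 0 is a fraction [phi a / phi b]; then [b] divides [a] in [H], and the
    quotient is mapped to [A]. *)
Lemma divisor_class_eq0 A : divisor_class phi A = 0 <-> phi_image phi A.
Proof.
rewrite -divisor_class0; split.
  move=> /eqP; rewrite -Quotient.idealrBE => /asboolP[a [b]].
  have -> : to_q (0 : {mset P}) = 0 by [].
  rewrite subr0 => /(congr1 (+%R^~ (to_q (phi b)))); rewrite subrK -to_qD => /fracP /=.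
  rewrite !addr0 => e; have [c aE] := phi_div (ex_intro _ A (etrans (esym e) (addrC _ _))).
  by exists c; apply: (@cancel_addI _ (phi b)); rewrite -raddfD -aE -e addrC.
move=> [a <-]; apply/eqP; rewrite -Quotient.idealrBE; apply/asboolP.
by exists a, 0; rewrite raddf0.
Qed.

Lemma phi_image_class_weight : phi_image phi = wt0 class_weight.
Proof.
apply/funext => A; apply/propext; rewrite -divisor_class_eq0 /wt0 -theta_divisor_class.
by split=> [->|]; [rewrite raddf0|rewrite -(raddf0 theta) => /theta_inj].
Qed.

End ClassGroup.

Section Conditions.
Variables (H : cmonoidType) (P : choiceType) (phi : {additive H -> {mset P}}) (w : P -> int).
Hypotheses (phi_div : divisor_hom phi) (phiw : phi_image phi = wt0 w).
Local Notation GP := (range w).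

(** The gap construction is used twice. First it provides [F] with lengths at least [M] apart;
    starting from this [F], it then provides adjacent lengths [k], [l] more than [M] apart, with [k]
    above the minimum by at least [M] because of [x] and [y], and [l] below the maximum because of
    [b] and [b']. *)
Lemma cond_b4_c : cond_b4 H -> cond_c GP.
Proof.
move=> [M M0 hM]; apply: contrapT => nc; have [pos neg] := not_cond_c nc.
have [F [m0 [K0 [b0 [b0' [[[x fx sx] _] [[y fy sy] _] [aK0 _ Kb0 _] _]]]]]] :=
  wt0_zlen_gap M pos neg (@zfact_nil _ (wt0 w)) (@zfact_nil _ (wt0 w)).
have [S [m [K [b [b' [[Lx Ly] [Lb Lb'] [xK yK Kb bb'] gap]]]]]] :=
  wt0_zlen_gap M.+1 pos neg fx fy.
have [k [l [Lk Ll /andP[yk kK] /andP[Kl lb] adj]]] := adjacent_across_gap Ly yK Lb Kb gap isT.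
have xy : (size x + M <= size y)%N by lia.
have ZS : wt0 w S by have [s fs _] := Lk; apply: zfactZ (wt0_saturated w) _ _ fs.
have [a aS] : phi_image phi S by rewrite phiw.
have psiS : psi phi (assoc_class a) = S by rewrite psi_class.
have [lo [hi [Llo Lhi bnd]]] := zlen_extrema ZS.
have LE n : lengths (assoc_class a) n%:Z <-> zlen (wt0 w) S n.
  rewrite -phiw -psiS; split; first by move=> /(zlen_lengths phi_div)[i Li [->]].
  by move=> Ln; apply/(zlen_lengths phi_div); exists n.
have bndz c : lengths (assoc_class a) c -> lo%:Z <= c <= hi%:Z.
  move=> /(zlen_lengths phi_div)[n]; rewrite psiS phiw => /bnd h ->; lia.
have := bnd _ Lx; have := bnd _ Lb' => bb bx.
have kl : enat_le (set_dist (Zfact_len k%:Z (assoc_class a)) (Zfact_len l%:Z (assoc_class a))) M.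
  apply: (hM a lo%:Z hi%:Z) => //.
  - by split; [exact/LE|move=> c /bndz/andP[]].
  - by split; [exact/LE|move=> c /bndz/andP[]].
  - apply/(adjacent_lengths phi_div); exists k, l; rewrite psiS phiw; split=> //; first lia.
    by move=> i /adj; lia.
  - lia.
  - lia.
have /least_leP[d [z [z' [[_ sz] [_ sz'] ->]]] dM] := kl.
have := dist_size z' z; rewrite distC.
move: (dist z z') dM => e eM; move: sz sz' => [sz] [sz']; rewrite sz sz'; lia.
Qed.

(** The Structure Theorem needs a finite set of differences, whereas without (c) the set of
    distances is unbounded. *)
Lemma cond_b1_c : cond_b1 H GP -> cond_c GP.
Proof.
move=> b1; apply: contrapT => nc.
have un := @zDelta_unbounded _ (val : GP -> int).
rewrite range_zs_weight -Delta_zero_sum in un; move: (un nc) => {}un.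
case: b1 => [D0|[fin _ _ _ _]]; first by have [d] := un 0%N; rewrite D0.
have /finite_seqP[s sE] := fin; have [d Dd] := un (\max_(i <- s) i).
rewrite ltnNge => /negP; apply; apply: leq_bigmax_seq => //.
by move: Dd; rewrite sE.
Qed.

Lemma cond_a_b2 : cond_a GP -> cond_b2 H.
Proof.
move=> /cond_a_transfer[Z' [C [satZ' uC suppZ' tr]]].
have [g trg] := tr P w erefl; rewrite -phiw in trg.
exact (transfer_cond_b2 satZ' suppZ' phi_div trg).
Qed.

Lemma cond_a_b1 : cond_a GP -> cond_b1 H GP.
Proof.
move=> /cond_a_transfer[Z' [C [satZ' uC suppZ' tr]]].
have [g trg] := tr P w erefl; rewrite -phiw in trg.
have [g' trg'] := tr GP (val : GP -> int) (@range_zs_weight GP).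
rewrite /cond_b1; have [->|D0] := eqVneq (Delta (zero_sum_monoid GP)) set0; [by left|right].
apply: (transfer_structure satZ' suppZ' phi_div trg uC); last exact/set0P.
by rewrite Delta_zero_sum; apply: transfer_zDelta trg' => //; exact: wt0_saturated.
Qed.

Lemma cond_b2_b3 : cond_b2 H -> cond_b3 H.
Proof.
move=> b2; have c := cond_b4_c (cond_b2_b4 phi_div b2).
have bounded (v : P -> int) : phi_image phi = wt0 v -> finite_set (neg_part (range v)) -> cond_b3 H.
  move=> phiv /finite_seqP[s sE].
  pose N := (\max_(c <- s) `|c|).+1.
  have neg p : v p < 0 -> v p \in s.
    move=> vp; have : neg_part (range v) (v p) by split=> //; exists p.
    by rewrite sE.
  apply: (@cond_b2_b3_of_bounded H P phi v s N) => // p.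
  have [vp|] := ltP (v p) 0; last by rewrite /N; lia.
  have := @leq_bigmax_seq _ s predT (fun c : int => `|c|%N) _ (neg p vp) isT.
  by rewrite /N /=; lia.
case: c => [pos|]; last exact: bounded.
(* If it is the positive classes that are finite in number, all signs are changed. *)
apply: (bounded (fun p => - w p)); first by rewrite wt0_opp.
apply: (@sub_finite_set _ _ [set - c | c in pos_part GP]); last exact: finite_image.
move=> _ [[p _ <-] /= wp]; exists (w p) => //; split; [by exists p|rewrite /=; lia].
Qed.

End Conditions.

Theorem theorem5p2 (H : cmonoidType) (P : choiceType)
  (phi : {additive H -> {mset P}}) (theta : {additive class_group phi -> int})
  (H_krull : krull H) (phi_div : divisor_hom phi) (phi_cof : cofinal_hom phi)
  (theta_bij : bijective theta) :
  let GP : set int := [set theta (divisor_class phi [mset p]) | p in [set: P]] in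
  [/\ cond_a GP -> [/\ cond_b1 H GP, cond_b2 H, cond_b3 H & cond_b4 H],
      [/\ cond_b1 H GP -> cond_c GP, cond_b2 H -> cond_c GP,
          cond_b3 H -> cond_c GP & cond_b4 H -> cond_c GP] &
      (cond_b2 H -> cond_b3 H) /\ (cond_b3 H -> cond_b4 H)].
Proof.
have phiw := phi_image_class_weight phi_div (bij_inj theta_bij).
move=> GP; have b34 := cond_b3_b4 phi_div; have b23 := cond_b2_b3 phi_div phiw.
have b4c := cond_b4_c phi_div phiw.
split.
- move=> a; have b2 := cond_a_b2 phi_div phiw a.
  by split; [exact: cond_a_b1 phi_div phiw a| |exact: b23|exact/b34/b23].
- split; [exact: cond_b1_c| | |by []].
    by move=> b2; apply/b4c/b34/b23.
  by move=> b3; apply/b4c/b34.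
- by [].
Qed.
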